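(* There is an algorithm which, given an octagonal constraint $R(\mathbf{x},\mathbf{x}')$ with $\mathbf{x}=\{x_1,\dots,x_N\}$, $N\ge1$, defining a relation $R\subseteq\mathbb{Z}^{\mathbf{x}}\times\mathbb{Z}^{\mathbf{x}}$, decides whether $R$ is well founded in time at most $\mathcal{O}\big(N^4\cdot(N+\log_2\mu(R))\big)$.
   Context: $\mathbb{Z}^{\mathbf{x}}$ is the set of valuations $\nu:\mathbf{x}\to\mathbb{Z}$; $\mathbf{x}'=\{x_1',\dots,x_N'\}$ are primed copies. A formula over unprimed and primed variables defines a relation on $\mathbb{Z}^{\mathbf{x}}$ by evaluating unprimed variables with the first valuation and primed ones with the second. An octagonal constraint over a set of integer variables is a finite conjunction of atoms $u-v\le c$, $u+v\le c$, $-u-v\le c$, with $u,v$ variables (possibly equal) and $c\in\mathbb{Z}$; $\mu(R)$ is the maximal absolute value of the constants $c$ occurring in $R(\mathbf{x},\mathbf{x}')$. $R$ is well founded if there is no infinite sequence of valuations $\nu_0,\nu_1,\nu_2,\dots$ with $(\nu_i,\nu_{i+1})\in R$ for all $i\ge0$. Time is measured in bit operations, with constants written in binary.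
   Formalization: The time bound is stated for constraints with at most one bound per left-hand side (correctness for all), since a conjunction with arbitrarily many atoms cannot be read in time bounded in N and μ(R) as claimed; log₂ μ(R) is rounded down and taken as 0 when μ(R)=0. *)

(* Defs.v *)
From HB Require Import structures.
From mathcomp Require Import all_boot all_order all_algebra.
Set Implicit Arguments.
Unset Strict Implicit.
Unset Printing Implicit Defensive.
Import GRing.Theory Num.Theory.
Local Open Scope ring_scope.

Definition valuation (N : nat) := 'I_N -> int.

(* inl i is x_i, inr i is its primed copy x_i' *)
Definition var (N : nat) : Type := ('I_N + 'I_N)%type.

Inductive shape := Diff | Plus | OppPlus.

Definition shape_code (s : shape) : nat :=
  match s with Diff => 0 | Plus => 1 | OppPlus => 2 end.
Definition shape_decode (n : nat) : option shape :=
  match n with 0 => Some Diff | 1 => Some Plus | 2 => Some OppPlus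
  | _ => None end%N.
Lemma shape_codeK : pcancel shape_code shape_decode.
Proof. by case. Qed.
HB.instance Definition _ := Equality.copy shape (pcan_type shape_codeK).

Record atom (N : nat) := Atom {
  lhs : shape * (var N * var N);
  rhs : int
}.

Definition octagon (N : nat) := seq (atom N).

Definition eval_var N (nu nu' : valuation N) (u : var N) : int :=
  match u with inl i => nu i | inr i => nu' i end.

Definition eval_lhs N (nu nu' : valuation N)
    (l : shape * (var N * var N)) : int :=
  let: (s, (u, v)) := l in
  let a := eval_var nu nu' u in
  let b := eval_var nu nu' v in
  match s with
  | Diff => a - b
  | Plus => a + b
  | OppPlus => - a - b
  end.

Definition oct_rel N (R : octagon N) (nu nu' : valuation N) : Prop :=
  all (fun a => eval_lhs nu nu' (lhs a) <= rhs a) R.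

Definition well_founded_rel N (r : valuation N -> valuation N -> Prop) : Prop :=
  ~ exists nu : nat -> valuation N, forall i : nat, r (nu i) (nu i.+1).

Definition mu N (R : octagon N) : nat := (\max_(a <- R) `|rhs a|)%N.

(* At most one bound for each left-hand side (as in the difference bound matrix
   representation), which makes the number of atoms at most 12 N^2.  Without it
   the length of a conjunction is not bounded in terms of N and mu, and no time
   bound in N and mu alone could cover reading the input. *)
Definition one_bound_per_lhs N (R : octagon N) : bool :=
  uniq [seq lhs a | a <- R].

(* The model of computation: structured programs for a random access machine
   whose cells, indexed by int, hold unbounded integers.  Time is the
   logarithmic cost, which accounts for bit operations: every operation is
   charged the binary lengths of the integers it touches, addresses included.
   The arithmetic primitives all have linear bit complexity (there is no
   multiplication or general division). *)
Definition memory := int -> int.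

Definition upd (m : memory) (x v : int) : memory :=
  fun y => if y == x then v else m y.

Definition bitlen (z : int) : nat := (trunc_log 2 `|z|).+1.

Inductive expr :=
| Cst of int
| Get of expr
| Add of expr & expr
| Sub of expr & expr
| Half of expr.

Fixpoint eval (m : memory) (e : expr) : int :=
  match e with
  | Cst z => z
  | Get e1 => m (eval m e1)
  | Add e1 e2 => eval m e1 + eval m e2
  | Sub e1 e2 => eval m e1 - eval m e2
  | Half e1 => (eval m e1 %/ 2)%Z (* rounded towards -oo *)
  end.

Fixpoint cost (m : memory) (e : expr) : nat :=
  match e with
  | Cst z => bitlen z
  | Get e1 =>
      (cost m e1 + bitlen (eval m e1) + bitlen (m (eval m e1)))%N
  | Add e1 e2 | Sub e1 e2 =>
      (cost m e1 + cost m e2 + bitlen (eval m e1) + bitlen (eval m e2))%N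
  | Half e1 => (cost m e1 + bitlen (eval m e1))%N
  end.

Inductive com :=
| Skip
| Put of expr & expr (* Put a e writes the value of e at address a *)
| Seq of com & com
| IfPos of expr & com & com
| WhilePos of expr & com.

(* exec c m t m' : started in memory m, c halts in memory m' after time t *)
Inductive exec : com -> memory -> nat -> memory -> Prop :=
| ExecSkip m : exec Skip m 1 m
| ExecPut m a e :
    exec (Put a e) m
      (cost m a + cost m e + bitlen (eval m a) + bitlen (eval m e))%N
      (upd m (eval m a) (eval m e))
| ExecSeq m m1 m2 c1 c2 t1 t2 :
    exec c1 m t1 m1 -> exec c2 m1 t2 m2 ->
    exec (Seq c1 c2) m (t1 + t2)%N m2
| ExecIfTrue m m1 e c1 c2 t :
    0 < eval m e -> exec c1 m t m1 ->
    exec (IfPos e c1 c2) m (cost m e + bitlen (eval m e) + t)%N m1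
| ExecIfFalse m m1 e c1 c2 t :
    eval m e <= 0 -> exec c2 m t m1 ->
    exec (IfPos e c1 c2) m (cost m e + bitlen (eval m e) + t)%N m1
| ExecWhileTrue m m1 m2 e c t1 t2 :
    0 < eval m e -> exec c m t1 m1 -> exec (WhilePos e c) m1 t2 m2 ->
    exec (WhilePos e c) m (cost m e + bitlen (eval m e) + t1 + t2)%N m2
| ExecWhileFalse m e c :
    eval m e <= 0 ->
    exec (WhilePos e c) m (cost m e + bitlen (eval m e))%N m.

(* x_i is numbered i and x_i' is numbered N + i, for i < N. *)
Definition var_code N (u : var N) : int :=
  match u with inl i => (i : nat)%:Z | inr i => (N + i)%N%:Z end.

Definition atom_code N (a : atom N) : seq int :=
  let: (s, (u, v)) := lhs a in
  [:: (shape_code s)%:Z; var_code u; var_code v; rhs a].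

Definition input_code N (R : octagon N) : seq int :=
  [:: N%:Z, (size R)%:Z & flatten [seq atom_code a | a <- R]].

(* The input occupies cells 0, 1, 2, ...; all other cells contain 0. *)
Definition input_mem N (R : octagon N) : memory :=
  fun x => if x is Posz k then nth 0 (input_code R) k else 0.

(* Main.v *)
(* View an octagonal constraint as a weighted graph on signed variables +x, -x.
   The n-th power of R is then governed by the shortest walks in the unfolding
   of this graph over layers 0, ..., n.  Squaring a matrix of shortest walks
   costs one Floyd-Warshall closure.  Over the integers the closure is
   consistent if and only if there is no negative cycle and the bounds on each
   x + x leave room for an integer; then every partial integer solution of the
   closed matrix extends, so no tightening is needed.

   After 4N squarings n = 2^(4N) >= 3^(2N).  If R has an infinite run, a walk
   between vertices of layer 0 that goes deeper than 3^(2N) crosses two layers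
   with the same net flow (-1, 0 or 1 at each of the 2N vertices).  The part in
   between can be repeated along the run, so its weight is nonnegative, and it
   can be cut out.  Hence the bounds on the domain no longer change between n
   and 2n.  Conversely, if powers n and 2n have the same nonempty domain, each
   point of it has a successor in it, and R has an infinite run.  So R is well
   founded if and only if some power is inconsistent or the bounds on the
   domain still change at the last squaring.

   Entries are weights of simple walks, hence of bit length O(N + log mu). *)
From HB Require Import structures.
From mathcomp Require Import all_boot all_order all_algebra zify.
From Stdlib Require Import IndefiniteDescription.
Require Import Defs.
Set Implicit Arguments.
Unset Strict Implicit.
Unset Printing Implicit Defensive.
Import Order.TTheory GRing.Theory Num.Theory.
Local Open Scope ring_scope.

(** * Walks in the unfolding and the cutting argument *)

(** A run enters the cutting argument only as an integer potential [z] on all layers. A multiset of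
    edges weighs at least the sum of its potential drops, and this sum depends only on the net
    outflow at each vertex. So repeating the middle part requires no new walk: it is enough to read
    [z] further up. What remains after a cut need not be a walk, since equal net flows can be joined
    in different ways; hence multisets of edges with prescribed [balance] replace walks, and a walk
    is extracted at the end. The matrix of the first power lists single edges and is not closed, so
    the invariants come in two strengths: [power_matrix] holds from the start, [exact_matrix] after
    a squaring. The time bound is a product: O(N) squarings of O(N^3) primitive steps each, and O(N
    + log mu) per step, because one bound [B] of that bit length holds for all cells. A closure may
    inflate intermediate entries by 2^(6N), but its result consists of walk weights again, so the
    inflation does not accumulate. *)

Definition edge : Type := (nat * nat * int)%type.
Definition tedge : Type := (nat * edge)%type.

(** Vertex [2i] stands for the variable numbered [i] and [2i + 1] for its negation; [bar] exchanges
    the two. *)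
Definition bar (x : nat) : nat := if odd x then x.-1 else x.+1.

Lemma barK : involutive bar.
Proof.
move=> x; rewrite /bar; case ox: (odd x); last by rewrite /= ox.
by case: x ox => //= x /negbTE ->.
Qed.

Definition coherent (v : nat -> int) := forall x, v (bar x) = - v x.

Section Unfolding.
Variables (q : nat) (es : seq edge).

(** The ends of a template edge are below [q + q]: those below [q] lie in the current layer, the
    others in the next. At level [l] both ends move by [q * l], so layer [l] starts at vertex
    [q * l]. *)
Definition src (a : tedge) : nat := (a.2.1.1 + q * a.1)%N.
Definition dst (a : tedge) : nat := (a.2.1.2 + q * a.1)%N.
Definition wt (p : seq tedge) : int := \sum_(a <- p) a.2.2.
Definition shift (k : nat) (a : tedge) : tedge := ((a.1 + k)%N, a.2).

Fixpoint walk (x : nat) (p : seq tedge) (y : nat) : bool :=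
  if p is a :: p' then (src a == x) && walk (dst a) p' y else x == y.

Definition unfolded (n : nat) (p : seq tedge) : bool :=
  all (fun a => (a.1 < n)%N && (a.2 \in es)) p.

(** With [d] an upper bound instead of the exact weight, distances need neither a minimum nor a
    value for infinity. *)
Definition reach (n x y : nat) (d : int) : Prop :=
  exists p, [/\ unfolded n p, walk x p y & wt p <= d].

Definition sat (n : nat) (v : nat -> int) : Prop :=
  forall a : tedge, (a.1 < n)%N -> a.2 \in es -> v (src a) - v (dst a) <= a.2.2.

Lemma wt_nil : wt [::] = 0. Proof. exact: big_nil. Qed.
Lemma wt_cons a p : wt (a :: p) = a.2.2 + wt p. Proof. exact: big_cons. Qed.
Lemma wt_cat p1 p2 : wt (p1 ++ p2) = wt p1 + wt p2. Proof. exact: big_cat. Qed.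

Lemma unfolded_cat n p1 p2 :
  unfolded n (p1 ++ p2) = unfolded n p1 && unfolded n p2.
Proof. exact: all_cat. Qed.

Lemma walk_cat x p1 y p2 z : walk x p1 y -> walk y p2 z -> walk x (p1 ++ p2) z.
Proof.
elim: p1 x => [|a p1 IH] x /=; first by move/eqP->.
by case/andP=> -> /IH h /h.
Qed.

Lemma unfoldedW n m p : (n <= m)%N -> unfolded n p -> unfolded m p.
Proof.
move=> nm; apply: sub_all => a /andP[h ->].
by rewrite (leq_trans h nm).
Qed.

Lemma reach_refl n x d : 0 <= d -> reach n x x d.
Proof. by move=> d0; exists [::]; rewrite /= eqxx wt_nil. Qed.

Lemma reachW n x y d d' : d <= d' -> reach n x y d -> reach n x y d'.
Proof. by move=> dd' [p [u w h]]; exists p; split=> //; apply: le_trans dd'. Qed.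

Lemma reach_mono n m x y d : (n <= m)%N -> reach n x y d -> reach m x y d.
Proof. by move=> nm [p [u w h]]; exists p; split=> //; apply: unfoldedW u. Qed.

Lemma reach_trans n x y z d d' :
  reach n x y d -> reach n y z d' -> reach n x z (d + d').
Proof.
move=> [p [u w h]] [p' [u' w' h']]; exists (p ++ p').
by rewrite unfolded_cat u u' (walk_cat w w') wt_cat lerD.
Qed.

Lemma reach_edge n (a : tedge) :
  (a.1 < n)%N -> a.2 \in es -> reach n (src a) (dst a) a.2.2.
Proof.
by move=> h1 h2; exists [:: a]; rewrite /= h1 h2 !eqxx wt_cons wt_nil addr0.
Qed.

Lemma src_shift k a : src (shift k a) = (src a + q * k)%N.
Proof. rewrite /src /shift /=; lia. Qed.
Lemma dst_shift k a : dst (shift k a) = (dst a + q * k)%N.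
Proof. rewrite /dst /shift /=; lia. Qed.

Lemma wt_shift k p : wt (map (shift k) p) = wt p.
Proof. by rewrite /wt big_map. Qed.

Lemma walk_shift k x p y :
  walk (x + q * k) (map (shift k) p) (y + q * k) = walk x p y.
Proof.
elim: p x => [|a p IH] x /=; first by rewrite eqn_add2r.
by rewrite src_shift dst_shift eqn_add2r IH.
Qed.

Lemma unfolded_shift n k p : unfolded n p -> unfolded (n + k) (map (shift k) p).
Proof.
move=> u; rewrite /unfolded all_map; apply: sub_all u => a /= /andP[h ->].
by rewrite ltn_add2r h.
Qed.

Lemma reach_shift n k x y d :
  reach n x y d -> reach (n + k) (x + q * k) (y + q * k) d.
Proof.
move=> [p [u w h]]; exists (map (shift k) p).
by rewrite walk_shift wt_shift unfolded_shift.
Qed.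

Lemma sat_shift n k v : sat (n + k) v -> sat n (fun x => v (x + q * k)%N).
Proof.
move=> s a h e; have := s (shift k a); rewrite src_shift dst_shift /=.
by rewrite ltn_add2r; apply.
Qed.

Lemma sat_sum n v p : sat n v -> unfolded n p ->
  \sum_(a <- p) (v (src a) - v (dst a)) <= wt p.
Proof.
move=> s; elim: p => [|a p IH]; first by rewrite wt_nil big_nil.
move=> /= /andP[/andP[h1 h2] u]; rewrite wt_cons big_cons lerD ?IH //.
exact: s.
Qed.

Lemma walk_sum (v : nat -> int) x p y : walk x p y ->
  \sum_(a <- p) (v (src a) - v (dst a)) = v x - v y.
Proof.
elim: p x => [|a p IH] x /=; first by move/eqP->; rewrite big_nil subrr.
by case/andP=> /eqP <- /IH; rewrite big_cons => ->; lia.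
Qed.

Lemma sat_walk n v x p y : sat n v -> unfolded n p -> walk x p y ->
  v x - v y <= wt p.
Proof. by move=> s u /(walk_sum v) <-; apply: sat_sum u. Qed.

Lemma sat_reach n v x y d : sat n v -> reach n x y d -> v x - v y <= d.
Proof. by move=> s [p [u w h]]; exact: le_trans (sat_walk s u w) h. Qed.

Lemma walk_split x p1 p2 y : walk x (p1 ++ p2) y ->
  exists z, walk x p1 z /\ walk z p2 y.
Proof.
elim: p1 x => [|a p1 IH] x /=; first by exists x.
by case/andP=> /eqP <- /IH [z []] ; exists z; rewrite eqxx.
Qed.

(* A closed walk has nonnegative weight as soon as a potential exists, so
   cycles can be cut out. *)
Lemma simple_walk n v x p y : sat n v -> unfolded n p -> walk x p y ->
  exists p', [/\ unfolded n p', walk x p' y, wt p' <= wt p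
               & uniq (x :: map dst p')].
Proof.
move=> s; elim: p x => [|a p IH] x; first by move=> *; exists [::].
move=> /= /andP[/andP[h1 h2] u] /andP[/eqP sa w].
have [p' [u' w' le' un']] := IH _ u w.
have [xin|xnin] := boolP (x \in map dst (a :: p')); last first.
  exists (a :: p'); rewrite /= h1 h2 sa eqxx; split=> //.
    by rewrite !wt_cons lerD2l.
  by move: xnin un' => /= -> ->.
have [b bin xb] := mapP xin.
have w2 : walk x (a :: p') y by rewrite /= sa eqxx w'.
have u2 : unfolded n (a :: p') by rewrite /= h1 h2.
have un2 : uniq (map dst (a :: p')) := un'.
have le2 : wt (a :: p') <= wt (a :: p) by rewrite !wt_cons lerD2l.
move: (a :: p') bin w2 u2 un2 le2 => r bin.
case/splitPr: bin => p1 p2 w2 u2 un2 le2.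
rewrite -cat_rcons in w2 u2 un2 le2.
have [z [w3 w4]] := walk_split w2.
have zx : z = x.
  move: w3; rewrite -cats1 => /walk_split[z' [_ /=]].
  by rewrite xb => /andP[_ /eqP].
subst z; move: u2; rewrite unfolded_cat => /andP[u3 u4].
exists p2; split=> //.
  have := sat_walk s u3 w3; rewrite subrr => c0.
  by apply: le_trans le2; rewrite wt_cat lerDr.
by move: un2; rewrite map_cat map_rcons cat_rcons cat_uniq xb => /and3P[].
Qed.

(** The boundary of [F] as a flow. It ignores the order of the edges, so parts of a walk can be
    removed, moved and recombined. *)
Definition balance (F : seq tedge) (u : nat) : int :=
  (count (fun a => src a == u) F)%:Z - (count (fun a => dst a == u) F)%:Z.

Lemma balance_cat F1 F2 u : balance (F1 ++ F2) u = balance F1 u + balance F2 u.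
Proof. by rewrite /balance !count_cat !PoszD opprD addrACA. Qed.

Lemma balance_cons a F u :
  balance (a :: F) u = (src a == u)%:Z - (dst a == u)%:Z + balance F u.
Proof. by rewrite -cat1s balance_cat /balance /= !addn0. Qed.

Lemma balance_walk x p y u : walk x p y ->
  balance p u = (x == u)%:Z - (y == u)%:Z.
Proof.
elim: p x => [|a p IH] x /=; first by move/eqP->; rewrite subrr.
by case/andP=> /eqP <- /IH h; rewrite balance_cons h addrA subrK.
Qed.

Lemma balance_perm F G u : perm_eq F G -> balance F u = balance G u.
Proof. by move/permP => h; rewrite /balance !h. Qed.

Lemma balance_shift k F u :
  balance (map (shift k) F) (u + q * k) = balance F u.
Proof.
rewrite /balance !count_map; congr (Posz _ - Posz _).
  by apply: eq_count => a /=; rewrite src_shift eqn_add2r.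
by apply: eq_count => a /=; rewrite dst_shift eqn_add2r.
Qed.

Lemma balance_out F u : (forall a, a \in F -> src a != u /\ dst a != u) ->
  balance F u = 0.
Proof.
move=> h; rewrite /balance.
rewrite (@eq_in_count _ _ pred0) ?(@eq_in_count _ (fun a => dst a == u) pred0).
- by rewrite count_pred0.
- by move=> a /h[_ /negbTE].
- by move=> a /h[/negbTE].
Qed.

(** Summation by parts: [v u] is counted once for each edge leaving [u] and minus once for each edge
    entering it. *)
Lemma sum_balance F U (v : nat -> int) :
  (forall a, a \in F -> (src a < U)%N /\ (dst a < U)%N) ->
  \sum_(a <- F) (v (src a) - v (dst a)) = \sum_(u < U) balance F u * v u.
Proof.
elim: F => [|a F IH] h.
  by rewrite big_nil big1 // => u _; rewrite /balance subrr mul0r.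
rewrite big_cons IH; last by move=> b bF; apply: h; rewrite inE bF orbT.
have [sU dU] := h a (mem_head _ _).
under [RHS]eq_bigr => u _ do rewrite balance_cons mulrDl mulrBl.
rewrite big_split sumrB /=; congr (_ - _ + _).
  rewrite (bigD1 (Ordinal sU)) //= eqxx mul1r big1 ?addr0 // => u.
  by rewrite -val_eqE /= eq_sym => /negbTE ->; rewrite mul0r.
rewrite (bigD1 (Ordinal dU)) //= eqxx mul1r big1 ?addr0 // => u.
by rewrite -val_eqE /= eq_sym => /negbTE ->; rewrite mul0r.
Qed.

Lemma sum_balance_eq F G (v : nat -> int) : balance F =1 balance G ->
  \sum_(a <- F) (v (src a) - v (dst a)) = \sum_(a <- G) (v (src a) - v (dst a)).
Proof.
move=> e; pose U := (\max_(a <- F ++ G) maxn (src a) (dst a)).+1.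
have h a : a \in F ++ G -> (src a < U)%N /\ (dst a < U)%N.
  move=> aF; have := @leq_bigmax_seq _ (F ++ G) xpredT (fun a => maxn (src a) (dst a)) a aF isT.
  by rewrite geq_max => /andP[].
rewrite !(@sum_balance _ U); last 2 first.
- by move=> a aG; apply: h; rewrite mem_cat aG orbT.
- by move=> a aF; apply: h; rewrite mem_cat aF.
by apply: eq_bigr => u _; rewrite e.
Qed.

(* Follow the flow from its source, one edge at a time; what remains when the
   sink is reached is a circulation, whose weight is nonnegative. *)
Lemma flow_reach n v F x y : sat n v -> unfolded n F ->
  (forall u, balance F u = (x == u)%:Z - (y == u)%:Z) -> reach n x y (wt F).
Proof.
move=> s; have [k] := ubnP (size F); elim: k F x y => // k IH F x y szF uF bF.
have [xy|xNy] := eqVneq x y.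
  rewrite -xy; apply: reach_refl; apply: le_trans (sat_sum s uF).
  rewrite (@sum_balance_eq _ [::]) ?big_nil // => u.
  by rewrite bF xy /balance /= !subrr.
have /hasP[a aF /eqP ax] : has (fun a => src a == x) F.
  have := bF x; rewrite eqxx eq_sym (negbTE xNy) /balance subr0 has_count.
  by case: count => // h; have := le0z_nat (count (fun a => dst a == x) F); lia.
have pF := perm_to_rem aF.
have : unfolded n (a :: rem a F) by rewrite /unfolded -(perm_all _ pF).
move=> /= /andP[/andP[a1 a2] u'].
have -> : wt F = a.2.2 + wt (rem a F) by rewrite -wt_cons; apply: perm_big.
have := reach_edge a1 a2; rewrite ax => r; apply: reach_trans r _.
apply: IH => // [|u].
  by rewrite -ltnS -(ltn_predK szF) ltnS; move: szF; rewrite (perm_size pF).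
apply: (addrI ((src a == u)%:Z - (dst a == u)%:Z)).
by rewrite -balance_cons -(balance_perm _ pF) bF ax addrA subrK.
Qed.

Hypothesis es_lt : forall e, e \in es -> (e.1.1 < q + q)%N /\ (e.1.2 < q + q)%N.

(** Layer [l] is touched from below by edges of level [l - 1] and from above by edges of level [l].
    The balance of [deep l F] on this layer is the net flow across the cut. *)
Definition deep (l : nat) (F : seq tedge) := [seq a <- F | (l <= a.1)%N].
Definition shallow (l : nat) (F : seq tedge) := [seq a <- F | ~~ (l <= a.1)%N].

Lemma vertex_lo (a : tedge) l : (l <= a.1)%N ->
  (q * l <= src a)%N /\ (q * l <= dst a)%N.
Proof.
move=> h; have : (q * l <= q * a.1)%N by rewrite leq_mul2l h orbT.
by rewrite /src /dst => h'; split; apply: leq_trans h' _; apply: leq_addl.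
Qed.

Lemma vertex_hi (a : tedge) l : a.2 \in es -> (a.1 < l)%N ->
  (src a < q * l.+1)%N /\ (dst a < q * l.+1)%N.
Proof.
move=> /es_lt[h1 h2] h; have : (q * a.1.+2 <= q * l.+1)%N.
  by rewrite leq_mul2l ltnS h orbT.
rewrite /src /dst !mulnSr => h'.
by split; apply: leq_trans h'; rewrite addnC -addnA ltn_add2l.
Qed.

Lemma perm_deep l F : perm_eq F (deep l F ++ shallow l F).
Proof. by rewrite perm_sym (perm_filterC (fun a : tedge => (l <= a.1)%N)). Qed.

Lemma deep_balance_lo l F u : (u < q * l)%N -> balance (deep l F) u = 0.
Proof.
move=> ul; apply: balance_out => a; rewrite mem_filter => /andP[/vertex_lo[h1 h2] _].
by rewrite !neq_ltn !(leq_trans ul) ?orbT.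
Qed.

(** Edges of level below [l] have no end beyond layer [l], so there the deep part carries the whole
    balance. *)
Lemma deep_balance_hi n l F u : unfolded n F -> (q * l.+1 <= u)%N ->
  balance (deep l F) u = balance F u.
Proof.
move=> uF ul; rewrite (balance_perm u (perm_deep l F)) balance_cat.
rewrite (@balance_out (shallow l F)) ?addr0 // => a.
rewrite mem_filter -ltnNge => /andP[la /(allP uF)/andP[_ ae]].
by have [h1 h2] := vertex_hi ae la; rewrite !neq_ltn !(leq_trans _ ul).
Qed.

Lemma count_src_walk (P : pred nat) x p y : walk x p y ->
  (count (fun a => P (src a)) p + P y)%N = (P x + count (fun a => P (dst a)) p)%N.
Proof.
elim: p x => [|a p IH] x /=; first by move/eqP->; rewrite addnC.
by case/andP=> /eqP <- /IH h; rewrite -addnA h addnCA.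
Qed.

(** A simple walk enters and leaves each vertex at most once, and selecting edges by [Q] only lowers
    both counts. *)
Lemma walk_balance_bound x p y (Q : pred tedge) u :
  walk x p y -> uniq (x :: map dst p) -> `|balance (filter Q p) u| <= 1.
Proof.
move=> w un; have c1 : (count (fun a => dst a == u) (filter Q p) <= 1)%N.
  rewrite count_filter; apply: leq_trans (_ : count_mem u (map dst p) <= 1)%N.
    by rewrite count_map; apply: sub_count => a /= /andP[].
  by move: un => /= /andP[_ /count_uniq_mem ->]; case: (_ \in _).
have c2 : (count (fun a => src a == u) (filter Q p) <= 1)%N.
  rewrite count_filter; apply: leq_trans (_ : count (fun a => src a == u) p <= 1)%N.
    by apply: sub_count => a /= /andP[].
  have := count_src_walk (pred1 u) w.
  have -> : (pred1 u x + count (fun a => pred1 u (dst a)) p)%N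
            = count_mem u (x :: map dst p) by rewrite /= count_map.
  rewrite count_uniq_mem // => h; apply: leq_trans (leq_b1 (u \in x :: map dst p)).
  by rewrite -h leq_addr.
rewrite /balance; move: c1 c2; case: (count _ _) => [|[]] //; by case: (count _ _) => [|[]].
Qed.

(** Codes the balances -1, 0 and 1 in a type with three elements, for the pigeonhole count
    [3 ^ q]. *)
Definition sign_code (c : int) : option bool :=
  if c == 1 then Some true else if c == -1 then Some false else None.

Lemma sign_code_inj c c' : `|c| <= 1 -> `|c'| <= 1 ->
  sign_code c = sign_code c' -> c = c'.
Proof.
rewrite /sign_code => h h'; do 4 ?[case: eqVneq => [->|?]] => //; lia.
Qed.

Section Periodic.
Variables (z : nat -> int) (F : seq tedge) (m l k : nat).
Hypotheses (satz : forall n, sat n z) (uF : unfolded m F).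
Hypothesis per : balance (deep (l + k) F) =1 balance (map (shift k) (deep l F)).

Let mid := shallow (l + k) (deep l F).
(** Potential drop along [D] moved up by [i] layers; shifting the argument of [z] leaves the edges
    in place. *)
Let S i (D : seq tedge) := \sum_(a <- D) (z (src a + q * i)%N - z (dst a + q * i)%N).

Lemma perm_mid : perm_eq (deep l F) (deep (l + k) F ++ mid).
Proof.
have -> : deep (l + k) F = deep (l + k) (deep l F).
  rewrite /deep -filter_predI; apply: eq_filter => a /=.
  by case: leqP => //= h; rewrite (leq_trans (leq_addr k l) h).
exact: perm_deep.
Qed.

Lemma unfolded_filter n (P : pred tedge) D : unfolded n D -> unfolded n (filter P D).
Proof. by move=> h; rewrite /unfolded all_filter; apply: sub_all h => a /= ->; rewrite implybT. Qed.

Lemma S_le i n D : unfolded n D -> S i D <= wt D.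
Proof. exact: (sat_sum (sat_shift (@satz (n + i)))). Qed.

(** The deep part is the middle part plus edges with the same balance as the deep part moved up by
    [k]. The drop along the middle is at most its weight, and the drop along the rest sees only the
    balance. *)
Lemma S_step i : S i (deep l F) <= wt mid + S (i + k) (deep l F).
Proof.
have -> : S i (deep l F) = S i mid + S i (deep (l + k) F).
  by rewrite addrC -big_cat; apply: perm_big; apply: perm_mid.
apply: lerD; first exact/S_le/unfolded_filter/unfolded_filter/uF.
rewrite {1}/S (sum_balance_eq (fun u => z (u + q * i)%N) per) big_map.
rewrite le_eqVlt; apply/orP; left; apply/eqP; apply: eq_bigr => a _.
by rewrite src_shift dst_shift mulnDr !addnA -!(addnAC _ (q * i)%N).
Qed.

(** By [S_step], a fixed number is at most [i] times the middle weight plus [wt (deep l F)], for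
    every [i]. A negative middle weight violates this once [i] exceeds the gap between the two fixed
    numbers. *)
Lemma wt_mid_ge0 : 0 <= wt mid.
Proof.
have h i : S 0 (deep l F) <= wt mid *+ i + S (k * i) (deep l F).
  elim: i => [|i IH]; first by rewrite muln0 mulr0n add0r.
  apply: le_trans IH _; rewrite mulrSr -addrA lerD2l mulnSr.
  exact: S_step.
rewrite leNgt; apply/negP => neg.
have W i : S 0 (deep l F) <= wt mid *+ i + wt (deep l F).
  by apply: le_trans (h i) _; rewrite lerD2l; apply/S_le/unfolded_filter/uF.
have := W `|wt (deep l F) - S 0 (deep l F)|.+1%N.
move: (wt mid) neg (S 0 _) (wt (deep l F)) => w w0 s t.
by rewrite -mulr_natr; nia.
Qed.

Lemma wt_cut : wt (deep (l + k) F) <= wt (deep l F).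
Proof.
have -> : wt (deep l F) = wt (deep (l + k) F) + wt mid.
  by rewrite -wt_cat; apply: perm_big; apply: perm_mid.
by rewrite lerDl wt_mid_ge0.
Qed.

End Periodic.

Definition unshift (k : nat) (a : tedge) : tedge := ((a.1 - k)%N, a.2).

Lemma unshiftK k l F : (k <= l)%N ->
  map (shift k) (map (unshift k) (deep l F)) = deep l F.
Proof.
move=> kl; rewrite -map_comp -[RHS]map_id; apply/eq_in_map => -[i e].
rewrite mem_filter /= => /andP[li _].
by rewrite /shift /unshift /= subnK // (leq_trans kl).
Qed.

Lemma cut_reach z m x y d : (forall n, sat n z) -> (x < q)%N -> (y < q)%N ->
  (3 ^ q < m)%N -> reach m x y d -> exists2 m', (m' < m)%N & reach m' x y d.
Proof.
move=> satz xq yq qm [p0 [u0 w0 le0]].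
have [F [uF wF leF unF]] := simple_walk (satz m) u0 w0.
have bF u : balance F u = (x == u)%:Z - (y == u)%:Z by apply: balance_walk.
have bF0 u : (q <= u)%N -> balance F u = 0.
  move=> qu; rewrite bF !ltn_eqF ?subrr //; exact: leq_trans qu.
(* The cuts are at layers 1 to [m]: the endpoints [x] and [y] lie in layer 0, so beyond any cut [F]
   has balance 0. *)
pose f (i : 'I_m) : {ffun 'I_q -> option bool} :=
  [ffun u : 'I_q => sign_code (balance (deep i.+1 F) (u + q * i.+1)%N)].
have /injectivePn[i0 [j0 ij0 fij0]] : ~~ injectiveb f.
  apply/negP => /injectiveP /leq_card.
  by rewrite card_ffun card_option card_bool !card_ord leqNgt qm.
have [i [j [ij fij]]] : exists i j : 'I_m, (i < j)%N /\ f i = f j.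
  by move: ij0; rewrite neq_ltn => /orP[]; [exists i0, j0|exists j0, i0].
pose k := (j - i)%N; have jE : (i.+1 + k)%N = j.+1 by rewrite /k; lia.
have per : balance (deep (i.+1 + k) F) =1 balance (map (shift k) (deep i.+1 F)).
  (* Vertex by vertex: below the cut both balances vanish, beyond it both equal the zero balance of
     [F], and on the cut layer they agree by the choice of [i] and [j]. *)
  move=> w; have [wk|kw] := ltnP w (q * k).
    rewrite deep_balance_lo; last by apply: leq_trans wk _; rewrite leq_mul2l leq_addl orbT.
    rewrite balance_out // => a /mapP[b _ ->]; rewrite src_shift dst_shift.
    by rewrite !neq_ltn !(leq_trans wk) ?orbT // leq_addl.
  rewrite -(subnK kw); move: (w - q * k)%N => u {w kw}; rewrite balance_shift.
  have [ul|lu] := ltnP u (q * i.+1).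
    by rewrite !deep_balance_lo // mulnDr ltn_add2r.
  have [ul|ul] := ltnP u (q * i.+2); last first.
    rewrite !(deep_balance_hi uF) //; last by rewrite -addSn mulnDr leq_add2r.
    by rewrite !bF0 //; [|apply: leq_trans (leq_addr _ _)]; apply: leq_trans ul;
      rewrite mulnS leq_addr.
  have uq : (u - q * i.+1 < q)%N by move: ul; rewrite (mulnS q i.+1); lia.
  have /ffunP/(_ (Ordinal uq)) := fij; rewrite !ffunE /= subnK // -jE.
  have -> : (u - q * i.+1 + q * (i.+1 + k) = u + q * k)%N.
    by rewrite mulnDr addnA subnK.
  by move/sign_code_inj => ->//; apply: walk_balance_bound wF unF.
pose Dm := map (unshift k) (deep (i.+1 + k) F).
have DmK : map (shift k) Dm = deep (i.+1 + k) F by apply: unshiftK; rewrite leq_addl.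
exists (m - k)%N; first by move: (ltn_ord j); rewrite /k; lia.
(* The two outer parts together have the boundary of [F] but need not form a walk; [flow_reach]
   extracts one of no larger weight. *)
pose G := shallow i.+1 F ++ Dm.
have wG : wt G <= d.
  apply: le_trans le0; apply: le_trans leF.
  have -> : wt F = wt (deep i.+1 F) + wt (shallow i.+1 F).
    by rewrite -wt_cat; apply: perm_big; apply: perm_deep.
  by rewrite wt_cat addrC lerD2r -(wt_shift k Dm) DmK (wt_cut satz uF per).
apply: reachW wG _; apply: (flow_reach (satz (m - k)%N)).
  rewrite unfolded_cat; apply/andP; split.
    apply/allP => a; rewrite mem_filter -ltnNge => /andP[la /(allP uF)/andP[_ ->]].
    by rewrite andbT; apply: leq_trans la _; move: (ltn_ord j); rewrite /k; lia.
  apply/allP => a /mapP[b]; rewrite mem_filter => /andP[lb /(allP uF)/andP[b1 b2] ->].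
  rewrite /= b2 andbT; have kb : (k <= b.1)%N := leq_trans (leq_addl _ _) lb.
  by rewrite ltn_sub2r // (leq_ltn_trans kb).
move=> u; rewrite -bF (balance_perm u (perm_deep i.+1 F)) !balance_cat addrC.
by rewrite -(balance_shift k Dm) DmK per balance_shift.
Qed.

Lemma reach_bounded z m x y d : (forall n, sat n z) -> (x < q)%N -> (y < q)%N ->
  reach m x y d -> reach (3 ^ q) x y d.
Proof.
move=> satz xq yq; have [b] := ubnP m; elim: b m => // b IH m mb r.
have [mq|qm] := leqP m (3 ^ q)%N; first exact: reach_mono r.
have [m' m'm] := cut_reach satz xq yq qm r.
by apply: IH; apply: leq_trans m'm _; rewrite -ltnS.
Qed.

Lemma unfolded_dst n p a : unfolded n p -> a \in p -> (dst a < q * n.+1)%N.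
Proof. by move=> u /(allP u)/andP[h1 h2]; have [] := vertex_hi h2 h1. Qed.

(** The edges of a simple walk have distinct ends among the [q * n.+1] vertices of layers 0 to [n],
    so there are at most that many. *)
Lemma reach_weight_bound v mu n x y d : sat n v ->
  (forall e, e \in es -> (`|e.2| <= mu)%N) ->
  reach n x y d -> exists d', [/\ reach n x y d', d' <= d & (`|d'| <= q * n.+1 * mu)%N].
Proof.
move=> s bmu [p0 [u0 w0 le0]].
have [p [u w lep un]] := simple_walk s u0 w0.
exists (wt p); split; [by exists p| exact: le_trans le0|].
have : (size p <= q * n.+1)%N.
  rewrite -(size_map dst) -(size_iota 0 (q * n.+1)); apply: uniq_leq_size.
    by case/andP: un.
  by move=> t /mapP[a /(unfolded_dst u) h ->]; rewrite mem_iota.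
move=> sz; apply: leq_trans (leq_mul sz (leqnn mu)) => {sz un w lep}.
elim: p u => [|a p IH]; first by rewrite wt_nil.
case/andP=> /andP[_ /bmu h] /IH h2; rewrite wt_cons /= mulSn.
have aux (i j : int) (b c : nat) : (`|i| <= b -> `|j| <= c -> `|(i + j)%R| <= b + c)%N.
  lia.
exact: aux.
Qed.

End Unfolding.

(** * Matrices, Floyd-Warshall, and integer octagons *)

(** [None] is plus infinity. Entries are handled through the upper bounds [d] that they satisfy, so
    that a minimum becomes a disjunction and a sum a splitting of [d]. *)
Definition ole (o : option int) (d : int) : bool :=
  if o is Some x then x <= d else false.
Definition omin (o1 o2 : option int) : option int :=
  match o1, o2 with
  | Some x, Some y => Some (if y < x then y else x)
  | Some x, None => Some x
  | None, _ => o2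
  end.
Definition oadd (o1 o2 : option int) : option int :=
  match o1, o2 with Some x, Some y => Some (x + y) | _, _ => None end.

Lemma ole_omin o1 o2 d : ole (omin o1 o2) d = ole o1 d || ole o2 d.
Proof.
case: o1 => [x|] //; case: o2 => [y|] //=; last by rewrite orbF.
by case: ltP => h; apply/idP/orP; [right|case|left|case] => //; lia.
Qed.

Lemma ole_oadd o1 o2 d : ole (oadd o1 o2) d ->
  exists a b, [/\ ole o1 a, ole o2 b & d = a + b].
Proof.
case: o1 => [x|] //; case: o2 => [y|] //= h.
by exists x, (d - x); split=> //=; lia.
Qed.

Lemma ole_oaddI o1 o2 a b : ole o1 a -> ole o2 b -> ole (oadd o1 o2) (a + b).
Proof. by case: o1 => [x|] //; case: o2 => [y|] //= h1 h2; rewrite lerD. Qed.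

Lemma oleW o d d' : d <= d' -> ole o d -> ole o d'.
Proof. by move=> h; case: o => //= x /le_trans; apply. Qed.

Definition mat := nat -> nat -> option int.

Definition stage (w : mat) (k : nat) : mat :=
  fun x y => omin (w x y) (oadd (w x k) (w k y)).

Fixpoint fw (w : mat) (n : nat) : mat :=
  if n is k.+1 then stage (fw w k) k else w.

(** Tested for each pivot just before its own stage. If it holds, the stage leaves the row and the
    column of the pivot unchanged. *)
Definition nneg (w : mat) (k : nat) : bool := ~~ ole (w k k) (-1).

Lemma nnegP w k d : nneg w k -> ole (w k k) d -> 0 <= d.
Proof. by rewrite /nneg; case: (w k k) => //= x; lia. Qed.

Lemma stage_col (w : mat) k x : nneg w k -> stage w k x k = w x k.
Proof.
rewrite /nneg /stage; case: (w x k) => [a|] //; case: (w k k) => [b|] //= h.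
by case: ltP => // h'; lia.
Qed.

Lemma stage_row (w : mat) k y : nneg w k -> stage w k k y = w k y.
Proof.
rewrite /nneg /stage; case: (w k k) => [b|]; case: (w k y) => [a|] //= h.
by case: ltP => // h'; lia.
Qed.

Lemma fw_mono w n x y d : ole (w x y) d -> ole (fw w n x y) d.
Proof. by move=> h; elim: n => //= n IH; rewrite ole_omin IH. Qed.

Lemma fw_closed w n k x y a b : (forall l, (l < n)%N -> nneg (fw w l) l) ->
  (k < n)%N -> ole (fw w n x k) a -> ole (fw w n k y) b -> ole (fw w n x y) (a + b).
Proof.
elim: n k x y a b => // n IH k x y a b nn kn.
have {IH} cl := fun k x y a b => IH k x y a b (fun l h => nn l (ltnW h)).
have nnn := nn n (ltnSn n); rewrite /= /stage !ole_omin.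
move: (fw w n) nnn cl => W nW cl.
have rowcol o d : ole (oadd o (W n n)) d -> ole o d.
  move=> /ole_oadd[s [t [h1 /(nnegP nW) h2 ->]]]; apply: oleW h1; lia.
have colrow o d : ole (oadd (W n n) o) d -> ole o d.
  move=> /ole_oadd[s [t [/(nnegP nW) h2 h1 ->]]]; apply: oleW h1; lia.
have [{}kn|->] : (k < n)%N \/ k = n by lia.
  2: {
  move=> h1 h2; apply/orP; right; apply: ole_oaddI.
    by case/orP: h1 => // /rowcol.
  by case/orP: h2 => // /colrow. }
case/orP=> [h1|/ole_oadd[a1 [a2 [h1 h1' ->]]]];
  case/orP=> [h2|/ole_oadd[b1 [b2 [h2 h2' ->]]]]; apply/orP.
- by left; apply: cl h1 h2.
- by right; rewrite addrA; apply: ole_oaddI => //; apply: cl h1 h2.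
- by right; rewrite -addrA; apply: ole_oaddI => //; apply: cl h1' h2.
- right; have h := cl _ _ _ _ _ kn h1' h2.
  have := nnegP nW h => h0; apply: oleW (ole_oaddI h1 h2'); lia.
Qed.

(** [P] abstracts the existence of walks. Negative cycles are allowed, so the conclusion is
    available even at a stage whose pivot fails the test. *)
Lemma fw_sound (P : nat -> nat -> int -> Prop) D w n :
  (forall x y z a b, P x y a -> P y z b -> P x z (a + b)) ->
  (forall x y d, (x < D)%N -> (y < D)%N -> ole (w x y) d -> P x y d) ->
  (n <= D)%N ->
  forall x y d, (x < D)%N -> (y < D)%N -> ole (fw w n x y) d -> P x y d.
Proof.
move=> tr base; elim: n => [|n IH] nD x y d xD yD; first exact: base.
rewrite /= /stage ole_omin => /orP[|/ole_oadd[a [b [h1 h2 ->]]]].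
  by apply: IH => //; apply: ltnW.
by apply: (tr _ n); apply: IH => //; apply: ltnW.
Qed.

Definition obound (b : nat) (o : option int) : bool :=
  if o is Some x then (`|x| <= b)%N else true.

Lemma obound_omin b o1 o2 : obound b o1 -> obound b o2 -> obound b (omin o1 o2).
Proof. by case: o1 => [x|] //; case: o2 => [y|] //=; case: ltP. Qed.

Lemma obound_oadd a b o1 o2 :
  obound a o1 -> obound b o2 -> obound (a + b) (oadd o1 o2).
Proof. by case: o1 => [x|] //; case: o2 => [y|] //=; lia. Qed.

Lemma oboundW a b o : (a <= b)%N -> obound a o -> obound b o.
Proof. by move=> ab; case: o => //= x /leq_trans; apply. Qed.

(** A stage adds at most two entries, so it at most doubles the bound; [n] stages cost [n] bits. *)
Lemma fw_bound b D w n : 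
  (forall x y, (x < D)%N -> (y < D)%N -> obound b (w x y)) ->
  (n <= D)%N ->
  forall x y, (x < D)%N -> (y < D)%N -> obound (2 ^ n * b) (fw w n x y).
Proof.
move=> base; elim: n => [|n IH] nD x y xD yD; first by rewrite mul1n; apply: base.
have {}IH := IH (ltnW nD); rewrite /= /stage expnS -mulnA mul2n -addnn.
apply: obound_omin; last by apply: obound_oadd; apply: IH.
by apply: oboundW (IH _ _ xD yD); apply: leq_addr.
Qed.

(** Helly property in dimension one: the largest lower bound works, or the smallest upper bound if
    there is no lower bound. *)
Lemma int_between (L H : seq int) :
  (forall l h, l \in L -> h \in H -> l <= h) ->
  exists y, (forall l, l \in L -> l <= y) /\ (forall h, h \in H -> y <= h).
Proof.
move=> LH; case: L LH => [|l0 L] LH.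
  elim: H {LH} => [|h0 H [y [_ yH]]]; first by exists 0.
  exists (Num.min h0 y); split=> // h; rewrite inE => /predU1P[->|/yH]; lia.
have : exists y, y \in l0 :: L /\ (forall l, l \in l0 :: L -> l <= y).
  elim: L l0 {LH} => [|l1 L IH] l0.
    by exists l0; split=> [|l]; rewrite inE // => /eqP->.
  have [y [yL Ly]] := IH l1; exists (Num.max l0 y); split.
    by case: (leP l0 y) => _; rewrite inE ?yL ?eqxx ?orbT.
  by move=> l; rewrite inE => /predU1P[->|/Ly]; lia.
by case=> y [yL Ly]; exists y; split=> // h; apply: LH.
Qed.

Lemma half_bar x : (bar x)./2 = x./2.
Proof.
rewrite /bar; case ox: (odd x).
  by rewrite -{1}(odd_double_half x) ox /= doubleK.
by rewrite -{1}(odd_double_half x) ox /= uphalf_double.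
Qed.

Lemma bar_half x y : x./2 = y./2 -> y = x \/ y = bar x.
Proof.
move=> h; rewrite -(odd_double_half x) -(odd_double_half y) -h /bar.
case: (odd x); case: (odd y); rewrite /= ?odd_double /= ?add0n ?add1n; auto.
Qed.

Lemma bar_neq x : bar x != x.
Proof. by rewrite /bar; case: ifP => h; [case: x h => // x _; rewrite ltn_eqF|rewrite gtn_eqF]. Qed.

(* Integer octagons: once the closure has no negative diagonal and each pair of
   opposite unary bounds leaves an integer in between, every partial integer
   solution extends; no further tightening of the matrix is needed. *)
Section Extension.
Variables (T : mat) (r : nat).
Let D := r.*2.
Hypothesis closedT : forall x y z a b, (x < D)%N -> (y < D)%N -> (z < D)%N ->
  ole (T x y) a -> ole (T y z) b -> ole (T x z) (a + b).
Hypothesis coherentT : forall x y d, (x < D)%N -> (y < D)%N ->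
  ole (T x y) d -> ole (T (bar y) (bar x)) d.
Hypothesis diagT : forall x d, (x < D)%N -> ole (T x x) d -> 0 <= d.
Hypothesis unaryT : forall x a b, (x < D)%N ->
  ole (T x (bar x)) a -> ole (T (bar x) x) b -> 0 <= (a %/ 2)%Z + (b %/ 2)%Z.

(** [S] is a set of variables, and a vertex is tested through [x./2], so a vertex and its negation
    are fixed together. *)
Definition sat_on (S : pred nat) (v : nat -> int) := forall x y d,
  (x < D)%N -> (y < D)%N -> S x./2 -> S y./2 -> ole (T x y) d -> v x - v y <= d.

Lemma bar_ltD x : (x < D)%N -> (bar x < D)%N.
Proof. by rewrite -!ltn_half_double half_bar. Qed.

Lemma extend1 S v u : coherent v -> sat_on S v -> (u < r)%N ->
  exists2 v', coherent v' /\ (forall x, S x./2 -> v' x = v x) &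
              sat_on (fun i => S i || (i == u)) v'.
Proof.
move=> cv sv ur; have [Su|nSu] := boolP (S u).
  exists v => // x y d xD yD hx hy; apply: sv => //.
    by case/orP: hx => // /eqP ->.
  by case/orP: hy => // /eqP ->.
pose U := u.*2; have UD : (U < D)%N by rewrite ltn_double.
have BD := bar_ltD UD.
(* Bounds on the new value at [U]: [lo] and [hi] come from vertices already fixed, [lou] and [hiu]
   from the unary constraints on [U], halved and rounded. *)
pose lo x := if S x./2 then omap (fun t => v x - t) (T x U) else None.
pose hi x := if S x./2 then omap (fun t => v x + t) (T U x) else None.
pose lou := if T (bar U) U is Some t then [:: - (t %/ 2)%Z] else [::].
pose hiu := if T U (bar U) is Some t then [:: (t %/ 2)%Z] else [::].
have loP l : l \in pmap lo (iota 0 D) ->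
    exists x t, [/\ (x < D)%N, S x./2, T x U = Some t & l = v x - t].
  rewrite mem_pmap => /mapP[x]; rewrite mem_iota /= add0n => xD.
  rewrite /lo; case: ifP => // Sx; case E: (T x U) => [t|] //= [->].
  by exists x, t.
have hiP l : l \in pmap hi (iota 0 D) ->
    exists x t, [/\ (x < D)%N, S x./2, T U x = Some t & l = v x + t].
  rewrite mem_pmap => /mapP[x]; rewrite mem_iota /= add0n => xD.
  rewrite /hi; case: ifP => // Sx; case E: (T U x) => [t|] //= [->].
  by exists x, t.
have oles o t : o = Some t -> ole o t by move=> ->; rewrite /= lexx.
have [y [Ly yH]] : exists y, (forall l, l \in pmap lo (iota 0 D) ++ lou -> l <= y)
   /\ (forall h, h \in pmap hi (iota 0 D) ++ hiu -> y <= h).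
  apply: int_between => l h; rewrite !mem_cat => /orP[/loP|] hl /orP[/hiP|] hh.
  - move: hl hh => [x [t [xD Sx E ->]]] [x' [t' [xD' Sx' E' ->]]].
    have := sv _ _ _ xD xD' Sx Sx' (closedT xD UD xD' (oles _ _ E) (oles _ _ E')).
    lia.
  (* The path from [x] through [U] and [bar U] to [bar x] gives [2 * v x <= 2 * t + t']. As
     [v x - t] is an integer, it is at most the floor of [t' / 2]: rounding loses nothing. Only the
     case of two unary bounds needs [unaryT]. *)
  - move: hl hh; rewrite /hiu => -[x [t [xD Sx E ->]]].
    case E': (T U _) => [t'|//]; rewrite inE => /eqP ->.
    have xB := bar_ltD xD.
    have c1 := closedT xD UD BD (oles _ _ E) (oles _ _ E').
    have c2 := closedT xD BD xB c1 (coherentT xD UD (oles _ _ E)).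
    have := sv _ _ _ xD xB Sx _ c2; rewrite half_bar cv => /(_ Sx); lia.
  - move: hl hh; rewrite /lou => + [x [t [xD Sx E ->]]].
    case E': (T _ U) => [t'|//]; rewrite inE => /eqP ->.
    have xB := bar_ltD xD.
    have c1 := closedT BD UD xD (oles _ _ E') (oles _ _ E).
    have c2 := closedT xB BD xD (coherentT UD xD (oles _ _ E)) c1.
    have := sv _ _ _ xB xD _ Sx c2; rewrite half_bar cv => /(_ Sx); lia.
  - move: hl hh; rewrite /lou /hiu; case E': (T _ U) => [t'|//].
    rewrite inE => /eqP ->; case E: (T U _) => [t|//]; rewrite inE => /eqP ->.
    have := unaryT UD (oles _ _ E) (oles _ _ E'); lia.
have lo1 x d : (x < D)%N -> S x./2 -> ole (T x U) d -> v x - y <= d.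
  move=> xD Sx; case E: (T x U) => [t|//] /= td.
  have : v x - t \in pmap lo (iota 0 D) ++ lou.
    rewrite mem_cat mem_pmap; apply/orP; left; apply/mapP; exists x.
      by rewrite mem_iota.
    by rewrite /lo Sx E.
  by move/Ly; lia.
have hi1 x d : (x < D)%N -> S x./2 -> ole (T U x) d -> y - v x <= d.
  move=> xD Sx; case E: (T U x) => [t|//] /= td.
  have : v x + t \in pmap hi (iota 0 D) ++ hiu.
    rewrite mem_cat mem_pmap; apply/orP; left; apply/mapP; exists x.
      by rewrite mem_iota.
    by rewrite /hi Sx E.
  by move/yH; lia.
have lo2 d : ole (T (bar U) U) d -> - y - y <= d.
  case E: (T _ U) => [t|//] /= td.
  have : - (t %/ 2)%Z \in pmap lo (iota 0 D) ++ lou.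
    by rewrite mem_cat /lou E inE eqxx orbT.
  by move/Ly; lia.
have hi2 d : ole (T U (bar U)) d -> y + y <= d.
  case E: (T U _) => [t|//] /= td.
  have : (t %/ 2)%Z \in pmap hi (iota 0 D) ++ hiu.
    by rewrite mem_cat /hiu E inE eqxx orbT.
  by move/yH; lia.
have nSU x : S x./2 -> x != U /\ x != bar U.
  by move=> Sx; split; apply: contraNneq nSu => E; move: Sx;
    rewrite E ?half_bar doubleK.
pose v' x := if x == U then y else if x == bar U then - y else v x.
have v'U : v' U = y by rewrite /v' eqxx.
have v'B : v' (bar U) = - y by rewrite /v' eqxx (negbTE (bar_neq _)).
have v'S x : S x./2 -> v' x = v x.
  by move=> /nSU[/negbTE h1 /negbTE h2]; rewrite /v' h1 h2.
exists v'.
  split=> // x; rewrite /v' !(inv_eq barK) barK.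
  case: (eqVneq x U) => [->|_]; first by rewrite eq_sym (negbTE (bar_neq _)).
  by case: eqP => _; rewrite ?opprK.
have caseu x : S x./2 || (x./2 == u) -> [\/ x = U, x = bar U | S x./2].
  case/orP; [by constructor 3|move/eqP => xu].
  have : U./2 = x./2 by rewrite doubleK.
  by case/bar_half; [constructor 1|constructor 2].
move=> x x' d xD xD' /caseu hx /caseu hx' c.
case: hx xD c => [->|->|Sx] xD c; case: hx' xD' c => [->|->|Sx'] xD' c;
  rewrite ?v'U ?v'B ?opprK.
- by rewrite subrr; apply: diagT c.
- exact: hi2.
- by rewrite v'S //; apply: hi1.
- exact: lo2.
- by rewrite addNr; apply: diagT c.
- have := coherentT xD xD' c; rewrite barK v'S // => /lo1.
  by rewrite half_bar bar_ltD // cv => /(_ isT Sx'); lia.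
- by rewrite v'S //; apply: lo1.
- have := coherentT xD xD' c; rewrite barK v'S // => /hi1.
  by rewrite half_bar bar_ltD // cv => /(_ isT Sx); lia.
- by rewrite !v'S //; apply: sv c.
Qed.

Lemma extend S v : coherent v -> sat_on S v ->
  exists2 v', coherent v' /\ (forall x, S x./2 -> v' x = v x) & sat_on predT v'.
Proof.
move=> cv sv.
have : forall n, (n <= r)%N ->
  exists2 v', coherent v' /\ (forall x, S x./2 -> v' x = v x) &
              sat_on (fun i => S i || (i < n)%N) v'.
  elim=> [_|n IH nr].
    by exists v => // x y d xD yD; rewrite !orbF; apply: sv.
  have [v1 [cv1 e1] s1] := IH (ltnW nr).
  have [v2 [cv2 e2] s2] := extend1 cv1 s1 nr.
  exists v2; first by split=> // x Sx; rewrite e2 ?e1 // Sx.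
  have e i : S i || (i < n.+1)%N = S i || (i < n)%N || (i == n).
    by rewrite ltnS leq_eqVlt -orbA (orbC (i == n)).
  by move=> x y d xD yD; rewrite !e; apply: s2.
case/(_ r (leqnn r)) => v' h s; exists v' => // x y d xD yD _ _.
by apply: s; rewrite // ltn_half_double ?xD ?yD orbT.
Qed.

End Extension.

(** * Squaring *)

Lemma barD x k : bar (x + k.*2) = (bar x + k.*2)%N.
Proof.
rewrite /bar oddD odd_double addbF; case: ifP => // ox.
by case: x ox.
Qed.

Section Squaring.
Variables (N : nat) (es : seq edge) (mu : nat).
Let q := N.*2.
Hypothesis es_lt : forall e, e \in es -> (e.1.1 < q + q)%N /\ (e.1.2 < q + q)%N.
Hypothesis es_bar : forall x y w, (x, y, w) \in es -> (bar y, bar x, w) \in es.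
Hypothesis es_mu : forall e, e \in es -> (`|e.2| <= mu)%N.

Local Notation reach := (reach q es).
Local Notation sat := (sat q es).

Lemma bar_shift x l : bar (x + q * l) = (bar x + q * l)%N.
Proof. by rewrite /q -doubleMl barD. Qed.

Definition tbar (a : tedge) : tedge := (a.1, (bar a.2.1.2, bar a.2.1.1, a.2.2)).

Lemma src_tbar a : src q (tbar a) = bar (dst q a).
Proof. by rewrite /src /dst bar_shift. Qed.
Lemma dst_tbar a : dst q (tbar a) = bar (src q a).
Proof. by rewrite /src /dst bar_shift. Qed.

(** The walk is traversed backwards with all its vertices negated; layers are kept. *)
Lemma reach_bar n x y d : reach n x y d -> reach n (bar y) (bar x) d.
Proof.
move=> [p [u w h]]; exists (rev (map tbar p)); split.
- rewrite /unfolded all_rev all_map; apply: sub_all u => -[i [[a b] c]] /= /andP[-> m].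
  exact: es_bar.
- elim: p x w {u h} => [|a p IH] x /=; first by move/eqP->.
  case/andP=> /eqP <- /IH w; rewrite rev_cons -cats1; apply: walk_cat w _.
  by rewrite /= src_tbar dst_tbar !eqxx.
- by rewrite /wt (perm_big _ (permEl (perm_rev _))) big_map.
Qed.

(* Row x of the matrix of the n-th power stands for a vertex of layer 0 or n. *)
Definition gidx (n x : nat) : nat := if (x < q)%N then x else (x + q * n.-1)%N.

(** Closure of the entries under concatenation. In the matrix of single edges a walk is a sum of
    entries, not an entry. *)
Inductive derivable (M : mat) : nat -> nat -> int -> Prop :=
| DerBase x y d : (x < q + q)%N -> (y < q + q)%N -> ole (M x y) d -> derivable M x y d
| DerTrans x y z a b : derivable M x y a -> derivable M y z b -> derivable M x z (a + b).

Record power_matrix (n : nat) (M : mat) : Prop := PowerMatrix {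
  pm_sound : forall x y d, (x < q + q)%N -> (y < q + q)%N ->
    ole (M x y) d -> reach n (gidx n x) (gidx n y) d;
  pm_complete : forall x y d, (x < q + q)%N -> (y < q + q)%N ->
    reach n (gidx n x) (gidx n y) d -> derivable M x y d;
  pm_diag : forall x, (x < q + q)%N -> ole (M x x) 0;
  pm_extend : forall v, coherent v ->
    (forall x y d, (x < q + q)%N -> (y < q + q)%N -> ole (M x y) d -> v x - v y <= d) ->
    exists V, [/\ coherent V, sat n V & forall x, (x < q + q)%N -> V (gidx n x) = v x];
  pm_bound : forall x y, (x < q + q)%N -> (y < q + q)%N ->
    obound (q * n.+1 * mu) (M x y)
}.

(** What a squaring adds to [power_matrix]: distances are single entries, and values prescribed on a
    part [S] of the variables extend. Both may fail for the matrix of single edges. *)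
Record exact_matrix (n : nat) (M : mat) : Prop := ExactMatrix {
  em_complete : forall x y d, (x < q + q)%N -> (y < q + q)%N ->
    reach n (gidx n x) (gidx n y) d -> ole (M x y) d;
  em_extend : forall S v, coherent v -> sat_on M (N + N) S v ->
    exists V, [/\ coherent V, sat n V &
                  forall x, (x < q + q)%N -> S x./2 -> V (gidx n x) = v x]
}.

(** Three blocks of [q] rows stand for layers [0], [n] and [2n]. Two copies of [M] overlap in the
    middle block. *)
Definition glue (M : mat) : mat := fun x y =>
  omin (if (x < q + q)%N && (y < q + q)%N then M x y else None)
       (if (q <= x)%N && (q <= y)%N then M (x - q)%N (y - q)%N else None).

(** Sends the two blocks of the squared matrix to the outer blocks of the glued one. *)
Definition widen (x : nat) : nat := if (x < q)%N then x else (x + q)%N.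

Definition squared (M : mat) : mat :=
  fun x y => fw (glue M) (q + q + q) (widen x) (widen y).

Definition hidx (n x : nat) : nat :=
  if (x < q)%N then x else if (x < q + q)%N then (x + q * n.-1)%N
  else (x + q * n.-1 + q * n.-1)%N.

Lemma hidx_lo n x : (x < q + q)%N -> hidx n x = gidx n x.
Proof. by rewrite /hidx /gidx => ->. Qed.

Lemma hidx_hi n x : (0 < n)%N -> hidx n (x + q) = (gidx n x + q * n)%N.
Proof.
move=> n0; rewrite /hidx /gidx; have -> : (q * n = q + q * n.-1)%N by rewrite -mulnS prednK.
rewrite ltn_add2r ltnNge leq_addl /=; case: ifP => _; lia.
Qed.

Lemma hidx_widen n x : (0 < n)%N -> hidx n (widen x) = gidx (n + n) x.
Proof.
move=> n0; rewrite /widen /gidx; case: ifP => xq; first by rewrite /hidx xq.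
rewrite hidx_hi // /gidx xq.
have -> : (q * n = q + q * n.-1)%N by rewrite -mulnS prednK.
have -> : ((n + n).-1 = n.-1 + n.-1 + 1)%N by lia.
rewrite !mulnDr muln1; lia.
Qed.

Lemma bar_hidx n x : bar (hidx n x) = hidx n (bar x).
Proof.
have e k : (bar x < k.*2)%N = (x < k.*2)%N by rewrite -!ltn_half_double half_bar.
rewrite /hidx; have := e (N + N)%N; have := e N; rewrite doubleD -!/q => -> ->.
by case: ifP => // _; case: ifP => _; rewrite ?bar_shift.
Qed.

Lemma widen_lt x : (x < q + q)%N -> (widen x < q + q + q)%N.
Proof. by rewrite /widen; case: ifP; lia. Qed.

Lemma satE n v l x y w : sat n v -> (l < n)%N -> (x, y, w) \in es ->
  v (x + q * l)%N - v (y + q * l)%N <= w.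
Proof. by move=> s ln m; apply: (s (l, (x, y, w))). Qed.

Lemma sat_glue n V1 V2 : (0 < n)%N -> sat n V1 -> sat n V2 ->
  (forall x, (x < q)%N -> V1 (x + q * n)%N = V2 x) ->
  sat (n + n) (fun u => if (u < q * n.+1)%N then V1 u else V2 (u - q * n)%N).
Proof.
move=> n0 s1 s2 e a an aes; have [h1 h2] := es_lt aes.
have [al|al] := ltnP a.1 n.
  by have [-> ->] := vertex_hi es_lt aes al; apply: s1.
(* On layer [n] the two potentials agree, so there the second one may be read although the test
   selects the first. *)
have V u : (q * n <= u)%N ->
    (if (u < q * n.+1)%N then V1 u else V2 (u - q * n)%N) = V2 (u - q * n)%N.
  move=> hu; case: ifP => // hu'; rewrite -e ?subnK //.
  by move: hu'; rewrite mulnS; lia.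
have [g1 g2] := vertex_lo q al; rewrite !V //.
have := s2 (unshift n a); rewrite /unshift /src /dst /= => h.
have e' x : (x + q * a.1 - q * n = x + q * (a.1 - n))%N.
  by rewrite mulnBr addnBA // leq_mul2l al orbT.
by rewrite !e'; apply: h => //; lia.
Qed.

Section Step.
Variables (n : nat) (M : mat).
Hypotheses (n0 : (0 < n)%N) (pm : power_matrix n M).
Let D := (q + q + q)%N.
Let T := fw (glue M) D.

Lemma glue_lo x y d : (x < q + q)%N -> (y < q + q)%N ->
  ole (M x y) d -> ole (glue M x y) d.
Proof. by move=> xq yq h; rewrite /glue ole_omin xq yq h. Qed.

Lemma glue_hi x y d : (x < q + q)%N -> (y < q + q)%N ->
  ole (M x y) d -> ole (glue M (x + q)%N (y + q)%N) d.
Proof. by move=> xq yq h; rewrite /glue ole_omin !leq_addl !addnK h orbT. Qed.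

(** Stated for every stage [k], because a failed pivot test stops the closure midway and still has
    to yield a negative closed walk. *)
Lemma fw_glue_sound k x y d : (k <= D)%N -> (x < D)%N -> (y < D)%N ->
  ole (fw (glue M) k x y) d -> reach (n + n) (hidx n x) (hidx n y) d.
Proof.
move=> kD; move: x y d.
apply: (fw_sound (P := fun x y => reach (n + n) (hidx n x) (hidx n y)) _ _ kD).
  by move=> x y z a b; apply: reach_trans.
move=> x y d xD yD; rewrite /glue ole_omin => /orP[].
  case: ifP => // /andP[xq yq] h; rewrite !hidx_lo //.
  by apply: reach_mono (pm_sound pm xq yq h); apply: leq_addr.
case: ifP => // /andP[xq yq]; rewrite -{2}(subnK xq) -{2}(subnK yq) !hidx_hi // => h.
by apply/reach_shift/(pm_sound pm); rewrite // ltn_subLR // addnA.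
Qed.

Lemma unsat_cycle k x d : (k <= D)%N -> (x < D)%N -> ole (fw (glue M) k x x) d ->
  d < 0 -> forall V, ~ sat (n + n) V.
Proof.
move=> kD xD /(fw_glue_sound kD xD xD) r d0 V s.
by have := sat_reach s r; rewrite subrr; lia.
Qed.

(** The two entries bound twice the value at [x] by [a] and minus twice that value by [b]; an
    integer value then lies between minus the floor of [b / 2] and the floor of [a / 2]. *)
Lemma unsat_unary x a b : (x < D)%N -> (bar x < D)%N ->
  ole (T x (bar x)) a -> ole (T (bar x) x) b -> (a %/ 2)%Z + (b %/ 2)%Z < 0 ->
  forall V, coherent V -> ~ sat (n + n) V.
Proof.
move=> xD yD /fw_glue_sound ra /fw_glue_sound rb ab V cV s.
have {}ra := ra (leqnn _) xD yD; have {}rb := rb (leqnn _) yD xD.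
have := sat_reach s ra; have := sat_reach s rb; rewrite -bar_hidx cV; lia.
Qed.

Section Consistent.
Hypothesis stage_ok : forall l, (l < D)%N -> nneg (fw (glue M) l) l.
Hypothesis diag_ok : forall x d, (x < D)%N -> ole (T x x) d -> 0 <= d.
Hypothesis unary_ok : forall x a b, (x < D)%N ->
  ole (T x (bar x)) a -> ole (T (bar x) x) b -> 0 <= (a %/ 2)%Z + (b %/ 2)%Z.

Lemma T_closed x y z a b : (y < D)%N ->
  ole (T x y) a -> ole (T y z) b -> ole (T x z) (a + b).
Proof. by move=> yD; apply: fw_closed. Qed.

Lemma T_lo x y d : derivable M x y d -> ole (T x y) d /\ (y < q + q)%N.
Proof.
elim=> {x y d} [x y d xq yq h|x y z a b _ [h1 yq] _ [h2 zq]].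
  by split=> //; apply/fw_mono/glue_lo.
by split=> //; apply: T_closed h1 h2; rewrite /D; lia.
Qed.

Lemma T_hi x y d : derivable M x y d -> ole (T (x + q)%N (y + q)%N) d /\ (y < q + q)%N.
Proof.
elim=> {x y d} [x y d xq yq h|x y z a b _ [h1 yq] _ [h2 zq]].
  by split=> //; apply/fw_mono/glue_hi.
by split=> //; apply: T_closed h1 h2; rewrite /D; lia.
Qed.

Lemma reach_lo x y d : (x < q + q)%N -> (y < q + q)%N ->
  reach n (gidx n x) (gidx n y) d -> ole (T x y) d.
Proof. by move=> xq yq /(pm_complete pm xq yq)/T_lo[]. Qed.

Lemma reach_hi x y d : (x < q + q)%N -> (y < q + q)%N ->
  reach n (gidx n x) (gidx n y) d -> ole (T (x + q)%N (y + q)%N) d.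
Proof. by move=> xq yq /(pm_complete pm xq yq)/T_hi[]. Qed.

Lemma gidx_mid j : (j < q)%N -> gidx n (j + q)%N = (j + q * n)%N.
Proof. by move=> jq; rewrite /gidx ltnNge leq_addl /= -addnA -mulnS prednK. Qed.

Lemma gidx_lt x : (x < q + q)%N -> (gidx n x < q * n.+1)%N.
Proof.
rewrite /gidx => xq; have -> : (q * n.+1 = q + q + q * n.-1)%N.
  by rewrite -addnA -mulnS prednK // mulnS.
by case: ifP; lia.
Qed.

Lemma T_diag x : (x < D)%N -> ole (T x x) 0.
Proof.
move=> xD; apply: fw_mono; have [xq|qx] := ltnP x (q + q).
  by apply: glue_lo => //; apply: (pm_diag pm).
have xq : (q <= x)%N by lia.
rewrite -(subnK xq); have xq' : (x - q < q + q)%N by move: xD; rewrite /D; lia.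
by apply: glue_hi => //; apply: (pm_diag pm).
Qed.

(* A walk is cut where it passes from one half of the unfolding to the other;
   what precedes the last crossing is summarized by an entry of T. *)
Lemma walk_summary x p u : (x < D)%N -> unfolded es (n + n) p -> walk q (hidx n x) p u ->
  exists (b : bool) (k : nat) (e r : int) (v : nat),
    [/\ (k < q + q)%N, ole (T x (k + b * q)%N) e, reach n (gidx n k) v r,
        (v < q * n.+1)%N & u = (v + b * (q * n))%N /\ e + r <= wt p].
Proof.
move=> xD; elim/last_ind: p u => [|p a IH] u.
  move=> _ /= /eqP <-; have [xq|qx] := ltnP x (q + q).
    exists false, x, 0, 0, (gidx n x).
    rewrite !mul0n !addn0 hidx_lo // wt_nil gidx_lt // T_diag //.
    by split=> //; apply: reach_refl.
  have xq : (q <= x)%N by lia.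
  have xq' : (x - q < q + q)%N by move: xD; rewrite /D; lia.
  exists true, (x - q)%N, 0, 0, (gidx n (x - q)).
  rewrite !mul1n subnK // -hidx_hi // subnK // wt_nil gidx_lt // T_diag //.
  by split=> //; apply: reach_refl.
rewrite -cats1 unfolded_cat => /andP[up]; rewrite /= andbT => /andP[an aes].
case/walk_split=> w [/(IH _ up)[b [k [e [r [v [kq Te rv vn [wE ler]]]]]]]].
move=> /= /andP[/eqP sa /eqP <-]; rewrite wt_cat wt_cons wt_nil addr0.
have [al|al] := ltnP a.1 n.
  have ra : reach n (src q a) (dst q a) a.2.2 by apply: reach_edge.
  have [sl dl] := vertex_hi es_lt aes al.
  case: b Te wE => Te wE; last first.
    exists false, k, e, (r + a.2.2), (dst q a); rewrite mul0n addn0 in wE *.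
    split=> //; last by split; lia.
    by apply: reach_trans rv _; rewrite -wE -sa.
  have vq : (v < q)%N by move: sl; rewrite sa wE mul1n mulnS; lia.
  exists false, (v + q)%N, (e + r), a.2.2, (dst q a).
  rewrite !mul0n !addn0; split=> //; [lia| | |split=> //; lia].
    apply: T_closed Te _; first by rewrite mul1n /D; lia.
    rewrite mul1n; apply: reach_hi => //; first lia.
    by rewrite {2}/gidx vq.
  by rewrite gidx_mid //; move: ra; rewrite sa wE mul1n.
have [g1 g2] := vertex_lo q al.
have sE : src q a = (src q (unshift n a) + q * n)%N.
  by rewrite /src /= mulnBr -addnA subnK // leq_mul2l al orbT.
have dE : dst q a = (dst q (unshift n a) + q * n)%N.
  by rewrite /dst /= mulnBr -addnA subnK // leq_mul2l al orbT.
have al' : ((unshift n a).1 < n)%N by rewrite /= ltn_subLR.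
have ra : reach n (src q (unshift n a)) (dst q (unshift n a)) a.2.2.
  by apply: (@reach_edge _ _ _ (unshift n a)).
have [sl dl] := vertex_hi es_lt (a := unshift n a) aes al'.
case: b Te wE => Te wE.
  exists true, k, e, (r + a.2.2), (dst q (unshift n a)); rewrite mul1n in wE *.
  split=> //; last by split; lia.
  apply: reach_trans rv _; suff <- : src q (unshift n a) = v by [].
  by apply: (@addIn (q * n)%N); rewrite -sE sa wE.
rewrite mul0n addn0 in wE; rewrite -{}wE in vn rv.
pose j := src q (unshift n a).
have jq : (j < q)%N.
  by move: vn; rewrite -sa sE -/j mulnS ltn_add2r.
exists true, j, (e + r), a.2.2, (dst q (unshift n a)).
rewrite !mul1n; split=> //; [lia| | |split=> //; lia].
  apply: T_closed Te _; first by rewrite mul0n /D; lia.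
  rewrite mul0n addn0; apply: reach_lo => //; first lia.
  by rewrite gidx_mid // -sE sa.
by rewrite /gidx jq.
Qed.

Lemma T_complete x y d : (x < D)%N -> (y < D)%N ->
  reach (n + n) (hidx n x) (hidx n y) d -> ole (T x y) d.
Proof.
move=> xD yD [p [up /(walk_summary xD up)]].
case=> b [k [e [r [v [kq Te rv vn [yE ler]]]]]] led.
apply: (@oleW _ (e + r)); first exact: le_trans led.
case: b Te yE => Te yE.
  rewrite mul1n in Te yE; apply: T_closed Te _; first by rewrite /D; lia.
  have qy : (q <= y)%N.
    rewrite leqNgt; apply/negP => yq; move: yE; rewrite /hidx yq.
    have : (q <= q * n)%N by rewrite leq_pmulr.
    lia.
  have yq' : (y - q < q + q)%N by move: yD; rewrite /D; lia.
  rewrite -(subnK qy); apply: reach_hi => //.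
  by move: yE; rewrite -{1}(subnK qy) hidx_hi // mul1n => /eqP; rewrite eqn_add2r => /eqP ->.
rewrite mul0n addn0 in yE; apply: T_closed Te _; first by rewrite mul0n /D; lia.
have yq : (y < q + q)%N.
  rewrite ltnNge; apply/negP => qy; move: vn; rewrite -yE /hidx !ltnNge qy.
  have -> /= : (q <= y)%N by lia.
  have -> : (q * n.+1 = q + q + q * n.-1)%N by rewrite -addnA -mulnS prednK // mulnS.
  by move: (q * n.-1)%N => t; rewrite -ltnNge => h; move: qy; lia.
by rewrite mul0n addn0; apply: reach_lo; rewrite // -(hidx_lo n yq) yE.
Qed.

(** The symmetry is inherited from walks, through soundness and completeness of [T]. Single stages
    need not preserve it, as they treat a pivot without its negation. *)
Lemma T_coherent x y d : (x < D)%N -> (y < D)%N ->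
  ole (T x y) d -> ole (T (bar y) (bar x)) d.
Proof.
have bD t : (t < D)%N -> (bar t < D)%N.
  by rewrite /D /q -!doubleD -!ltn_half_double half_bar.
move=> xD yD /(fw_glue_sound (leqnn _) xD yD)/reach_bar.
by rewrite !bar_hidx; apply: T_complete; apply: bD.
Qed.

Lemma DE : D = (N + N + N).*2. Proof. by rewrite /D /q !doubleD. Qed.

(** The closed matrix first yields values on all three blocks. Each half then extends separately by
    [pm_extend], and the two extensions agree on layer [n]. *)
Lemma T_extend S v : coherent v -> sat_on T (N + N + N) S v ->
  exists V, [/\ coherent V, sat (n + n) V &
                forall x, (x < D)%N -> S x./2 -> V (hidx n x) = v x].
Proof.
move=> cv sv.
have [] := @extend T (N + N + N) _ _ _ _ S v cv sv; rewrite -?DE.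
- by move=> x y z a b _ yD _; apply: T_closed.
- exact: T_coherent.
- exact: diag_ok.
- exact: unary_ok.
move=> w [cw ew] sw.
have sw' x y d : (x < D)%N -> (y < D)%N -> ole (T x y) d -> w x - w y <= d.
  by rewrite DE => xD yD; apply: sw.
have [|V1 [c1 s1 e1]] := pm_extend pm cw.
  move=> x y d xq yq h; apply: sw'; [rewrite /D; lia|rewrite /D; lia|].
  exact/fw_mono/glue_lo.
pose w2 x := w (x + q)%N.
have cw2 : coherent w2 by move=> x; rewrite /w2 -cw /q barD.
have [|V2 [c2 s2 e2]] := pm_extend pm cw2.
  move=> x y d xq yq h; apply: sw'; [rewrite /D; lia|rewrite /D; lia|].
  exact/fw_mono/glue_hi.
have mid x : (x < q)%N -> V1 (x + q * n)%N = V2 x.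
  move=> xq; rewrite -gidx_mid // e1; last lia.
  have := e2 x; rewrite {1}/gidx xq => ->; rewrite /w2 //; lia.
exists (fun u => if (u < q * n.+1)%N then V1 u else V2 (u - q * n)%N); split.
- move=> x; have e k : (bar x < q * k)%N = (x < q * k)%N.
    by rewrite /q -doubleMl -!ltn_half_double half_bar.
  rewrite e; case: ifP => // h; have qn : (q * n <= x)%N by move: h; rewrite mulnS; lia.
  by rewrite -{1}(subnK qn) bar_shift addnK c2.
- exact: sat_glue.
- move=> x xD Sx; rewrite -(ew x) //; have [xq|qx] := ltnP x (q + q).
    by rewrite hidx_lo // gidx_lt // e1.
  have xq : (q <= x)%N by lia.
  have xq' : (x - q < q + q)%N by move: xD; rewrite /D; lia.
  have -> : hidx n x = (gidx n (x - q) + q * n)%N by rewrite -{1}(subnK xq) hidx_hi.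
  rewrite addnK.
  have -> : (gidx n (x - q) + q * n < q * n.+1)%N = false.
    rewrite mulnS ltn_add2r /gidx; move: (q * n.-1)%N => t; case: ifP; lia.
  by rewrite e2 // /w2 subnK.
Qed.

Lemma consistent_sat : exists V, coherent V /\ sat (n + n) V.
Proof.
have [||V [cV sV _]] := @T_extend pred0 (fun=> 0); last by exists V.
  by move=> x; rewrite oppr0.
by move=> x y.
Qed.

Lemma squared_exact : exact_matrix (n + n) (squared M).
Proof.
split=> [x y d xq yq r|S v cv sv].
  by apply: T_complete; rewrite ?widen_lt ?hidx_widen.
(* [S'] prescribes nothing in the middle block: its values are the ones quantified away in a
   composition of relations. *)
pose S' i := if (i < N)%N then S i else (N + N <= i)%N && S (i - N)%N.
pose v' x := if (x < q)%N then v x else v (x - q)%N.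
have S'P x : S' x./2 -> exists y, [/\ S y./2, x = widen y & v' x = v y].
  rewrite /S' /widen /v' ltn_half_double geq_half_double -/q.
  case: (ltnP x q) => [xq Sx|qx]; first by exists x; rewrite xq.
  have h : (x - q)./2 = (x./2 - N)%N.
    by rewrite -{2}(subnK qx) halfD /q odd_double andbF add0n doubleK addnK.
  rewrite doubleD -/q => /andP[qx' Sx]; exists (x - q)%N.
  by rewrite h ltnNge leq_subRL // qx' subnK.
have S'W x : (x < q + q)%N -> S x./2 -> S' (widen x)./2 /\ v' (widen x) = v x.
  rewrite /S' /widen /v' => xq; case: (ltnP x q) => qx Sx.
    by rewrite qx ltn_half_double qx.
  have -> : (x + q)./2 = (x./2 + N)%N.
    by rewrite halfD /q odd_double andbF add0n doubleK.
  rewrite !(ltnNge (_ + _)) !leq_addl /= !addnK Sx andbT leq_add2r.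
  by rewrite geq_half_double.
have cv' : coherent v'.
  move=> x; rewrite /v'; have -> : (bar x < q)%N = (x < q)%N.
    by rewrite -!ltn_half_double half_bar.
  case: ltnP => xq; first exact: cv.
  by rewrite -cv -{1}(subnK xq) /q barD addnK.
have [|V [cV sV e]] := T_extend (S := S') cv'.
  move=> x y d xD yD /S'P[x1 [Sx xE ->]] /S'P[y1 [Sy yE ->]] h.
  apply: sv => //; last by rewrite /squared -xE -yE.
    by rewrite doubleD -/q; move: xD; rewrite -DE xE /widen /D; case: ifP; lia.
  by rewrite doubleD -/q; move: yD; rewrite -DE yE /widen /D; case: ifP; lia.
exists V; split=> // x xq Sx; have [S1 v1] := S'W x xq Sx.
by rewrite -hidx_widen // e // widen_lt.
Qed.

Lemma squared_power : power_matrix (n + n) (squared M).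
Proof.
split=> [x y d xq yq h|x y d xq yq r|x xq|v cv sv|x y xq yq].
- rewrite -!hidx_widen //; apply: fw_glue_sound h => //; exact: widen_lt.
- by apply: DerBase => //; apply: (em_complete squared_exact).
- by apply: T_diag; apply: widen_lt.
- have [|V [cV sV e]] := em_extend squared_exact (S := predT) cv.
    by move=> x y d; rewrite !doubleD => xq yq _ _; apply: sv.
  by exists V; split=> // x xq; apply: e.
(* The entry [d] bounds a walk, hence some simple walk of weight [d' <= d]; completeness gives
   [d <= d']. So the entry obeys the bound for simple walks, whatever growth the closure allowed. *)
- have [V [_ sV]] := consistent_sat.
  case E: (squared M x y) => [d|] //=.
  have : reach (n + n) (gidx (n + n) x) (gidx (n + n) y) d.
    rewrite -!hidx_widen //; apply: (@fw_glue_sound D); rewrite ?widen_lt //.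
    by move: E; rewrite /squared => ->; rewrite /= lexx.
  case/(reach_weight_bound es_lt sV es_mu) => d' [r' d'd].
  have := em_complete squared_exact xq yq r'; rewrite E /= => dd'.
  by have -> : d' = d by apply/eqP; rewrite eq_le d'd dd'.
Qed.

End Consistent.
End Step.
End Squaring.

Section SquareSpec.
Variable N : nat.
Let q := N.*2.
Let D := (q + q + q)%N.

(** With [None] as plus infinity: the bound [o] is strictly tighter than [o']. *)
Definition ogt (o o' : option int) : bool :=
  match o, o' with Some t, Some s => t < s | Some _, None => true | None, _ => false end.

Lemma ogtPn o o' d : ~~ ogt o o' -> ole o d -> ole o' d.
Proof. by case: o => [t|] //; case: o' => [s|] //=; lia. Qed.

Lemma ogtP o o' : ogt o o' -> exists d, ole o d /\ ~~ ole o' d.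
Proof. by case: o => [t|] //; case: o' => [s|] //= h; exists t; rewrite lexx //; split=> //; lia. Qed.

Definition unary_ok (T : mat) (i : nat) : bool :=
  match T i.*2 i.*2.+1, T i.*2.+1 i.*2 with
  | Some a, Some b => 0 <= (a %/ 2)%Z + (b %/ 2)%Z
  | _, _ => true
  end.

(** Both indices lie in layer 0: the domain bound of power [2n] is tighter than that of power
    [n]. *)
Definition grows (T M : mat) (x y : nat) : bool :=
  [&& (x < q)%N, (y < q)%N & ogt (T (widen N x) (widen N y)) (M x y)].

Lemma power_matrix_ext es mu n (M M' : mat) :
  (forall x y, (x < q + q)%N -> (y < q + q)%N -> M x y = M' x y) ->
  power_matrix N es mu n M -> power_matrix N es mu n M'.
Proof.
move=> e [h1 h2 h3 h4 h5]; split.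
- by move=> x y d xq yq; rewrite -e //; apply: h1.
- move=> x y d xq yq /(h2 _ _ _ xq yq); elim=> {x y d xq yq} [x y d xq yq|x y z a b _ d1 _ d2].
    by rewrite e //; apply: DerBase.
  exact: DerTrans d1 d2.
- by move=> x xq; rewrite -e //; apply: h3.
- by move=> v cv hv; apply: h4 => // x y d xq yq h; apply: hv; rewrite -?e.
- by move=> x y xq yq; rewrite -e //; apply: h5.
Qed.

Lemma exact_matrix_ext es n (M M' : mat) :
  (forall x y, (x < q + q)%N -> (y < q + q)%N -> M x y = M' x y) ->
  exact_matrix N es n M -> exact_matrix N es n M'.
Proof.
move=> e [h1 h2]; split.
- by move=> x y d xq yq; rewrite -e //; apply: h1.
- move=> S v cv sv; apply: h2 => // x y d xq yq Sx Sy h; apply: sv => //.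
  by rewrite -e -?/q ?doubleD //; rewrite -doubleD.
Qed.

Variables (es : seq edge) (mu n : nat).
Hypothesis es_lt : forall e, e \in es -> (e.1.1 < q + q)%N /\ (e.1.2 < q + q)%N.
Hypothesis es_bar : forall x y w, (x, y, w) \in es -> (bar y, bar x, w) \in es.
Hypothesis es_mu : forall e, e \in es -> (`|e.2| <= mu)%N.
Hypothesis n0 : (0 < n)%N.

Definition infeasible : Prop := forall v, coherent v -> ~ sat q es (n + n) v.

Definition squared_spec (M M' : mat) (diff : int) : Prop :=
  [/\ power_matrix N es mu (n + n) M', exact_matrix N es (n + n) M' &
      diff = 0 /\ (forall x y d, (x < q)%N -> (y < q)%N -> ole (M' x y) d -> ole (M x y) d) \/
      diff = 1 /\ exists x y d, [/\ (x < q)%N, (y < q)%N, ole (M' x y) d & ~~ ole (M x y) d]].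

Lemma squared_specP (M M' T : mat) diff : power_matrix N es mu n M ->
  (forall l, (l < D)%N -> nneg (fw (glue N M) l) l) ->
  (forall k, (k < D)%N -> nneg (fw (glue N M) D) k) ->
  (forall k, (k < N + N + N)%N -> unary_ok (fw (glue N M) D) k) ->
  (forall x y, (x < D)%N -> (y < D)%N -> T x y = fw (glue N M) D x y) ->
  (forall x y, (x < q + q)%N -> (y < q + q)%N -> M' x y = T (widen N x) (widen N y)) ->
  diff = 0 /\ (forall x y, ~~ grows T M x y) \/ diff = 1 /\ (exists x y, grows T M x y) ->
  squared_spec M M' diff.
Proof.
move=> pM stg dg un eT eM hd.
have diag x d : (x < D)%N -> ole (fw (glue N M) D x x) d -> 0 <= d.
  by move=> xD; apply: nnegP; apply: dg.
have unary x a b : (x < D)%N -> ole (fw (glue N M) D x (bar x)) a ->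
    ole (fw (glue N M) D (bar x) x) b -> 0 <= (a %/ 2)%Z + (b %/ 2)%Z.
  move=> xD; have kN : (x./2 < N + N + N)%N by move: xD; rewrite /D /q; lia.
  have := un _ kN; rewrite /unary_ok => h ha hb.
  have [xE|xE] : x = x./2.*2 \/ x = x./2.*2.+1.
  - by have := odd_double_half x; case: (odd x) => /= hx; [right|left]; exact: esym hx.
  - have bE : bar x = x./2.*2.+1 by rewrite /bar {1 2 3}xE odd_double.
    rewrite bE {1}xE in ha; rewrite bE {2}xE in hb; move: h ha hb.
    case: (fw _ _ _ _) => [s|] //; case: (fw _ _ _ _) => [t|] //=; lia.
  - have bE : bar x = x./2.*2 by rewrite /bar {1 2 3}xE /= odd_double.
    rewrite bE {1}xE in ha; rewrite bE {2}xE in hb; move: h ha hb.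
    case: (fw _ _ _ _) => [s|] //; case: (fw _ _ _ _) => [t|] //=; lia.
have e x y : (x < q + q)%N -> (y < q + q)%N -> squared N M x y = M' x y.
  by move=> xq yq; rewrite eM // eT // widen_lt.
split.
- by apply: power_matrix_ext e _; apply: squared_power.
- by apply: exact_matrix_ext e _; apply: (@squared_exact N es mu).
- case: hd => [[d0 ng]|[d1 [x [y /and3P[xq yq /ogtP[d [h1 h2]]]]]]]; [left|right]; split=> //.
    move=> x y d xq yq; rewrite eM; [|lia|lia]; apply: ogtPn.
    by have := ng x y; rewrite /grows xq yq.
  by exists x, y, d; rewrite eM //; lia.
Qed.

End SquareSpec.

(** * Termination criterion *)

Section Termination.
Variables (N : nat) (es : seq edge) (mu : nat).
Let q := N.*2.
Hypothesis es_lt : forall e, e \in es -> (e.1.1 < q + q)%N /\ (e.1.2 < q + q)%N.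
Hypothesis es_bar : forall x y w, (x, y, w) \in es -> (bar y, bar x, w) \in es.
Hypothesis es_mu : forall e, e \in es -> (`|e.2| <= mu)%N.

(** Fixes each entry by the upper bounds it satisfies; parallel edges then need no explicit
    minimum. *)
Definition base_matrix (M : mat) : Prop := forall x y d,
  (x < q + q)%N -> (y < q + q)%N ->
  ole (M x y) d = (x == y) && (0 <= d) || has (fun e => (e.1 == (x, y)) && (e.2 <= d)) es.

Lemma gidx1 x : gidx N 1 x = x.
Proof. by rewrite /gidx muln0 addn0 if_same. Qed.

Lemma base_edge M x y w : base_matrix M -> (x, y, w) \in es -> ole (M x y) w.
Proof.
move=> bM m; have [/= h1 h2] := es_lt m.
by rewrite bM //; apply/orP; right; apply/hasP; exists (x, y, w); rewrite //= eqxx lexx.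
Qed.

Lemma base_power M : base_matrix M -> power_matrix N es mu 1 M.
Proof.
move=> bM; split=> [x y d xq yq|x y d xq yq|x xq|v cv sv|x y xq yq].
- rewrite bM // !gidx1 => /orP[/andP[/eqP -> d0]|/hasP[[[a b] w] m /andP[/eqP[<- <-] wd]]].
    exact: reach_refl.
  apply: reachW wd _; have := @reach_edge q es 1 (0%N, (a, b, w)) isT m.
  by rewrite /src /dst muln0 !addn0.
- rewrite !gidx1 => -[p [u w h]]; elim: p x d xq u w h => [|[l [[a b] w]] p IH] x d xq.
    move=> _ /= /eqP <-; rewrite wt_nil => d0; apply: DerBase => //.
    by rewrite bM // eqxx d0.
  case/andP=> /andP[]; case: l => // _ m u; rewrite /= /src /dst muln0 !addn0 /=.
  move=> /andP[/eqP <- wk]; rewrite wt_cons /= => h.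
  rewrite -(subrK w d) addrC; have [/= aq bq] := es_lt m.
  apply: (@DerTrans _ _ _ b); first by apply: DerBase => //; apply: base_edge m.
  by apply: IH => //; rewrite lerBrDl.
- by rewrite bM // eqxx lexx.
- exists v; split=> // [|x _]; last by rewrite gidx1.
  move=> [l [[a b] w]]; case: l => // _ m; rewrite /src /dst muln0 !addn0 /=.
  have [aq bq] := es_lt m; exact: sv aq bq (base_edge bM m).
- case E: (M x y) => [t|] //=.
  have := bM x y t xq yq; rewrite E /= lexx => /esym/orP[/andP[/eqP xy t0]|].
    have := bM x y 0 xq yq; rewrite E xy eqxx /= => t1; suff -> : t = 0 by [].
    by apply/eqP; rewrite eq_le t0 t1.
  case/hasP=> [[[a b] w] m /andP[/eqP[ax by_] /= wt]]; rewrite ax by_ in m.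
  have := base_edge bM m; rewrite E /= => tw.
  have -> : t = w by apply/eqP; rewrite eq_le tw wt.
  have q0 : (0 < q)%N by lia.
  by apply: leq_trans (es_mu m) _; rewrite leq_pmull // muln_gt0 q0.
Qed.

Definition join (v w : nat -> int) (x : nat) : int := if (x < q)%N then v x else w (x - q)%N.

Definition linked (v w : nat -> int) : Prop :=
  forall x y c, (x, y, c) \in es -> join v w x - join v w y <= c.

Lemma linked_sat (s : nat -> nat -> int) : (0 < N)%N ->
  (forall k, coherent (s k)) -> (forall k, linked (s k) (s k.+1)) ->
  exists z, coherent z /\ forall n, sat q es n z.
Proof.
move=> N0 cs ls; have q0 : (0 < q)%N by rewrite double_gt0.
exists (fun u => s (u %/ q)%N (u %% q)%N); split=> [x|n [l [[x y] c]] /= _ m].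
  have e : bar x = (bar (x %% q) + q * (x %/ q))%N.
    by rewrite -bar_shift -/q addnC mulnC -divn_eq.
  have lt : (bar (x %% q) < q)%N.
    by rewrite -ltn_half_double half_bar ltn_half_double ltn_mod.
  have {1}-> : (bar x %/ q = x %/ q)%N.
    by rewrite e addnC mulnC divnMDl // (divn_small lt) addn0.
  have -> : (bar x %% q = bar (x %% q))%N.
    by rewrite e addnC mulnC modnMDl (modn_small lt).
  exact: cs.
have e t : (t < q + q)%N ->
    s ((t + q * l) %/ q)%N ((t + q * l) %% q)%N = join (s l) (s l.+1) t.
  move=> tq; rewrite addnC mulnC divnMDl // modnMDl /join; case: ltnP => h.
    by rewrite (divn_small h) (modn_small h) addn0.
  have tq' : (t - q < q)%N by lia.
  by rewrite -{1 2}(subnK h) divnDr ?dvdnn // divnn q0 modnDr (divn_small tq') (modn_small tq') add0n addn1.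
by have [h1 h2] := es_lt m; rewrite /src /dst /= !e //; apply: ls.
Qed.

Lemma coherent_shift v : coherent v -> coherent (fun x => v (x + q)%N).
Proof. by move=> cv x; rewrite -cv barD. Qed.

(** [X] is the domain given by the bounds of [M]. By stability, [v] in [X] extends over [2n] layers.
    Layer 1 of the extension is in [X] again: a walk of depth [n] moved up by one layer stays within
    [n + 1 <= 2n] layers. *)
Lemma stable_run n M M' : (0 < n)%N ->
  power_matrix N es mu n M -> exact_matrix N es (n + n) M' ->
  (forall x y d, (x < q)%N -> (y < q)%N -> ole (M' x y) d -> ole (M x y) d) ->
  exists s : nat -> nat -> int,
    forall k, coherent (s k) /\ linked (s k) (s k.+1).
Proof.
move=> n0 pM eM' stab; have qq x : (x < q)%N -> (x < q + q)%N by lia.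
pose X (v : nat -> int) := coherent v /\
  forall x y d, (x < q)%N -> (y < q)%N -> ole (M x y) d -> v x - v y <= d.
have soundM x y d : (x < q)%N -> (y < q)%N -> ole (M x y) d -> reach q es n x y d.
  move=> xq yq /(pm_sound pM (qq _ xq) (qq _ yq)).
  by rewrite /gidx -/q xq yq.
have step v : X v -> exists w, X w /\ linked v w.
  move=> [cv sv].
  have [|V [cV sV eV]] := em_extend eM' (S := fun i => (i < N)%N) cv.
    move=> x y d _ _; rewrite !ltn_half_double -/q => xq yq /(stab _ _ _ xq yq).
    exact: sv.
  have {}eV x : (x < q)%N -> V x = v x.
    by move=> xq; rewrite -eV ?qq ?ltn_half_double // /gidx -/q xq.
  exists (fun x => V (x + q)%N); split.
    split=> [|x y d xq yq /(soundM _ _ _ xq yq) r]; first exact: coherent_shift.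
    have := sat_reach sV; apply; apply: (@reach_mono _ _ (n + 1)).
      by rewrite leq_add2l.
    by have := reach_shift 1 r; rewrite muln1.
  move=> x y c m; have nn : (0 < n + n)%N by rewrite addn_gt0 n0.
  have := satE sV nn m; rewrite -/q muln0 !addn0.
  have jE t : join v (fun x => V (x + q)%N) t = V t.
    by rewrite /join; case: ltnP => tq; [rewrite eV|rewrite subnK].
  by rewrite !jE.
have [v0 X0] : exists v, X v.
  have c0 : coherent (fun=> 0) by move=> x; rewrite oppr0.
  have [|V [cV sV _]] := em_extend eM' (S := pred0) c0; first by move=> x y.
  exists V; split=> // x y d xq yq /(soundM _ _ _ xq yq) r.
  by apply: sat_reach sV _; apply: reach_mono r; apply: leq_addr.
(* Dependent choice along [step], with membership in [X] carried by the type. *)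
pose next (v : {v | X v}) : {v | X v} :=
  let: exist v Xv := v in
  let: exist w wP := constructive_indefinite_description _ (step v Xv) in
  exist _ w (proj1 wP).
exists (fun k => sval (iter k next (exist _ v0 X0))) => k.
rewrite iterS; move: (iter k next _) => [v Xv] /=.
case: constructive_indefinite_description => w [Xw lw] /=.
by split=> //; case: Xv.
Qed.

Lemma run_stable n M M' z : (3 ^ q <= n)%N -> coherent z -> (forall m, sat q es m z) ->
  exact_matrix N es n M -> power_matrix N es mu (n + n) M' ->
  forall x y d, (x < q)%N -> (y < q)%N -> ole (M' x y) d -> ole (M x y) d.
Proof.
move=> qn cz satz eM pM' x y d xq yq h; have qq t : (t < q)%N -> (t < q + q)%N by lia.
have := pm_sound pM' (qq _ xq) (qq _ yq) h; rewrite /gidx -/q xq yq.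
move/(reach_bounded es_lt satz xq yq)/(reach_mono qn) => r.
by apply: (em_complete eM); rewrite ?qq // /gidx -/q xq yq.
Qed.

End Termination.

(** * Octagonal constraints as edges between signed variables *)

Definition atom_pair N (a : atom N) : shape * (var N * var N) * int := (lhs a, rhs a).
Definition pair_atom N (p : shape * (var N * var N) * int) : atom N := Atom p.1 p.2.
Lemma atom_pairK N : cancel (@atom_pair N) (@pair_atom N).
Proof. by case. Qed.
HB.instance Definition _ N := Equality.copy (atom N) (can_type (@atom_pairK N)).

Section Octagon.
Variables (N : nat).
Let q := N.*2.

Definition var_nat (u : var N) : nat := match u with inl i => i | inr i => (N + i)%N end.

(** Every left-hand side is a difference of signed variables: [u + v] is [u - (-v)] and [- u - v] is
    [(-u) - v]. A set bit marks a negated variable. *)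
Definition atom_shift (s : shape) : bool * bool :=
  match s with Diff => (false, false) | Plus => (false, true) | OppPlus => (true, false) end.

(* An atom contributes an edge between signed variables together with the
   mirror edge between their opposites. *)
Definition atom_edges (a : atom N) : seq edge :=
  let: (s, (u, v)) := lhs a in
  let: (bu, bv) := atom_shift s in
  [:: (((var_nat u).*2 + bu)%N, ((var_nat v).*2 + bv)%N, rhs a);
      (((var_nat v).*2 + ~~ bv)%N, ((var_nat u).*2 + ~~ bu)%N, rhs a)].

Definition oct_edges (R : octagon N) : seq edge := flatten [seq atom_edges a | a <- R].

Lemma var_nat_lt u : (var_nat u < N + N)%N.
Proof. by case: u => i /=; have := ltn_ord i; lia. Qed.

Lemma signed_lt u (b : bool) : ((var_nat u).*2 + b < q + q)%N.
Proof. by have := var_nat_lt u; rewrite /q; case: b; lia. Qed.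

Lemma bar_signed c (b : bool) : bar (c.*2 + b) = (c.*2 + ~~ b)%N.
Proof. by rewrite addnC barD addnC; case: b. Qed.

Lemma oct_edgesP (R : octagon N) e : reflect (exists2 a, a \in R & e \in atom_edges a) (e \in oct_edges R).
Proof. exact: flatten_mapP. Qed.

Lemma atom_edges_lt a e : e \in atom_edges a -> (e.1.1 < q + q)%N /\ (e.1.2 < q + q)%N.
Proof.
rewrite /atom_edges; case: a => [[s [u v]] c] /=; case: (atom_shift s) => bu bv.
by rewrite !inE => /orP[]/eqP -> /=; split; apply: signed_lt.
Qed.

Lemma oct_edges_lt (R : octagon N) e : e \in oct_edges R -> (e.1.1 < q + q)%N /\ (e.1.2 < q + q)%N.
Proof. by case/oct_edgesP=> a _; apply: atom_edges_lt. Qed.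

Lemma oct_edges_bar (R : octagon N) x y w :
  (x, y, w) \in oct_edges R -> (bar y, bar x, w) \in oct_edges R.
Proof.
case/oct_edgesP=> a aR h; apply/oct_edgesP; exists a => //; move: h.
rewrite /atom_edges; case: a {aR} => [[s [u v]] c] /=; case: (atom_shift s) => bu bv.
rewrite !inE => /orP[]/eqP[-> -> ->]; rewrite !bar_signed ?negbK !eqxx ?orbT //.
Qed.

Lemma oct_edges_mu (R : octagon N) e : e \in oct_edges R -> (`|e.2| <= mu R)%N.
Proof.
case/oct_edgesP=> a aR h; rewrite /mu.
apply: leq_trans (@leq_bigmax_seq _ R xpredT (fun a : atom N => `|rhs a|%N) a aR isT).
move: h; rewrite /atom_edges; case: a {aR} => [[s [u v]] c] /=.
by case: (atom_shift s) => bu bv; rewrite !inE => /orP[]/eqP ->.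
Qed.

Definition unsign (v : nat -> int) : valuation N := fun i => v i.*2.

(** The default 0 makes the result coherent on vertices beyond the variables too. *)
Definition sign (nu : valuation N) (x : nat) : int :=
  let a := if insub x./2 is Some i then nu i else 0 in if odd x then - a else a.

Lemma sign_coherent nu : coherent (sign nu).
Proof.
move=> x; rewrite /sign half_bar; have -> : odd (bar x) = ~~ odd x.
  rewrite /bar; case ox: (odd x); last by rewrite /= ox.
  by case: x ox => //= x /negbTE.
by case: (odd x); rewrite /= ?opprK.
Qed.

Lemma signK nu : unsign (sign nu) =1 nu.
Proof. by move=> i; rewrite /unsign /sign odd_double doubleK valK. Qed.

Section Pair.
Variables (v w : nat -> int).
Hypotheses (cv : coherent v) (cw : coherent w).

Lemma join_coherent : coherent (join N v w).
Proof.
move=> x; rewrite /join; have -> : (bar x < N.*2)%N = (x < N.*2)%N.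
  by rewrite -!ltn_half_double half_bar.
by case: ltnP => h; rewrite ?cv // -cw -{1}(subnK h) barD addnK.
Qed.

Lemma join_signed u (b : bool) : join N v w ((var_nat u).*2 + b) =
  if b then - eval_var (unsign v) (unsign w) u else eval_var (unsign v) (unsign w) u.
Proof.
have e : join N v w (var_nat u).*2 = eval_var (unsign v) (unsign w) u.
  case: u => i; rewrite /join /= /unsign; first by rewrite ltn_double ltn_ord.
  by rewrite doubleD ltnNge leq_addr /= addKn.
case: b; last by rewrite addn0 e.
by rewrite -e -join_coherent -{2}[(_).*2]addn0 (bar_signed _ false).
Qed.

Lemma linked_oct (R : octagon N) : linked N (oct_edges R) v w <-> oct_rel R (unsign v) (unsign w).
Proof.
rewrite /oct_rel; split=> [lk|/allP h x y c /oct_edgesP[a aR]].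
  apply/allP => a aR.
  have := lk ((var_nat (lhs a).2.1).*2 + (atom_shift (lhs a).1).1)%N
             ((var_nat (lhs a).2.2).*2 + (atom_shift (lhs a).1).2)%N (rhs a).
  rewrite !join_signed => h.
  case: a aR h => [[s [u t]] c] aR /= h; apply: le_trans (h _).
    by case: s {aR h}; rewrite /= ?opprK.
  apply/oct_edgesP; exists (Atom (s, (u, t)) c) => //.
  by rewrite /atom_edges /=; case: (atom_shift s) => bu bv; rewrite inE eqxx.
have j0 u := join_signed u false; have j1 u := join_signed u true.
rewrite /= in j0 j1; have := h a aR; case: a {aR} => [[s [u t]] c'] /=.
by case: s => hh; rewrite /= !inE => /orP[]/eqP[-> -> ->]; rewrite ?j0 ?j1; lia.
Qed.

End Pair.

Lemma oct_rel_ext (R : octagon N) nu1 nu1' nu2 nu2' : nu1 =1 nu2 -> nu1' =1 nu2' ->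
  oct_rel R nu1 nu1' -> oct_rel R nu2 nu2'.
Proof.
move=> e e'; apply: sub_all => -[[s [u v]] c]; rewrite /eval_lhs /=.
have ev w : eval_var nu1 nu1' w = eval_var nu2 nu2' w by case: w => i /=.
by rewrite !ev.
Qed.

Lemma run_potential (R : octagon N) (nu : nat -> valuation N) : (0 < N)%N ->
  (forall i, oct_rel R (nu i) (nu i.+1)) ->
  exists z, coherent z /\ forall n, sat q (oct_edges R) n z.
Proof.
move=> N0 h; apply: (@linked_sat N _ (@oct_edges_lt R) (fun k => sign (nu k))) => // k.
  exact: sign_coherent.
apply/linked_oct; try exact: sign_coherent.
by apply: oct_rel_ext (h k) => i; rewrite signK.
Qed.

Lemma potential_run (R : octagon N) (s : nat -> nat -> int) :
  (forall k, coherent (s k) /\ linked N (oct_edges R) (s k) (s k.+1)) ->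
  exists nu : nat -> valuation N, forall i, oct_rel R (nu i) (nu i.+1).
Proof.
move=> h; exists (fun k => unsign (s k)) => k; have [c l] := h k.
by apply/(linked_oct c (proj1 (h k.+1))).
Qed.

End Octagon.

(** * Programs and cost *)

Section Run.
Variable B : nat.

Definition bounded (m : memory) : Prop := forall x, (`|m x| <= B)%N.

(* Bounding every cell by B makes the logarithmic cost of a primitive step O(log B),
   so that it suffices to count steps. *)
Inductive run : com -> memory -> nat -> memory -> Prop :=
| RunSkip m : run Skip m 1 m
| RunPut m a e : bounded m -> run (Put a e) m 1 (upd m (eval m a) (eval m e))
| RunSeq m m1 m2 c1 c2 t1 t2 :
    run c1 m t1 m1 -> run c2 m1 t2 m2 -> run (Seq c1 c2) m (t1 + t2) m2
| RunIfTrue m m1 e c1 c2 t :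
    bounded m -> 0 < eval m e -> run c1 m t m1 -> run (IfPos e c1 c2) m t.+1 m1
| RunIfFalse m m1 e c1 c2 t :
    bounded m -> eval m e <= 0 -> run c2 m t m1 -> run (IfPos e c1 c2) m t.+1 m1
| RunWhileTrue m m1 m2 e c t1 t2 :
    bounded m -> 0 < eval m e -> run c m t1 m1 -> run (WhilePos e c) m1 t2 m2 ->
    run (WhilePos e c) m (t1 + t2).+1 m2
| RunWhileFalse m e c : bounded m -> eval m e <= 0 -> run (WhilePos e c) m 1 m.

End Run.

(** If all cells are bounded by [B], values are at most [esize e * B]. [ecost] and [ccost] bound
    costs in units of the bit length of [B]. All three depend on the program text only. *)
Fixpoint esize (e : expr) : nat :=
  match e with
  | Cst z => `|z|%N
  | Get e1 => 1
  | Add e1 e2 | Sub e1 e2 => esize e1 + esize e2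
  | Half e1 => esize e1
  end.

Fixpoint ecost (e : expr) : nat :=
  match e with
  | Cst z => bitlen z
  | Get e1 => ecost e1 + (esize e1).+1 + 2
  | Add e1 e2 | Sub e1 e2 => ecost e1 + ecost e2 + (esize e1).+1 + (esize e2).+1
  | Half e1 => ecost e1 + (esize e1).+1
  end.

Fixpoint ccost (c : com) : nat :=
  match c with
  | Skip => 1
  | Put a e => ecost a + ecost e + (esize a).+1 + (esize e).+1
  | Seq c1 c2 => ccost c1 + ccost c2
  | IfPos e c1 c2 => ecost e + (esize e).+1 + ccost c1 + ccost c2
  | WhilePos e c => ecost e + (esize e).+1 + ccost c
  end.

Section Cost.
Variables (B : nat).
Hypothesis B0 : (0 < B)%N.
Let L := bitlen B%:Z.

(** A factor [k] is below [2 ^ k], so it adds at most [k] bits. *)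
Lemma bitlen_mul k z : (`|z| <= k * B)%N -> (bitlen z <= k.+1 * L)%N.
Proof.
move=> zk; apply: (@leq_trans (k + L)%N); last first.
  by rewrite mulSn addnC leq_add2l leq_pmulr.
rewrite /bitlen; have [->|z0] := posnP `|z|%N; first by rewrite trunc_log0 /L /bitlen; lia.
rewrite -(ltn_exp2l _ _ (ltnSn 1)); apply: leq_ltn_trans (trunc_logP _ z0) _ => //.
apply: leq_ltn_trans zk _; rewrite expnD.
apply: (@leq_ltn_trans (2 ^ k * B)%N); first by rewrite leq_mul2r ltnW ?orbT // ltn_expl.
by rewrite ltn_pmul2l ?expn_gt0 // trunc_log_ltn.
Qed.

Lemma eval_bound m e : bounded B m -> (`|eval m e| <= esize e * B)%N.
Proof.
move=> bm; elim: e => [z|e IH|e1 IH1 e2 IH2|e1 IH1 e2 IH2|e IH] /=.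
- exact: leq_pmulr.
- by rewrite mul1n.
- by rewrite mulnDl; lia.
- by rewrite mulnDl; lia.
- by apply: leq_trans IH; lia.
Qed.

Lemma cost_bound m e : bounded B m -> (cost m e <= ecost e * L)%N.
Proof.
move=> bm; have v e' := bitlen_mul (eval_bound e' bm).
elim: e => [z|e IH|e1 IH1 e2 IH2|e1 IH1 e2 IH2|e IH] /=.
- exact: leq_pmulr.
- rewrite !mulnDl; apply: leq_add; first by apply: leq_add => //; apply: v.
  by apply: bitlen_mul; rewrite mul1n.
- by rewrite !mulnDl; apply: leq_add (v e2); apply: leq_add (v e1); apply: leq_add.
- by rewrite !mulnDl; apply: leq_add (v e2); apply: leq_add (v e1); apply: leq_add.
- by rewrite mulnDl leq_add.
Qed.

(** Each counted step executes one primitive of the text and is charged for the whole text, which is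
    a constant of the program. *)
Lemma run_exec c m s m' : run B c m s m' ->
  exists2 t, exec c m t m' & (t <= s * (ccost c * L))%N.
Proof.
have test m0 e : bounded B m0 ->
    (cost m0 e + bitlen (eval m0 e) <= (ecost e + (esize e).+1) * L)%N.
  by move=> bm; rewrite mulnDl leq_add ?cost_bound // bitlen_mul // eval_bound.
elim=> {c m s m'}.
- by move=> m; exists 1%N; [constructor|rewrite !mul1n].
- move=> m a e bm; eexists; first by constructor.
  have := leq_add (test m a bm) (test m e bm); rewrite mul1n /= -mulnDl.
  by move=> h; apply: leq_trans (leq_trans h _); rewrite ?leq_mul2r; lia.
- move=> m m1 m2 c1 c2 s1 s2 _ [t1 e1 h1] _ [t2 e2 h2].
  exists (t1 + t2)%N; first exact: ExecSeq e1 e2.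
  rewrite mulnDl; apply: leq_add; [apply: leq_trans h1 _|apply: leq_trans h2 _].
    by rewrite leq_mul // leq_mul2r /= leq_addr ?orbT.
  by rewrite leq_mul // leq_mul2r /= leq_addl ?orbT.
- move=> m m1 e c1 c2 s bm pos _ [t e1 h].
  eexists; first exact: ExecIfTrue pos e1.
  rewrite mulSn leq_add //; last first.
    by apply: leq_trans h _; apply: leq_mul => //; apply: leq_mul => //=; lia.
  by apply: leq_trans (test m e bm) _; apply: leq_mul => //=; lia.
- move=> m m1 e c1 c2 s bm pos _ [t e1 h].
  eexists; first exact: ExecIfFalse pos e1.
  rewrite mulSn leq_add //; last first.
    by apply: leq_trans h _; apply: leq_mul => //; apply: leq_mul => //=; lia.
  by apply: leq_trans (test m e bm) _; apply: leq_mul => //=; lia.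
- move=> m m1 m2 e c s1 s2 bm pos _ [t1 e1 h1] _ [t2 e2 h2].
  eexists; first exact: ExecWhileTrue pos e1 e2.
  rewrite -addSn mulnDl leq_add // mulSn leq_add //; last first.
    by apply: leq_trans h1 _; apply: leq_mul => //; apply: leq_mul => //=; lia.
  by apply: leq_trans (test m e bm) _; apply: leq_mul => //=; lia.
- move=> m e c bm neg; eexists; first exact: ExecWhileFalse neg.
  rewrite mul1n; apply: leq_trans (test m e bm) _.
  by apply: leq_mul => //=; lia.
Qed.

End Cost.

(** * Weakest preconditions with a step budget *)

Definition wp (B : nat) (c : com) (s : nat) (Q : memory -> Prop) (m : memory) : Prop :=
  exists s' m', [/\ (s' <= s)%N, run B c m s' m' & Q m'].

Section Wp.
Variable B : nat.
Local Notation wp := (wp B).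

Lemma wp_mono c s s' (Q Q' : memory -> Prop) m : (s <= s')%N ->
  (forall m', Q m' -> Q' m') -> wp c s Q m -> wp c s' Q' m.
Proof. by move=> ss' QQ' [t [m' [ts r /QQ' q]]]; exists t, m'; rewrite (leq_trans ts). Qed.

Lemma wp_skip (Q : memory -> Prop) m : Q m -> wp Skip 1 Q m.
Proof. by move=> q; exists 1%N, m; split=> //; constructor. Qed.

Lemma wp_put a e (Q : memory -> Prop) m : bounded B m ->
  Q (upd m (eval m a) (eval m e)) -> wp (Put a e) 1 Q m.
Proof. by move=> bm q; eexists 1%N, _; split; [|apply: RunPut|exact: q]. Qed.

Lemma wp_seq c1 c2 s1 s2 (Q : memory -> Prop) m :
  wp c1 s1 (wp c2 s2 Q) m -> wp (Seq c1 c2) (s1 + s2) Q m.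
Proof.
move=> [t1 [m1 [h1 r1 [t2 [m2 [h2 r2 q]]]]]]; exists (t1 + t2)%N, m2.
by rewrite leq_add //; split=> //; apply: RunSeq r1 r2.
Qed.

Lemma wp_if e c1 c2 s (Q : memory -> Prop) m : bounded B m ->
  (0 < eval m e -> wp c1 s Q m) -> (eval m e <= 0 -> wp c2 s Q m) ->
  wp (IfPos e c1 c2) s.+1 Q m.
Proof.
move=> bm h1 h2; case: (ltP 0 (eval m e)) => h.
  by have [t [m' [ts r q]]] := h1 h; exists t.+1, m'; split=> //; apply: RunIfTrue r.
by have [t [m' [ts r q]]] := h2 h; exists t.+1, m'; split=> //; apply: RunIfFalse r.
Qed.

(** For counted loops: the guard is the number of iterations left and serves as the variant. *)
Lemma wp_while e c n s (I : nat -> memory -> Prop) m :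
  (forall k m', (k <= n)%N -> I k m' -> bounded B m' /\ eval m' e = (n - k)%N%:Z) ->
  (forall k m', (k < n)%N -> I k m' -> wp c s (I k.+1) m') ->
  I 0%N m -> wp (WhilePos e c) (n * s.+1 + 1) (I n) m.
Proof.
move=> test body I0.
suff h j k m' : (j + k = n)%N -> I k m' -> wp (WhilePos e c) (j * s.+1 + 1) (I n) m'.
  by apply: h I0; rewrite addn0.
elim: j k m' => [|j IH] k m' jk Ik; have [|bm ev] := test k m' _ Ik; try lia.
  exists 1%N, m'; split=> //; last by rewrite -jk.
  by apply: RunWhileFalse => //; rewrite ev; lia.
have [|t [m1 [ts r I1]]] := body k m' _ Ik; first lia.
have [|t2 [m2 [ts2 r2 q]]] := IH k.+1 m1 _ I1; first lia.
exists (t + t2).+1, m2; split=> //; first by rewrite mulSn; lia.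
by apply: RunWhileTrue r r2 => //; rewrite ev; lia.
Qed.

End Wp.

(* The input occupies the nonnegative addresses.  Below 0 come constants,
   registers, and, from - 64 on, matrix cells, where i * D + j indexes entries
   and a mod 8 selects a component: 0 to 3 are flags and values of the two
   matrices (a null flag means no bound) and 4 is the table of row addresses,
   which replaces the missing multiplication. *)
Lemma upd_eq m x v : upd m x v x = v. Proof. by rewrite /upd eqxx. Qed.
Lemma upd_neqb m x v y : y != x -> upd m x v y = m y.
Proof. by rewrite /upd => /negbTE ->. Qed.
Lemma upd_neq m x v y : y <> x -> upd m x v y = m y.
Proof. by move/eqP; apply: upd_neqb. Qed.

Definition const_addr (c : nat) : int := - (c.+1)%:Z.
Definition reg_addr (r : nat) : int := - (r + 9)%N%:Z.
Definition cell_addr (D a i j : nat) : int := - (64 + 8 * (i * D + j) + a)%N%:Z.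

Definition K (c : nat) : expr := Get (Cst (const_addr c)).
Definition V (r : nat) : expr := Get (Cst (reg_addr r)).
Definition twice (e : expr) : expr := Add e e.
Definition times8 (e : expr) : expr := twice (twice (twice e)).
(** The table of row addresses is stored in component 4 of the cells of row 0. *)
Definition Row (ei : expr) : expr := Sub (Cst (- 68%:Z)) (times8 ei).
Definition Cell (a : nat) (ei ej : expr) : expr :=
  Sub (Get (Row ei)) (Add (times8 ej) (Cst a%:Z)).
Definition Flag (b : bool) ei ej : expr := Get (Cell b.*2 ei ej).
Definition Val (b : bool) ei ej : expr := Get (Cell b.*2.+1 ei ej).

Record state := State { entries : bool -> mat ; reg : nat -> int }.
Definition set_reg st r v : state :=
  State (entries st) (fun r' => if r' == r then v else reg st r').
Definition set_entry st b i j o : state :=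
  State (fun b' x y => if [&& b' == b, x == i & y == j] then o else entries st b' x y)
        (reg st).

Definition Set_ (r : nat) (e : expr) : com := Put (Cst (reg_addr r)) e.
Definition Clear b ei ej : com := Put (Cell b.*2 ei ej) (Cst 0).
Definition Min b ei ej e : com :=
  IfPos (Flag b ei ej)
    (IfPos (Sub (Val b ei ej) e) (Put (Cell b.*2.+1 ei ej) e) Skip)
    (Seq (Put (Cell b.*2.+1 ei ej) e) (Put (Cell b.*2 ei ej) (Cst 1))).
Definition For (r : nat) (e : expr) (c : com) : com :=
  Seq (Set_ r (Cst 0))
    (WhilePos (Sub e (V r)) (Seq c (Set_ r (Add (V r) (Cst 1))))).

Section Represent.
Variables (B D : nat) (const : nat -> nat) (inp : nat -> int).
Hypothesis B_small : (64 < B)%N.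

(** The value cell is unconstrained under a null flag, so clearing writes the flag only and zeroed
    memory represents matrices without bounds. *)
Definition holds (m : memory) (D a b : nat) i j (o : option int) : Prop :=
  if o is Some v then m (cell_addr D a i j) = 1 /\ m (cell_addr D b i j) = v
  else m (cell_addr D a i j) = 0.

Record represents (st : state) (m : memory) : Prop := Represents {
  rep_bounded : bounded B m;
  rep_input : forall k : nat, m k%:Z = inp k;
  rep_const : forall c, (c < 4)%N -> m (const_addr c) = (const c)%:Z;
  rep_reg : forall r, (r < 48)%N -> m (reg_addr r) = reg st r;
  rep_row : forall i, (i < D)%N -> m (- (68 + 8 * i)%N%:Z) = cell_addr D 0 i 0;
  rep_entry : forall (b : bool) i j, (i < D)%N -> (j < D)%N ->
    holds m D b.*2 b.*2.+1 i j (entries st b i j)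
}.

Definition evals st e z : Prop := forall m, represents st m -> eval m e = z.

(** The same calculus on abstract states, so that programs can be verified without speaking of
    addresses. *)
Definition wps c s (Q : state -> Prop) st : Prop := forall m, represents st m ->
  wp B c s (fun m' => exists2 st', represents st' m' & Q st') m.

Lemma wps_mono c s s' (Q Q' : state -> Prop) st : (s <= s')%N ->
  (forall st', Q st' -> Q' st') -> wps c s Q st -> wps c s' Q' st.
Proof.
by move=> ss' QQ' h m /h; apply: wp_mono => // m' [st' r /QQ']; exists st'.
Qed.

Lemma wps_skip (Q : state -> Prop) st : Q st -> wps Skip 1 Q st.
Proof. by move=> q m r; apply: wp_skip; exists st. Qed.

Lemma wps_seq c1 c2 s1 s2 (Q : state -> Prop) st :
  wps c1 s1 (wps c2 s2 Q) st -> wps (Seq c1 c2) (s1 + s2) Q st.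
Proof.
move=> h m /h h'; apply: wp_seq; apply: wp_mono h' => // m' [st' r h2].
exact: h2.
Qed.

Lemma wps_if e z c1 c2 s (Q : state -> Prop) st : evals st e z ->
  (0 < z -> wps c1 s Q st) -> (z <= 0 -> wps c2 s Q st) ->
  wps (IfPos e c1 c2) s.+1 Q st.
Proof.
move=> ev h1 h2 m r; apply: wp_if; first exact: rep_bounded r.
  by rewrite (ev _ r) => /h1; apply.
by rewrite (ev _ r) => /h2; apply.
Qed.

Lemma evals_cst st z : evals st (Cst z) z. Proof. by []. Qed.
Lemma evals_add st e1 e2 z1 z2 : evals st e1 z1 -> evals st e2 z2 ->
  evals st (Add e1 e2) (z1 + z2).
Proof. by move=> h1 h2 m r; rewrite /= h1 ?h2. Qed.
Lemma evals_sub st e1 e2 z1 z2 : evals st e1 z1 -> evals st e2 z2 ->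
  evals st (Sub e1 e2) (z1 - z2).
Proof. by move=> h1 h2 m r; rewrite /= h1 ?h2. Qed.
Lemma evals_half st e z : evals st e z -> evals st (Half e) (z %/ 2)%Z.
Proof. by move=> h m r; rewrite /= h. Qed.
Lemma evals_K st c : (c < 4)%N -> evals st (K c) (const c)%:Z.
Proof. by move=> c4 m r /=; apply: rep_const r _ c4. Qed.
Lemma evals_V st r : (r < 48)%N -> evals st (V r) (reg st r).
Proof. by move=> r4 m h /=; apply: rep_reg h _ r4. Qed.
Lemma evals_input st e (k : nat) : evals st e k%:Z -> evals st (Get e) (inp k).
Proof. by move=> h m r; rewrite /= h // (rep_input r). Qed.
Lemma evals_eq st e z z' : evals st e z -> z = z' -> evals st e z'.
Proof. by move=> h <-. Qed.

Lemma eval_cell st m a ei ej (i j : nat) : represents st m ->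
  eval m ei = i%:Z -> eval m ej = j%:Z -> (i < D)%N ->
  eval m (Cell a ei ej) = cell_addr D a i j.
Proof.
move=> r hi hj iD /=; rewrite hi hj.
have -> : - 68%:Z - (i%:Z + i%:Z + (i%:Z + i%:Z) + (i%:Z + i%:Z + (i%:Z + i%:Z)))
          = - (68 + 8 * i)%N%:Z by lia.
rewrite (rep_row r iD) /cell_addr; lia.
Qed.

Lemma cell_inj a i j a' i' j' : (a < 8)%N -> (a' < 8)%N -> (j < D)%N -> (j' < D)%N ->
  cell_addr D a i j = cell_addr D a' i' j' -> [/\ a = a', i = i' & j = j'].
Proof.
move=> a8 a8' jD jD' /oppr_inj[] e.
have [e1 e2] : a = a' /\ (i * D + j = i' * D + j')%N by lia.
have D0 : (0 < D)%N by apply: leq_ltn_trans jD.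
have := congr1 (fun x => x %/ D)%N e2; have := congr1 (fun x => x %% D)%N e2.
by rewrite !modnMDl !modn_small // !divnMDl // !divn_small // !addn0.
Qed.

Lemma upd_bounded m x v : bounded B m -> (`|v| <= B)%N -> bounded B (upd m x v).
Proof. by move=> bm bv y; rewrite /upd; case: ifP. Qed.

Lemma rep_set_reg st m r v : represents st m -> (r < 48)%N -> (`|v| <= B)%N ->
  represents (set_reg st r v) (upd m (reg_addr r) v).
Proof.
move=> h r4 bv; split.
- exact: upd_bounded (rep_bounded h) bv.
- by move=> k; rewrite upd_neq ?(rep_input h) // /reg_addr; lia.
- by move=> c c4; rewrite upd_neq ?(rep_const h) // /reg_addr /const_addr; lia.
- move=> r' r4' /=; case: eqVneq => [->|ne]; first by rewrite upd_eq.
  by rewrite upd_neq ?(rep_reg h) // /reg_addr; move/eqP: ne; lia.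
- by move=> i iD; rewrite upd_neq ?(rep_row h) // /reg_addr; lia.
- move=> b i j iD jD; have := rep_entry h b iD jD; rewrite /holds /=.
  have ne a : cell_addr D a i j <> reg_addr r.
    by rewrite /cell_addr /reg_addr; move: (8 * _)%N => x; lia.
  by case: (entries st b i j) => [v'|]; rewrite !upd_neq.
Qed.

Lemma wps_set r e z (Q : state -> Prop) st : evals st e z -> (r < 48)%N ->
  (`|z| <= B)%N -> Q (set_reg st r z) -> wps (Set_ r e) 1 Q st.
Proof.
move=> ev r4 bz q m h; apply: wp_put; first exact: rep_bounded h.
by rewrite (ev _ h); exists (set_reg st r z) => //; apply: rep_set_reg.
Qed.

Lemma rep_set_entry st m m' (b : bool) i j o : represents st m -> (i < D)%N -> (j < D)%N ->
  bounded B m' -> holds m' D b.*2 b.*2.+1 i j o ->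
  (forall x, x <> cell_addr D b.*2 i j -> x <> cell_addr D b.*2.+1 i j -> m' x = m x) ->
  represents (set_entry st b i j o) m'.
Proof.
move=> h iD jD bm' hh fr; have big a x y : exists t, cell_addr D a x y = - (64 + t)%N%:Z.
  by exists (8 * (x * D + y) + a)%N; rewrite /cell_addr addnA.
have b8 (c : bool) : (c.*2 < 8)%N by case: c.
have b8' (c : bool) : (c.*2.+1 < 8)%N by case: c.
have fr1 x : - 64%:Z < x -> m' x = m x.
  have [t1 e1] := big b.*2 i j; have [t2 e2] := big b.*2.+1 i j.
  by move=> hx; apply: fr; rewrite ?e1 ?e2; lia.
have fr2 a i' j' : (a < 8)%N -> (j' < D)%N -> (a./2 != b) || (i' != i) || (j' != j) ->
    m' (cell_addr D a i' j') = m (cell_addr D a i' j').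
  move=> a8 jD' ne; by apply: fr => /cell_inj[] // ea ei ej; move: ne;
      rewrite ea ei ej !eqxx; case: (b).
split=> //.
- by move=> k; rewrite fr1 ?(rep_input h) //; lia.
- by move=> c c4; rewrite fr1 ?(rep_const h) // /const_addr; lia.
- by move=> r r4; rewrite fr1 ?(rep_reg h) // /reg_addr; lia.
- move=> i' iD'; rewrite -(rep_row h iD').
  have -> : - (68 + 8 * i')%N%:Z = cell_addr D 4 0 i' by rewrite /cell_addr mul0n add0n; lia.
  by rewrite fr2 //; case: (b).
- move=> b' i' j' iD' jD' /=; case: and3P => [[/eqP -> /eqP -> /eqP ->] //|ne].
  have := rep_entry h b' iD' jD'; rewrite /holds !fr2 //=; move: ne;
    rewrite ?doubleK ?uphalf_double; case: b'; case: (b); case: (i' == i); case: (j' == j) => //= -[]; by split.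
Qed.

Section Entry.
Variables (st : state) (b : bool) (ei ej : expr) (i j : nat).
Hypotheses (hi : evals st ei i%:Z) (hj : evals st ej j%:Z) (iD : (i < D)%N) (jD : (j < D)%N).

Lemma cells_neq : cell_addr D b.*2 i j <> cell_addr D b.*2.+1 i j.
Proof. by rewrite /cell_addr; lia. Qed.

Lemma evals_val v : entries st b i j = Some v -> evals st (Val b ei ej) v.
Proof.
move=> e m h; rewrite /Val /= -/(eval m (Cell _ _ _)).
have := rep_entry h b iD jD; rewrite e => -[_ <-].
by rewrite -(eval_cell _ h (hi h) (hj h) iD).
Qed.

Lemma eval_flag m : represents st m ->
  eval m (Flag b ei ej) = (entries st b i j != None)%:Z.
Proof.
move=> h; have := rep_entry h b iD jD.
have -> : eval m (Flag b ei ej) = m (cell_addr D b.*2 i j).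
  by rewrite -(eval_cell _ h (hi h) (hj h) iD).
by case: (entries st b i j) => [v [-> _]|->].
Qed.

Lemma wps_entry c1 c2 s (Q : state -> Prop) :
  (forall v, entries st b i j = Some v -> wps c1 s Q st) ->
  (entries st b i j = None -> wps c2 s Q st) ->
  wps (IfPos (Flag b ei ej) c1 c2) s.+1 Q st.
Proof.
move=> h1 h2; apply: (@wps_if _ (entries st b i j != None)%:Z); first by move=> m; apply: eval_flag.
  by case: (entries st b i j) h1 h2 => // v h1 _ _; apply: (h1 v).
by case: (entries st b i j) h1 h2 => // _ h2 _; apply: h2.
Qed.

Lemma wps_clear (Q : state -> Prop) : Q (set_entry st b i j None) -> wps (Clear b ei ej) 1 Q st.
Proof.
move=> q m h; apply: wp_put; first exact: rep_bounded h.
rewrite (eval_cell _ h (hi h) (hj h) iD); exists (set_entry st b i j None) => //.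
apply: (rep_set_entry h) => //=; first by apply: upd_bounded (rep_bounded h) _.
  exact: upd_eq.
by move=> x h1 _; rewrite upd_neq.
Qed.

Lemma wps_min e v (Q : state -> Prop) : evals st e v -> (`|v| <= B)%N ->
  Q (set_entry st b i j (omin (entries st b i j) (Some v))) ->
  wps (Min b ei ej e) 3 Q st.
Proof.
move=> he bv q m h; have bm := rep_bounded h.
have cell a m0 : represents st m0 -> eval m0 (Cell a ei ej) = cell_addr D a i j.
  by move=> h0; apply: (eval_cell _ h0 (hi h0) (hj h0) iD).
have hE := rep_entry h b iD jD.
apply: wp_if => //; rewrite (eval_flag h); move: hE.
  case E: (entries st b i j) q => [t|] // q [e1 e2] _.
  have eS : eval m (Sub (Val b ei ej) e) = t - v.
    by apply: (evals_sub (evals_val E) he).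
  apply: wp_if => //; rewrite eS => tv.
    apply: wp_put => //; rewrite cell // (he _ h).
    exists (set_entry st b i j (Some (if v < t then v else t))); last exact: q.
    have -> : (v < t) = true by lia.
    apply: (rep_set_entry h) => //=; first exact: upd_bounded.
      by rewrite upd_eq upd_neq //; exact: cells_neq.
    by move=> x _ h2; rewrite upd_neq.
  apply: wp_skip; exists (set_entry st b i j (Some (if v < t then v else t))); last exact: q.
  have -> : (v < t) = false by lia.
  by apply: (rep_set_entry h).
case E: (entries st b i j) q => [t|] // q e1 _.
apply: (@wp_seq _ _ _ 1 1); apply: wp_put => //; rewrite cell // (he _ h).
set m1 := upd _ _ _; have bm1 : bounded B m1 by apply: upd_bounded.
(* Between the two writes the flag is still null: the memory represents the old state, and addresses
   evaluate as before. *)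
have h1 : represents st m1.
  case: (@rep_set_entry st m m1 b i j None h iD jD bm1) => /=.
  - by rewrite /m1 upd_neq //; exact: cells_neq.
  - by move=> x _ h2; rewrite /m1 upd_neq.
  move=> r1 r2 r3 r4 r5 r6; split=> // b' i' j' iD' jD'.
  by have := r6 b' i' j' iD' jD'; case: and3P => [[/eqP -> /eqP -> /eqP ->]|//]; rewrite E.
apply: wp_put => //; rewrite cell //=.
exists (set_entry st b i j (Some v)); last exact: q.
apply: (rep_set_entry h) => //=; first by apply: upd_bounded => //; lia.
  rewrite upd_eq upd_neq; first by rewrite /m1 upd_eq.
  by move=> e0; case: cells_neq; rewrite -e0.
by move=> x h2 h3; rewrite upd_neq // /m1 upd_neq.
Qed.

End Entry.

Lemma wps_for r e c n s (I : nat -> state -> Prop) st : (r < 48)%N -> (n <= B)%N ->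
  (forall st', evals st' e n%:Z) ->
  I 0%N (set_reg st r 0) ->
  (forall k st', (k < n)%N -> reg st' r = k%:Z -> I k st' ->
     wps c s (fun st'' => reg st'' r = k%:Z /\ I k.+1 (set_reg st'' r k.+1%:Z)) st') ->
  wps (For r e c) (n * (s + 2) + 2) (I n) st.
Proof.
move=> r4 nB he I0 body m h.
have -> : (n * (s + 2) + 2 = 1 + (n * (s + 1).+1 + 1))%N by rewrite !addn2 !addn1.
apply: wp_seq; apply: wp_put; first exact: rep_bounded h.
pose J k m' := exists2 st', represents st' m' & reg st' r = k%:Z /\ I k st'.
suff : wp B (WhilePos (Sub e (V r)) (Seq c (Set_ r (Add (V r) (Cst 1)))))
    (n * (s + 1).+1 + 1) (J n) (upd m (eval m (Cst (reg_addr r))) (eval m (Cst 0))).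
  by apply: wp_mono => // m' [st' r' [_ i']]; exists st'.
apply: wp_while.
- move=> k m' kn [st' h' [rk _]]; split; first exact: rep_bounded h'.
  by rewrite /= (he _ _ h') (rep_reg h' r4) rk; lia.
- move=> k m' kn [st' h' [rk Ik]]; apply: wp_seq.
  apply: wp_mono (body k st' kn rk Ik m' h') => // m1 [st1 h1 [rk1 I1]].
  apply: wp_put; first exact: rep_bounded h1.
  exists (set_reg st1 r k.+1%:Z); last by rewrite /= eqxx.
  rewrite /= (rep_reg h1 r4) rk1 (_ : k%:Z + 1 = k.+1%:Z); last lia.
  by apply: rep_set_reg => //; lia.
- exists (set_reg st r 0); last by rewrite /= eqxx.
  exact: rep_set_reg.
Qed.

End Represent.

Section Derived.
Variables (B D : nat) (const : nat -> nat) (inp : nat -> int).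
Hypothesis B_small : (64 < B)%N.
Local Notation wps := (wps B D const inp).
Local Notation evals := (evals B D const inp).
Local Notation represents := (represents B D const inp).

Definition same (st st' : state) : Prop :=
  (forall b x y, entries st b x y = entries st' b x y) /\
  (forall r, reg st r = reg st' r).

Lemma same_represents st st' m : same st st' -> represents st m -> represents st' m.
Proof.
move=> [h1 h2] [r1 r2 r3 r4 r5 r6]; split=> //.
  by move=> r hr; rewrite r4.
by move=> b i j iD jD; rewrite -h1; apply: r6.
Qed.

Lemma wps_same c s (Q : state -> Prop) st st' : same st st' -> wps c s Q st' -> wps c s Q st.
Proof. by move=> h w m /(same_represents h); apply: w. Qed.

Lemma wps_le c s s' (Q : state -> Prop) st : wps c s Q st -> (s <= s')%N -> wps c s' Q st.
Proof. by move=> w h; apply: wps_mono w. Qed.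

Lemma wps_post c s (Q Q' : state -> Prop) st :
  wps c s Q st -> (forall st', Q st' -> Q' st') -> wps c s Q' st.
Proof. by move=> w h; apply: wps_mono h w. Qed.

Lemma wps_if2 e z c1 c2 s1 s2 (Q : state -> Prop) st : evals st e z ->
  (0 < z -> wps c1 s1 Q st) -> (z <= 0 -> wps c2 s2 Q st) ->
  wps (IfPos e c1 c2) (s1 + s2).+1 Q st.
Proof.
move=> ev h1 h2; apply: wps_if ev _ _ => h.
  by apply: wps_le (h1 h) _; apply: leq_addr.
by apply: wps_le (h2 h) _; apply: leq_addl.
Qed.

Lemma wps_entry2 st b ei ej (i j : nat) c1 c2 s1 s2 (Q : state -> Prop) :
  evals st ei i%:Z -> evals st ej j%:Z -> (i < D)%N -> (j < D)%N ->
  (forall v, entries st b i j = Some v -> evals st (Val b ei ej) v -> wps c1 s1 Q st) ->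
  (entries st b i j = None -> wps c2 s2 Q st) ->
  wps (IfPos (Flag b ei ej) c1 c2) (s1 + s2).+1 Q st.
Proof.
move=> hi hj iD jD h1 h2; apply: (wps_entry B_small hi hj iD jD) => [v e|e].
  apply: wps_le (h1 v e _) _; last exact: leq_addr.
  exact: (evals_val B_small hi hj iD jD e).
by apply: wps_le (h2 e) _; apply: leq_addl.
Qed.

Lemma evals_reg st r z : reg st r = z -> (r < 48)%N -> evals st (V r) z.
Proof. by move=> <-; apply: evals_V. Qed.

Definition MinFrom (b : bool) ei ej (b' : bool) fi fj : com :=
  IfPos (Flag b' fi fj) (Min b ei ej (Val b' fi fj)) Skip.

Definition Copy (b : bool) ei ej (b' : bool) fi fj : com :=
  Seq (Clear b ei ej) (MinFrom b ei ej b' fi fj).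

Definition Relax ei ek ej : com :=
  IfPos (Flag true ei ek)
    (IfPos (Flag true ek ej)
       (Min true ei ej (Add (Val true ei ek) (Val true ek ej))) Skip) Skip.

Lemma same_set_entry st b i j o : entries st b i j = o -> same st (set_entry st b i j o).
Proof.
by move=> <-; split=> //= b' x y; case: and3P => // -[/eqP -> /eqP -> /eqP ->].
Qed.

Lemma omin_None o : omin o None = o. Proof. by case: o. Qed.

Lemma wps_minfrom st b b' ei ej fi fj (i j k l : nat) (Q : state -> Prop) :
  evals st ei i%:Z -> evals st ej j%:Z -> (i < D)%N -> (j < D)%N ->
  evals st fi k%:Z -> evals st fj l%:Z -> (k < D)%N -> (l < D)%N ->
  obound B (entries st b' k l) ->
  Q (set_entry st b i j (omin (entries st b i j) (entries st b' k l))) ->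
  wps (MinFrom b ei ej b' fi fj) 5 Q st.
Proof.
move=> hi hj iD jD hk hl kD lD bd q.
apply: wps_le (wps_entry2 (s1 := 3) (s2 := 1) hk hl kD lD _ _) _ => // [v e ev|e].
  by apply: (wps_min B_small hi hj iD jD ev) => //; [move: bd; rewrite e|move: q; rewrite e].
by apply: (wps_same (same_set_entry _)) (wps_skip q); rewrite e omin_None.
Qed.

Lemma wps_copy st b b' ei ej fi fj (i j k l : nat) (Q : state -> Prop) : b != b' ->
  evals st ei i%:Z -> evals st ej j%:Z -> (i < D)%N -> (j < D)%N ->
  (forall st', reg st' =1 reg st -> evals st' ei i%:Z /\ evals st' ej j%:Z) ->
  (forall st', reg st' =1 reg st -> evals st' fi k%:Z /\ evals st' fj l%:Z) ->
  (k < D)%N -> (l < D)%N -> obound B (entries st b' k l) ->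
  (forall st', same st' (set_entry st b i j (entries st b' k l)) -> Q st') ->
  wps (Copy b ei ej b' fi fj) 6 Q st.
Proof.
move=> bb hi hj iD jD hij hkl kD lD bd q.
apply: (@wps_seq _ _ _ _ _ _ 1 5); apply: (wps_clear B_small hi hj) => //.
have [|hi' hj'] := hij (set_entry st b i j None); first by [].
have [|hk hl] := hkl (set_entry st b i j None); first by [].
have e : entries (set_entry st b i j None) b' k l = entries st b' k l.
  by rewrite /= eq_sym (negbTE bb).
apply: (wps_minfrom hi' hj' iD jD hk hl kD lD); rewrite e // => {e}.
apply: q; split=> //= b1 x y; rewrite !eqxx /=.
by case: and3P.
Qed.

Lemma wps_relax st ei ek ej (i k j : nat) (Q : state -> Prop) :
  evals st ei i%:Z -> evals st ek k%:Z -> evals st ej j%:Z ->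
  (i < D)%N -> (k < D)%N -> (j < D)%N ->
  obound B (oadd (entries st true i k) (entries st true k j)) ->
  Q (set_entry st true i j
       (omin (entries st true i j) (oadd (entries st true i k) (entries st true k j)))) ->
  wps (Relax ei ek ej) 7 Q st.
Proof.
move=> hi hk hj iD kD jD bd q.
apply: wps_le (wps_entry2 (s1 := 5) (s2 := 1) hi hk iD kD _ _) _ => // [v e ev|e]; last first.
  by apply: (wps_same (same_set_entry _)) (wps_skip q); rewrite e omin_None.
apply: wps_le (wps_entry2 (s1 := 3) (s2 := 1) hk hj kD jD _ _) _ => // [w e' ew|e']; last first.
  by apply: (wps_same (same_set_entry _)) (wps_skip q); rewrite e e' omin_None.
rewrite e e' /= in bd q.
by apply: (wps_min B_small hi hj iD jD (evals_add ev ew)).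
Qed.

Lemma wps_for2 r1 r2 e1 e2 n1 n2 c s (Inv : nat -> nat -> state -> Prop) st :
  (r1 < 48)%N -> (r2 < 48)%N -> r1 != r2 -> (n1 <= B)%N -> (n2 <= B)%N ->
  (forall st', evals st' e1 n1%:Z) -> (forall st', evals st' e2 n2%:Z) ->
  (forall i j st' v, Inv i j st' -> Inv i j (set_reg st' r1 v) /\ Inv i j (set_reg st' r2 v)) ->
  (forall i j st', (i < n1)%N -> (j < n2)%N -> reg st' r1 = i%:Z -> reg st' r2 = j%:Z ->
     Inv i j st' ->
     wps c s (fun st'' => [/\ reg st'' r1 = i%:Z, reg st'' r2 = j%:Z & Inv i j.+1 st'']) st') ->
  (forall i st', (i < n1)%N -> Inv i n2 st' -> Inv i.+1 0%N st') ->
  Inv 0%N 0%N st ->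
  wps (For r1 e1 (For r2 e2 c)) (n1 * (n2 * (s + 2) + 2 + 2) + 2) (Inv n1 0%N) st.
Proof.
move=> h1 h2 r12 b1 b2 ev1 ev2 ins body row I0.
apply: (wps_for B_small (I := fun i => Inv i 0%N)) => //; first by case: (ins 0%N 0%N st 0 I0).
move=> i st1 i1 ri Ii.
apply: wps_post (@wps_for _ _ _ _ B_small _ _ _ n2 s
  (fun j st' => reg st' r1 = i%:Z /\ Inv i j st') _ _ _ _ _ _) _ => //.
- by rewrite /= (negbTE r12); split=> //; case: (ins _ _ _ 0 Ii).
- move=> j st2 j2 rj [ri2 Iij]; apply: wps_post (body i j st2 i1 j2 ri2 rj Iij) _.
  move=> st3 [ri3 rj3 I3]; split=> //; split; first by rewrite /= (negbTE r12).
  by case: (ins _ _ _ j.+1%:Z I3).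
- by move=> st2 [ri2 /row I2]; split=> //; case: (ins _ _ _ i.+1%:Z (I2 i1)).
Qed.

(** Common shape of the consistency checks: a failure is recorded in the register [f], and the loop
    runs on. *)
Lemma wps_search r f e c n s (ok : nat -> bool) st :
  (r < 48)%N -> (f < 48)%N -> r != f -> (n <= B)%N ->
  (forall st', evals st' e n%:Z) ->
  (forall k st' Q, (k < n)%N -> reg st' r = k%:Z ->
     (forall b x y, entries st' b x y = entries st b x y) ->
     (ok k -> Q st') -> (~~ ok k -> Q (set_reg st' f 1)) -> wps c s Q st') ->
  reg st f = 0 ->
  wps (For r e c) (n * (s + 2) + 2) (fun st' =>
    [/\ forall b x y, entries st' b x y = entries st b x y,
        forall r', r' != r -> r' != f -> reg st' r' = reg st r' &
        reg st' f = 0 /\ (forall k, (k < n)%N -> ok k) \/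
        reg st' f = 1 /\ exists2 k, (k < n)%N & ~~ ok k]) st.
Proof.
move=> r4 f4 rf nB ev body f0.
apply: wps_post (wps_for B_small (I := fun i st' =>
  [/\ forall b x y, entries st' b x y = entries st b x y,
        forall r', r' != r -> r' != f -> reg st' r' = reg st r' &
        reg st' f = 0 /\ (forall k, (k < i)%N -> ok k) \/
        reg st' f = 1 /\ exists2 k, (k < n)%N & ~~ ok k]) _ _ _ _ _) _ => //.
- split=> // [r' /negbTE /= ->|] //=; rewrite eq_sym (negbTE rf); left; split=> //.
- move=> k st' kn rk [he hr hf]; apply: (body k) => // okk.
    split=> //; split=> //= [r' nr nf|]; first by rewrite (negbTE nr) hr.
    rewrite eq_sym (negbTE rf); case: hf => [[-> h]|h]; [left|by right].
    by split=> // j; rewrite ltnS leq_eqVlt => /predU1P[->|/h].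
  split; first by rewrite /= (negbTE rf).
  split=> //= [r' nr nf|]; first by rewrite (negbTE nr) (negbTE nf) hr.
  by rewrite eq_sym (negbTE rf) eqxx; right; split=> //; exists k.
Qed.

End Derived.

(** * The decision program *)

Notation rI := 0%N (only parsing).
Notation rJ := 1%N (only parsing).
Notation rK := 2%N (only parsing).
Notation rC := 3%N (only parsing).
Notation rFail := 4%N (only parsing).
Notation rDiff := 5%N (only parsing).
Notation rX := 6%N (only parsing).
Notation rY := 7%N (only parsing).
Notation rP := 8%N (only parsing).

Definition succ (e : expr) : expr := Add e (Cst 1).

(* Matrix [true] is the scratch matrix of three layers, [false] that of two layers. *)
Definition pull_entry : com :=
  Seq (Clear true (V rI) (V rJ))
  (Seq (IfPos (Sub (K 2) (V rI)) (IfPos (Sub (K 2) (V rJ))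
          (MinFrom true (V rI) (V rJ) false (V rI) (V rJ)) Skip) Skip)
    (IfPos (Sub (succ (V rI)) (K 0)) (IfPos (Sub (succ (V rJ)) (K 0))
          (MinFrom true (V rI) (V rJ) false (Sub (V rI) (K 0)) (Sub (V rJ) (K 0)))
          Skip) Skip)).
Definition pull : com := For rI (K 1) (For rJ (K 1) pull_entry).

Definition relax_all : com :=
  For rI (K 1) (For rJ (K 1) (Relax (V rI) (V rK) (V rJ))).
(** A failed pivot test disables all later stages, so every stage that runs has a nonnegative pivot
    and can work in place. *)
Definition floyd_warshall : com :=
  For rK (K 1)
    (Seq (IfPos (V rFail) Skip
           (IfPos (Flag true (V rK) (V rK))
             (IfPos (Sub (Cst 0) (Val true (V rK) (V rK))) (Set_ rFail (Cst 1)) Skip) Skip))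
         (IfPos (V rFail) Skip relax_all)).

Definition check_diag : com :=
  For rI (K 1) (IfPos (Flag true (V rI) (V rI))
    (IfPos (Sub (Cst 0) (Val true (V rI) (V rI))) (Set_ rFail (Cst 1)) Skip) Skip).
Definition check_unary : com :=
  For rI (K 3)
   (IfPos (Flag true (twice (V rI)) (succ (twice (V rI))))
     (IfPos (Flag true (succ (twice (V rI))) (twice (V rI)))
       (IfPos (Sub (Cst 0) (Add (Half (Val true (twice (V rI)) (succ (twice (V rI)))))
                                (Half (Val true (succ (twice (V rI))) (twice (V rI))))))
          (Set_ rFail (Cst 1)) Skip) Skip) Skip).

Definition compare : com :=
  IfPos (Sub (K 0) (V rI)) (IfPos (Sub (K 0) (V rJ))
    (IfPos (Flag true (V rX) (V rY))
      (IfPos (Flag false (V rI) (V rJ))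
        (IfPos (Sub (Val false (V rI) (V rJ)) (Val true (V rX) (V rY))) (Set_ rDiff (Cst 1)) Skip)
        (Set_ rDiff (Cst 1))) Skip) Skip) Skip.
Definition set_widened (r s : nat) : com :=
  Seq (Set_ r (V s)) (IfPos (Sub (succ (V s)) (K 0)) (Set_ r (Add (V s) (K 0))) Skip).
(** The comparison has to precede the copy, which overwrites the old entry. *)
Definition push_entry : com :=
  Seq (set_widened rX rI) (Seq (set_widened rY rJ)
    (Seq compare (Copy false (V rI) (V rJ) true (V rX) (V rY)))).
Definition push : com :=
  Seq (Set_ rDiff (Cst 0)) (For rI (K 2) (For rJ (K 2) push_entry)).

Definition square : com :=
  Seq pull (Seq floyd_warshall (IfPos (V rFail) Skip
    (Seq check_diag (IfPos (V rFail) Skip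
    (Seq check_unary (IfPos (V rFail) Skip push)))))).

(** One squaring beyond the [4N] that give the depth: the last one tests whether the domain bounds
    still change. *)
Definition squarings : com :=
  For rC (succ (K 2)) (IfPos (V rFail) Skip square).

(** Row counts of one, three and two layers, and the number of variables in three layers. *)
Definition dims (N c : nat) : nat :=
  nth 0%N [:: N.*2; (N.*2 + N.*2 + N.*2)%N; (N.*2 + N.*2)%N; (N + N + N)%N] c.

Ltac evs := lazymatch goal with
  | |- evals _ _ _ _ _ (Add _ _) _ => eapply evals_add; evs
  | |- evals _ _ _ _ _ (Sub _ _) _ => eapply evals_sub; evs
  | |- evals _ _ _ _ _ (Half _) _ => eapply evals_half; evs
  | |- evals _ _ _ _ _ (K _) _ => eapply evals_K; reflexivity
  | |- evals _ _ _ _ _ (V _) _ => eapply evals_V; reflexivity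
  | |- evals _ _ _ _ _ (Cst _) _ => eapply evals_cst
  | |- evals _ _ _ _ _ (succ _) _ => unfold succ; evs
  | |- evals _ _ _ _ _ (twice _) _ => unfold twice; evs
  | |- evals _ _ _ _ _ (Val _ _ _) _ => eassumption
  end.
Ltac ev := eapply evals_eq; [evs | rewrite ?/dims /=; lia].

(** The entries visited by a double loop before it reaches [(i, j)]. *)
Definition before (i j x y : nat) : bool := (x < i)%N || (x == i) && (y < j)%N.

Lemma beforeS i j x y : before i j.+1 x y = before i j x y || (x == i) && (y == j).
Proof. by rewrite /before; lia. Qed.

Lemma before_row i n x y : (y < n)%N -> before i n x y = before i.+1 0 x y.
Proof. by rewrite /before; lia. Qed.

Lemma before_all n x y : (x < n)%N -> before n 0 x y.
Proof. by rewrite /before => ->. Qed.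

Lemma before00 x y : before 0 0 x y = false.
Proof. by rewrite /before; lia. Qed.

Lemma before_self i j : before i j i j = false.
Proof. by rewrite /before; lia. Qed.

(** * Correctness of one squaring *)

Section Specs.
Variables (N B : nat) (inp : nat -> int).
Hypothesis N0 : (0 < N)%N.
Let q := N.*2.
Let D := (q + q + q)%N.
Hypothesis B_small : (64 < B)%N.
Hypothesis D_small : (D < B)%N.
Local Notation wps := (wps B D (dims N) inp).
Local Notation evals := (evals B D (dims N) inp).

Lemma evals_D st : evals st (K 1) D%:Z.
Proof. exact: (@evals_K _ _ (dims N) inp st 1). Qed.
Lemma evals_2q st : evals st (K 2) (q + q)%N%:Z.
Proof. exact: (@evals_K _ _ (dims N) inp st 2). Qed.

Lemma ltqD i : (i < q + q)%N -> (i < D)%N. Proof. rewrite /D; lia. Qed.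

Lemma wps_pull_entry st (i j : nat) (Q : state -> Prop) :
  reg st rI = i%:Z -> reg st rJ = j%:Z -> (i < D)%N -> (j < D)%N ->
  (forall x y, (x < q + q)%N -> (y < q + q)%N -> obound B (entries st false x y)) ->
  (forall st', same st' (set_entry st true i j (glue N (entries st false) i j)) -> Q st') ->
  wps pull_entry 30 Q st.
Proof.
move=> hi hj iD jD bd q'.
have evi st' : reg st' rI = i%:Z -> evals st' (V rI) i%:Z by move=> h; apply: evals_reg.
have evj st' : reg st' rJ = j%:Z -> evals st' (V rJ) j%:Z by move=> h; apply: evals_reg.
apply: wps_le; first apply: wps_seq.
  apply: (wps_clear B_small (evi _ hi) (evj _ hj)) => //.
  apply: wps_seq.
  pose o1 := if (i < q + q)%N && (j < q + q)%N then entries st false i j else None.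
  apply: (wps_post (Q := fun st' => same st' (set_entry st true i j o1))).
    apply: wps_if2; first by evs.
      move=> pi; apply: wps_if2; first by evs.
        move=> pj; have iq : (i < q + q)%N by move: pi; rewrite /= hi /dims /=; lia.
        have jq : (j < q + q)%N by move: pj; rewrite /= hj /dims /=; lia.
        apply: (wps_minfrom B_small (evi _ _) (evj _ _) iD jD (evi _ _) (evj _ _)) => //=.
          exact: bd.
        by rewrite /o1 iq jq !eqxx /=; split=> //= b x y; case: and3P.
      move=> pj; apply: wps_skip; have jq : (j < q + q)%N = false by move: pj; rewrite /= hj /dims /=; lia.
      by rewrite /o1 jq andbF; split.
    move=> pi; apply: wps_skip; have iq : (i < q + q)%N = false by move: pi; rewrite /= hi /dims /=; lia.
    by rewrite /o1 iq; split.
  move=> st1 s1; apply: (wps_same s1) => {st1 s1}.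
  apply: wps_if2; first by evs.
    move=> pi; apply: wps_if2; first by evs.
      move=> pj; have iq : (q <= i)%N by move: pi; rewrite /= hi /dims /=; lia.
      have jq : (q <= j)%N by move: pj; rewrite /= hj /dims /=; lia.
      apply: (wps_minfrom B_small (i := i) (j := j) (k := i - q) (l := j - q)) => //; try by ev.
      - by rewrite /D in iD *; lia.
      - by rewrite /D in jD *; lia.
      - by apply: bd; rewrite /D in iD jD *; lia.
      - apply: q'; rewrite /glue iq jq /= -/o1 !eqxx; split=> //= b x y.
        by case: and3P.
    move=> pj; apply: wps_skip; apply: q'.
    have jq : (q <= j)%N = false by move: pj; rewrite /= hj /dims /=; lia.
    by rewrite /glue -!/q jq andbF omin_None; split.
  move=> pi; apply: wps_skip; apply: q'.
  have iq : (q <= i)%N = false by move: pi; rewrite /= hi /dims /=; lia.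
  by rewrite /glue -!/q iq omin_None; split.
by [].
Qed.

Definition unchanged (rs : seq nat) (b : bool) (st st' : state) : Prop :=
  (forall x y, entries st' b x y = entries st b x y) /\
  (forall r, r \notin rs -> reg st' r = reg st r).

Lemma unchanged_set rs b st st' r v : r \in rs -> unchanged rs b st st' ->
  unchanged rs b st (set_reg st' r v).
Proof.
move=> rin [h1 h2]; split=> //= r' nr'; case: eqVneq => [e|_]; last exact: h2.
by move: nr'; rewrite e rin.
Qed.

Lemma unchanged_entry rs b st st' i j o : unchanged rs b st st' ->
  unchanged rs b st (set_entry st' (~~ b) i j o).
Proof.
move=> [h1 h2]; split=> //= x y; rewrite -h1; case: and3P => //.
by case: (b) => -[].
Qed.

Lemma wps_pull st :
  (forall x y, (x < q + q)%N -> (y < q + q)%N -> obound B (entries st false x y)) ->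
  wps pull (100 * (D * D).+1) (fun st' => unchanged [:: rI; rJ] false st st' /\
    forall x y, (x < D)%N -> (y < D)%N ->
      entries st' true x y = glue N (entries st false) x y) st.
Proof.
move=> bd; pose Inv (i j : nat) st' := unchanged [:: rI; rJ] false st st' /\
  forall x y, (x < D)%N -> (y < D)%N -> before i j x y ->
    entries st' true x y = glue N (entries st false) x y.
apply: wps_le; first apply: (wps_post (Q := Inv D 0%N)).
- apply: (wps_for2 (n2 := D) (s := 30) B_small) => //; try exact: ltnW.
  + exact: evals_D.
  + exact: evals_D.
  + by move=> i j st' v [u h]; split; split=> //; apply: unchanged_set.
  + move=> i j st' iD jD hi hj [[u1 u2] h].
    apply: (wps_pull_entry hi hj iD jD) => [x y xq yq|st1 [e1 e2]].
      by rewrite u1; apply: bd.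
    split; rewrite ?e2 //; split.
      by split=> [x y|r nr]; rewrite ?e1 ?e2 /= ?u1 ?u2.
    move=> x y xD yD; rewrite beforeS e1 /=; case: andP => [[/eqP -> /eqP ->] _|_].
      by rewrite /glue !u1.
    by rewrite orbF; apply: h.
  + move=> i st' iD [u h]; split=> // x y xD yD; rewrite -(before_row _ _ yD).
    exact: h.
  + by split=> // x y _ _; rewrite before00.
- by move=> st' [u h]; split=> // x y xD yD; apply: h => //; apply: before_all.
- by rewrite /D; nia.
Qed.

(** The update is in place, yet it computes [stage W k] of the old matrix: besides the entry being
    written, only the row and the column of the pivot are read, and these do not change when the
    pivot is nonnegative. *)
Lemma wps_relax_all st (W : mat) k b : (k < D)%N -> reg st rK = k%:Z -> nneg W k ->
  (forall x y, (x < D)%N -> (y < D)%N -> entries st true x y = W x y) ->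
  (forall x y, (x < D)%N -> (y < D)%N -> obound b (W x y)) -> (b + b <= B)%N ->
  wps relax_all (100 * (D * D).+1) (fun st' => unchanged [:: rI; rJ] false st st' /\
    forall x y, (x < D)%N -> (y < D)%N -> entries st' true x y = stage W k x y) st.
Proof.
move=> kD hk Wk eW bW bB; pose Inv (i j : nat) st' := unchanged [:: rI; rJ] false st st' /\
  forall x y, (x < D)%N -> (y < D)%N ->
    entries st' true x y = if before i j x y then stage W k x y else W x y.
apply: wps_le; first apply: (wps_post (Q := Inv D 0%N)).
- apply: (wps_for2 (n2 := D) (s := 7) B_small) => //; try exact: ltnW.
  + exact: evals_D.
  + exact: evals_D.
  + by move=> i j st' v [u h]; split; split=> //; apply: unchanged_set.
  + move=> i j st' iD jD hi hj [u h]; have [u1 u2] := u.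
    have ci : entries st' true i k = W i k by rewrite h // stage_col // if_same.
    have cj : entries st' true k j = W k j by rewrite h // stage_row // if_same.
    apply: (wps_relax B_small (i := i) (k := k) (j := j)) => //.
    * by ev.
    * by apply: evals_reg; rewrite ?u2.
    * by ev.
    * by rewrite ci cj; apply: oboundW bB _; apply: obound_oadd; apply: bW.
    rewrite ci cj h // before_self; split=> //; split; first exact: (unchanged_entry _ _ _ u).
    move=> x y xD yD; rewrite beforeS /=; case: andP => [[/eqP -> /eqP ->]|_].
      by rewrite orbT.
    by rewrite orbF; apply: h.
  + move=> i st' iD [u h]; split=> // x y xD yD; rewrite -(before_row _ _ yD).
    exact: h.
  + by split=> // x y xD yD; rewrite before00 eW.
- by move=> st' [u h]; split=> // x y xD yD; rewrite h // before_all.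
- by rewrite /D; nia.
Qed.

Lemma wps_floyd_warshall st (w : mat) b : reg st rFail = 0 ->
  (forall x y, (x < D)%N -> (y < D)%N -> entries st true x y = w x y) ->
  (forall x y, (x < D)%N -> (y < D)%N -> obound b (w x y)) -> (2 ^ D * b <= B)%N ->
  wps floyd_warshall (200 * (D * (D * D).+1).+1) (fun st' =>
    unchanged [:: rI; rJ; rK; rFail] false st st' /\
    (reg st' rFail = 0 /\ (forall l, (l < D)%N -> nneg (fw w l) l) /\
       (forall x y, (x < D)%N -> (y < D)%N -> entries st' true x y = fw w D x y) \/
     reg st' rFail = 1 /\ exists2 l, (l < D)%N & ~~ nneg (fw w l) l)) st.
Proof.
move=> f0 ew bw bB; pose Inv (k : nat) st' :=
  unchanged [:: rI; rJ; rK; rFail] false st st' /\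
    (reg st' rFail = 0 /\ (forall l, (l < k)%N -> nneg (fw w l) l) /\
       (forall x y, (x < D)%N -> (y < D)%N -> entries st' true x y = fw w k x y) \/
     reg st' rFail = 1 /\ exists2 l, (l < D)%N & ~~ nneg (fw w l) l).
apply: wps_le; first apply: (wps_for B_small (I := Inv)) => //.
- exact: ltnW.
- exact: evals_D.
- split; last by left.
  by apply: unchanged_set.
- move=> k st1 kD hk [u1 h1].
  apply: wps_seq; apply: (wps_post (Q := fun st' => reg st' rK = k%:Z /\
    unchanged [:: rI; rJ; rK; rFail] false st st' /\
    (reg st' rFail = 0 /\ (forall l, (l < k.+1)%N -> nneg (fw w l) l) /\
       (forall x y, (x < D)%N -> (y < D)%N -> entries st' true x y = fw w k x y) \/
     reg st' rFail = 1 /\ exists2 l, (l < D)%N & ~~ nneg (fw w l) l))).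
    apply: wps_if2; first by evs.
      move=> f1; apply: wps_skip; split=> //; split=> //.
      by case: h1 => [[f2 _]|h1]; [move: f1; rewrite f2|right].
    move=> f1; case: h1 => [[f2 [nn e1]]|[f2 _]]; last by move: f1; rewrite f2.
    have evk : evals st1 (V rK) k%:Z by apply: evals_reg.
    have nnS : nneg (fw w k) k -> forall l, (l < k.+1)%N -> nneg (fw w l) l.
      by move=> nk l; rewrite ltnS leq_eqVlt => /predU1P[->|/nn].
    apply: (wps_entry2 B_small evk evk kD kD) => [v ekk evv|ekk].
      apply: wps_if2; first by evs.
        move=> vneg; apply: (wps_set B_small (z := 1)) => //; first lia.
        split=> //; split; first exact: unchanged_set.
        right; split=> //; exists k => //; rewrite /nneg -e1 // ekk /=; lia.
      move=> vpos; apply: wps_skip; split=> //; split=> //; left; split=> //; split=> //.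
      by apply: nnS; rewrite /nneg -e1 // ekk /=; lia.
    apply: wps_skip; split=> //; split=> //; left; split=> //; split=> //.
    by apply: nnS; rewrite /nneg -e1 // ekk.
  move=> st2 [hk2 [u2 h2]].
  apply: wps_if2; first by evs.
    move=> f1; apply: wps_skip; split=> //; split; first exact: unchanged_set.
    by case: h2 => [[f2 _]|h2]; [move: f1; rewrite f2|right].
  move=> f1; case: h2 => [[f2 [nn e2]]|[f2 _]]; last by move: f1; rewrite f2.
  have bk x y : (x < D)%N -> (y < D)%N -> obound (2 ^ k * b) (fw w k x y).
    by apply: (fw_bound bw); apply: ltnW.
  apply: wps_post; first apply: (wps_relax_all kD hk2 (nn k (ltnSn k)) e2 bk).
    apply: leq_trans bB; rewrite addnn -mul2n mulnA -expnS leq_mul2r.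
    by rewrite leq_pexp2l // orbT.
  move=> st3 [[u3 r3] e3]; split; first by rewrite r3.
  split; last by left; split; [rewrite /= r3|split].
  apply: unchanged_set => //; case: u2 => u2 r2; split=> [x y|r hr]; first by rewrite u3.
  by rewrite r3 ?r2 //; move: hr; rewrite !inE !negb_or => /and4P[-> ->].
- by rewrite /D; nia.
Qed.

Lemma wps_check_diag st : reg st rFail = 0 ->
  wps check_diag (100 * D.+1) (fun st' =>
    [/\ forall b x y, entries st' b x y = entries st b x y,
        forall r', r' != rI -> r' != rFail -> reg st' r' = reg st r' &
        reg st' rFail = 0 /\ (forall k, (k < D)%N -> nneg (entries st true) k) \/
        reg st' rFail = 1 /\ exists2 k, (k < D)%N & ~~ nneg (entries st true) k]) st.
Proof.
move=> f0; apply: wps_le; first apply: (wps_search (s := 20) B_small) => //.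
- exact: ltnW.
- exact: evals_D.
- move=> k st' Q kD hk e ok nok; apply: wps_le.
    have evk : evals st' (V rI) k%:Z by apply: evals_reg.
    apply: (wps_entry2 B_small evk evk kD kD) => [v ekk evv|ekk].
      apply: wps_if2; first by evs.
        move=> vneg; apply: (wps_set B_small (z := 1)) => //; first lia.
        by apply: nok; rewrite /nneg -e ekk /=; lia.
      by move=> vpos; apply: wps_skip; apply: ok; rewrite /nneg -e ekk /=; lia.
    by apply: wps_skip; apply: ok; rewrite /nneg -e ekk.
  by [].
- by rewrite /D; lia.
Qed.

Lemma wps_check_unary st : reg st rFail = 0 ->
  wps check_unary (100 * D.+1) (fun st' =>
    [/\ forall b x y, entries st' b x y = entries st b x y,
        forall r', r' != rI -> r' != rFail -> reg st' r' = reg st r' &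
        reg st' rFail = 0 /\ (forall k, (k < N + N + N)%N -> unary_ok (entries st true) k) \/
        reg st' rFail = 1 /\ exists2 k, (k < N + N + N)%N & ~~ unary_ok (entries st true) k]) st.
Proof.
move=> f0; apply: wps_le; first apply: (wps_search (s := 20) B_small) => //.
- by apply: leq_trans (ltnW D_small); rewrite /D /q; lia.
- by move=> st'; apply: (@evals_K _ _ (dims N) inp st' 3).
- move=> k st' Q kD hk e ok nok; apply: wps_le.
    have ev0 : evals st' (twice (V rI)) k.*2%:Z by ev.
    have ev1 : evals st' (succ (twice (V rI))) k.*2.+1%:Z by ev.
    have k0 : (k.*2 < D)%N by rewrite /D /q; lia.
    have k1 : (k.*2.+1 < D)%N by rewrite /D /q; lia.
    apply: (wps_entry2 B_small ev0 ev1 k0 k1) => [v e01 evv|e01].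
      apply: (wps_entry2 B_small ev1 ev0 k1 k0) => [v' e10 evv'|e10].
        apply: wps_if2; first by evs.
          move=> vneg; apply: (wps_set B_small (z := 1)) => //; first lia.
          by apply: nok; rewrite /unary_ok -!e e01 e10; lia.
        by move=> vpos; apply: wps_skip; apply: ok; rewrite /unary_ok -!e e01 e10; lia.
      by apply: wps_skip; apply: ok; rewrite /unary_ok -!e e01 e10.
    by apply: wps_skip; apply: ok; rewrite /unary_ok -!e e01.
  by [].
- by rewrite /D /q; lia.
Qed.

Lemma wps_set_widened (r s i : nat) (Q : state -> Prop) st :
  (r < 48)%N -> (s < 48)%N -> s != r -> reg st s = i%:Z -> (i < q + q)%N ->
  (forall st', (forall b x y, entries st' b x y = entries st b x y) ->
     (forall r', r' != r -> reg st' r' = reg st r') ->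
     reg st' r = (widen N i)%:Z -> Q st') ->
  wps (set_widened r s) 4 Q st.
Proof.
move=> r4 s4 sr hs iq hQ; apply: (@wps_seq _ _ _ _ _ _ 1 3).
apply: (wps_set B_small (z := i%:Z)) => //; first exact: evals_reg.
  by have := ltqD iq; lia.
apply: wps_le; first apply: wps_if2.
- apply: evals_sub; last exact: (@evals_K _ _ (dims N) inp _ 0).
  apply: evals_add; last exact: evals_cst.
  by apply: evals_reg => //=; rewrite (negbTE sr).
- move=> h; apply: (wps_set B_small (z := i%:Z + q%:Z)) => //.
  + apply: evals_add; last exact: (@evals_K _ _ (dims N) inp _ 0).
    by apply: evals_reg => //=; rewrite (negbTE sr).
  + by have := D_small; rewrite /D; lia.
  apply: hQ => // [r' nr|] /=; first by rewrite (negbTE nr).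
  by rewrite eqxx /widen -/q; case: ltnP => //; move: h; rewrite /dims /= -/q (negbTE sr) hs; lia.
- move=> h; apply: wps_skip; apply: hQ => // [r' nr|] /=; first by rewrite (negbTE nr).
  by rewrite eqxx /widen -/q; case: ltnP => //; move: h; rewrite /dims /= -/q (negbTE sr) hs; lia.
- by [].
Qed.

Lemma wps_push_entry st (i j : nat) (Q : state -> Prop) :
  reg st rI = i%:Z -> reg st rJ = j%:Z -> (i < q + q)%N -> (j < q + q)%N ->
  (forall x y, (x < D)%N -> (y < D)%N -> obound B (entries st true x y)) ->
  (forall st', same st' (set_entry st' false i j (entries st true (widen N i) (widen N j))) ->
     (forall x y, entries st' true x y = entries st true x y) ->
     (forall x y, ~~ ((x == i) && (y == j)) -> entries st' false x y = entries st false x y) ->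
     (forall r, r \notin [:: rX; rY; rDiff] -> reg st' r = reg st r) ->
     reg st' rDiff = (if [&& (i < q)%N, (j < q)%N &
        ogt (entries st true (widen N i) (widen N j)) (entries st false i j)] then 1
        else reg st rDiff) ->
     Q st') ->
  wps push_entry 40 Q st.
Proof.
move=> hi hj iq jq bd hQ; have iD := ltqD iq; have jD := ltqD jq.
have wi : (widen N i < D)%N := widen_lt iq; have wj : (widen N j < D)%N := widen_lt jq.
set a := widen N i in wi hQ *; set b := widen N j in wj hQ *.
apply: wps_le; first apply: wps_seq; first apply: (wps_set_widened _ _ _ hi iq) => //.
  move=> st1 e1 r1 x1; apply: wps_seq; apply: (@wps_set_widened _ _ j) => //.
    by rewrite r1.
  move=> st2 e2 r2 y2; apply: wps_seq.
  have hi2 : reg st2 rI = i%:Z by rewrite r2 // r1.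
  have hj2 : reg st2 rJ = j%:Z by rewrite r2 // r1.
  have hx2 : reg st2 rX = a%:Z by rewrite r2.
  have e12 c x y : entries st2 c x y = entries st c x y by rewrite e2 e1.
  have d2 : reg st2 rDiff = reg st rDiff by rewrite r2 // r1.
  have evi := @evals_reg B D (dims N) inp _ _ _ hi2 isT; have evj := @evals_reg B D (dims N) inp _ _ _ hj2 isT.
  have evx := @evals_reg B D (dims N) inp _ _ _ hx2 isT; have evy := @evals_reg B D (dims N) inp _ _ _ y2 isT.
  apply: (wps_post (Q := fun st' =>
    [/\ forall c x y, entries st' c x y = entries st c x y,
        forall r, r != rDiff -> reg st' r = reg st2 r &
        reg st' rDiff = if [&& (i < q)%N, (j < q)%N & ogt (entries st true a b)
           (entries st false i j)] then 1 else reg st rDiff])).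
    apply: wps_if2; first by evs.
      rewrite hi2 /dims /= -/q => pi; have -> /= : (i < q)%N by lia.
      apply: wps_if2; first by evs.
        rewrite hj2 /dims /= -/q => pj; have -> /= : (j < q)%N by lia.
        apply: (wps_entry2 B_small evx evy wi wj) => [v ev evv|ev]; rewrite e12 in ev; rewrite ev /=.
          apply: (wps_entry2 B_small evi evj iD jD) => [v' ev' evv'|ev']; rewrite e12 in ev'; rewrite ev' /=.
            apply: wps_if2; first by evs.
              move=> h; have -> : v < v' by lia.
              apply: (wps_set B_small (z := 1)) => //; first lia.
              by split=> // r nr /=; rewrite (negbTE nr).
            move=> h; have -> : (v < v') = false by lia.
            by apply: wps_skip; split.
          apply: (wps_set B_small (z := 1)) => //; first lia.
          by split=> // r nr /=; rewrite (negbTE nr).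
        by apply: wps_skip; split.
      rewrite hj2 /dims /= -/q => pj; have -> /= : (j < q)%N = false by lia.
      by apply: wps_skip; split.
    rewrite hi2 /dims /= -/q => pi; have -> /= : (i < q)%N = false by lia.
    by apply: wps_skip; split.
  move=> st3 [e3 r3 d3].
  have evij st' : reg st' =1 reg st3 -> evals st' (V rI) i%:Z /\ evals st' (V rJ) j%:Z.
    by move=> h; split; apply: evals_reg; rewrite // h r3.
  have evxy st' : reg st' =1 reg st3 -> evals st' (V rX) a%:Z /\ evals st' (V rY) b%:Z.
    by move=> h; split; apply: evals_reg; rewrite // h r3.
  have [ei ej] := evij st3 (fun=> erefl).
  apply: (wps_copy B_small _ ei ej iD jD evij evxy wi wj) => //.
    by rewrite e3; apply: bd.
  move=> st4 [e4 r4]; apply: hQ.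
  - split=> // c x y; rewrite /= e4 e3 /=.
    by case: and3P => //= -[/eqP -> /eqP -> /eqP ->]; rewrite !eqxx.
  - by move=> x y; rewrite e4 /= e3.
  - by move=> x y; rewrite e4 /= => /negbTE ->; rewrite e3.
  - move=> r; rewrite !inE !negb_or => /and3P[n1 n2 n3]; rewrite r4 /= r3 // r2 // r1 //.
  - by rewrite r4 /= d3.
by [].
Qed.

Lemma wps_push st :
  (forall x y, (x < D)%N -> (y < D)%N -> obound B (entries st true x y)) ->
  wps push (100 * (D * D).+1) (fun st' =>
    [/\ unchanged [:: rI; rJ; rX; rY; rDiff] true st st',
        forall x y, (x < q + q)%N -> (y < q + q)%N ->
          entries st' false x y = entries st true (widen N x) (widen N y) &
        reg st' rDiff = 0 /\ (forall x y, ~~ grows N (entries st true) (entries st false) x y) \/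
        reg st' rDiff = 1 /\ exists x y, grows N (entries st true) (entries st false) x y]) st.
Proof.
move=> bd; set T := entries st true; set M := entries st false.
pose Inv (i j : nat) st' := [/\ unchanged [:: rI; rJ; rX; rY; rDiff] true st st',
  forall x y, (x < q + q)%N -> (y < q + q)%N -> entries st' false x y =
     if before i j x y then T (widen N x) (widen N y) else M x y &
  reg st' rDiff = 0 /\ (forall x y, before i j x y -> (y < q + q)%N -> ~~ grows N T M x y) \/
  reg st' rDiff = 1 /\ exists x y, grows N T M x y].
apply: wps_le; first apply: (@wps_seq _ _ _ _ _ _ 1); first apply: (wps_set B_small (z := 0)) => //.
  apply: (wps_post (Q := Inv (q + q)%N 0%N)).
    apply: (wps_for2 (n2 := (q + q)%N) (s := 40) B_small) => //.
    + by have := D_small; rewrite /D; lia.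
    + by have := D_small; rewrite /D; lia.
    + exact: evals_2q.
    + exact: evals_2q.
    + by move=> i j st' v [u h d]; split; split=> //; apply: unchanged_set.
    + move=> i j st1 iq jq hi hj [u h d]; have [u1 u2] := u.
      apply: (wps_push_entry hi hj iq jq) => [x y xD yD|st2 [s1 _] s2 s3 r2 d2].
        by rewrite u1; apply: bd.
      split; rewrite ?r2 //; split.
      * split=> [x y|r hr]; first by rewrite s2 u1.
        rewrite r2 ?u2 //; move: hr; rewrite !inE !negb_or.
        by case/and5P=> _ _ -> -> ->.
      * move=> x y xq yq; rewrite beforeS; case: (boolP (_ && _)) => [/andP[/eqP -> /eqP ->]|ne].
          by rewrite orbT s1 /= !eqxx u1.
        by rewrite orbF s3 // h.
      * rewrite d2; have -> : entries st1 false i j = M i j by rewrite h // before_self.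
        rewrite !u1 -/T -/(grows N T M i j).
        case: d => [[d0 ng]|[d1 g]]; last by right; case: ifP.
        case: ifP => [g|/negbT g]; [right|left]; split=> //; first by exists i, j.
        move=> x y; rewrite beforeS => /orP[hb yq|/andP[/eqP -> /eqP ->]] //.
        exact: ng.
    + move=> i st1 iq [u h d]; split=> //.
        by move=> x y xq yq; rewrite h // (before_row _ _ yq).
      case: d => [[d0 ng]|]; [left|by right]; split=> // x y hb yq.
      by apply: ng => //; rewrite (before_row _ _ yq).
    + split=> //; first exact: unchanged_set.
        by move=> x y xq yq; rewrite before00.
      by left; split=> // x y; rewrite before00.
  move=> st1 [u h d]; split=> //.
    by move=> x y xq yq; rewrite h // before_all.
  case: d => [[d0 ng]|]; [left|by right]; split=> // x y.
  case: (boolP ((x < q)%N && (y < q)%N)) => [/andP[xq yq]|nq].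
    by apply: ng; [apply: before_all; lia|lia].
  by apply: contra nq => /and3P[-> ->].
by rewrite /D; nia.
Qed.

Section Square.
Variables (es : seq edge) (mu n : nat).
Hypothesis es_lt : forall e, e \in es -> (e.1.1 < q + q)%N /\ (e.1.2 < q + q)%N.
Hypothesis es_bar : forall x y w, (x, y, w) \in es -> (bar y, bar x, w) \in es.
Hypothesis es_mu : forall e, e \in es -> (`|e.2| <= mu)%N.
Hypothesis n0 : (0 < n)%N.
Hypothesis B_large : (2 ^ D * (q * n.+1 * mu) <= B)%N.

(** Every early exit certifies infeasibility: a negative pivot or diagonal entry is a negative
    closed walk, and a failed unary test leaves no integer value. *)
Lemma wps_square st : reg st rFail = 0 -> power_matrix N es mu n (entries st false) ->
  wps square (1000 * (D * (D * D).+1).+1) (fun st' => reg st' rC = reg st rC /\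
    (reg st' rFail = 1 /\ infeasible N es n \/
     reg st' rFail = 0 /\ squared_spec N es mu n (entries st false) (entries st' false) (reg st' rDiff))) st.
Proof.
move=> f0 pM; set M := entries st false; pose w := glue N M.
have bM x y : (x < q + q)%N -> (y < q + q)%N -> obound (q * n.+1 * mu) (M x y).
  exact: (pm_bound pM).
have bB : (q * n.+1 * mu <= B)%N.
  by apply: leq_trans B_large; rewrite leq_pmull // expn_gt0.
have bw x y : (x < D)%N -> (y < D)%N -> obound (q * n.+1 * mu) (w x y).
  move=> xD yD; rewrite /w /glue; apply: obound_omin; case: ifP => // /andP[h1 h2].
    exact: bM.
  by apply: bM; rewrite -/q in h1 h2; rewrite /D in xD yD; lia.
apply: wps_le; first apply: wps_seq.
  apply: wps_post; first apply: wps_pull => x y xq yq; first exact: oboundW bB (bM _ _ xq yq).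
  move=> st1 [[u1 r1] e1]; apply: wps_seq; apply: wps_post.
    by apply: (wps_floyd_warshall (w := w) _ e1 bw B_large); rewrite r1.
  move=> st2 [[u2 r2] h2].
  have c2 : reg st2 rC = reg st rC by rewrite r2 // r1.
  apply: wps_if2; first by evs.
    move=> f; apply: wps_skip; split=> //; case: h2 => [[f2 _]|[f2 [l lD nn]]].
      by move: f; rewrite f2.
    left; split=> // v _; move: nn; rewrite negbK => nn.
    by apply: (unsat_cycle n0 pM (ltnW lD) lD nn).
  move=> f; case: h2 => [[f2 [stg eT]]|[f2 _]]; last by move: f; rewrite f2.
  have bT x y : (x < D)%N -> (y < D)%N -> obound B (fw w D x y).
    by move=> xD yD; apply: oboundW B_large _; apply: (fw_bound bw).
  apply: wps_seq; apply: wps_post; first exact: wps_check_diag f2.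
  move=> st3 [e3 r3 h3].
  have c3 : reg st3 rC = reg st rC by rewrite r3.
  apply: wps_if2; first by evs.
    move=> g; apply: wps_skip; split=> //; case: h3 => [[f3 _]|[f3 [l lD]]].
      by move: g; rewrite f3.
    rewrite /nneg eT // negbK => nn; left; split=> // v _.
    by apply: (unsat_cycle n0 pM (leqnn _) lD nn).
  move=> g; case: h3 => [[f3 dg]|[f3 _]]; last by move: g; rewrite f3.
  apply: wps_seq; apply: wps_post; first exact: wps_check_unary f3.
  move=> st4 [e4 r4 h4].
  have c4 : reg st4 rC = reg st rC by rewrite r4.
  have e43 b x y : entries st4 b x y = entries st2 b x y by rewrite e4 e3.
  have NE k : (k < N + N + N)%N -> (k.*2.+1 < D)%N /\ (k.*2 < D)%N.
    by rewrite /D /q; lia.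
  have unE k : (k < N + N + N)%N -> unary_ok (entries st3 true) k = unary_ok (fw w D) k.
    by move=> /NE[k1 k0]; rewrite /unary_ok !e3 !eT.
  apply: wps_if2; first by evs.
    move=> g'; apply: wps_skip; split=> //; case: h4 => [[f4 _]|[f4 [k kN]]].
      by move: g'; rewrite f4.
    rewrite unE // /unary_ok => nn; left; split=> //.
    have [k1 k0] := NE k kN; have bE : bar k.*2 = k.*2.+1 by rewrite /bar odd_double.
    move: nn; case Ea: (fw w D _ _) => [a|] //; case Eb: (fw w D _ _) => [b|] //.
    move=> nn v cv; apply: (@unsat_unary N es mu n M n0 pM k.*2 a b); rewrite ?bE //.
    - by rewrite -/q -/D -/w Ea /= lexx.
    - by rewrite -/q -/D -/w Eb /= lexx.
    - by rewrite ltNge.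
  move=> g'; case: h4 => [[f4 un]|[f4 _]]; last by move: g'; rewrite f4.
  apply: wps_post; first apply: wps_push => x y xD yD.
    by rewrite e43 eT //; apply: bT.
  move=> st5 [[u5 r5] e5 d5]; split; first by rewrite r5.
  right; split; first by rewrite r5.
  have eM x y : entries st4 false x y = M x y by rewrite e43 u2 u1.
  apply: (squared_specP es_lt es_bar es_mu n0 pM stg _ _ (T := entries st4 true)).
  - by move=> k kD; rewrite /nneg -eT //; apply: dg.
  - by move=> k kN; rewrite -unE //; apply: un.
  - by move=> x y xD yD; rewrite e43 eT.
  - exact: e5.
  - have ge x y : grows N (entries st4 true) (entries st4 false) x y
                 = grows N (entries st4 true) M x y by rewrite /grows eM.
    case: d5 => [[d0 ng]|[d1 [x [y gx]]]]; [left|right]; split=> //.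
      by move=> x y; rewrite -ge.
    by exists x, y; rewrite -ge.
by rewrite /D; nia.
Qed.

End Square.

End Specs.

(** * Reading the input, iterating the squaring, and the verdict *)

Definition init_diag : com := For rI (K 2) (Min false (V rI) (V rI) (Cst 0)).

Definition field (k : int) : expr := Get (Add (V rP) (Cst k)).
Definition set_signs : com :=
  IfPos (field 0)
    (IfPos (Sub (field 0) (Cst 1))
      (Seq (Set_ rX (Cst 1)) (Set_ rY (Cst 0)))
      (Seq (Set_ rX (Cst 0)) (Set_ rY (Cst 1))))
    (Seq (Set_ rX (Cst 0)) (Set_ rY (Cst 0))).
(** [Min] is used because different atoms may give the same edge, as [u + v] and [v + u] do. The
    mirror edge has the sign bits complemented, by [1 - bit]. *)
Definition read_atom : com :=
  Seq set_signs
  (Seq (Min false (Add (twice (field 1)) (V rX)) (Add (twice (field 2)) (V rY)) (field 3))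
  (Seq (Min false (Sub (succ (twice (field 2))) (V rY)) (Sub (succ (twice (field 1))) (V rX))
         (field 3))
       (Set_ rP (Add (V rP) (Cst 4))))).
Definition read_input : com :=
  Seq (Set_ rP (Cst 2)) (For rC (Get (Cst 1)) read_atom).

Definition decide : com :=
  Seq (Set_ rFail (Cst 0)) (Seq init_diag (Seq read_input squarings)).

Lemma ole_set_min st b i j c x y d :
  ole (entries (set_entry st b i j (omin (entries st b i j) (Some c))) b x y) d =
  ole (entries st b x y) d || [&& x == i, y == j & c <= d].
Proof.
rewrite /= eqxx /=; case: (eqVneq x i) => [->|_]; last by rewrite orbF.
by case: (eqVneq y j) => [->|_]; rewrite ?orbF //= ole_omin.
Qed.

Lemma nth_flatten_const (T : Type) (x0 : T) m (ss : seq (seq T)) k j :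
  all (fun s => size s == m) ss -> (k < size ss)%N -> (j < m)%N ->
  nth x0 (flatten ss) (m * k + j) = nth x0 (nth [::] ss k) j.
Proof.
elim: ss k => [|s ss IH] [|k] //= /andP[/eqP sz h] kss jm; rewrite nth_cat sz.
  by rewrite muln0 add0n jm.
by rewrite mulnS -addnA ltnNge leq_addr /= addKn IH.
Qed.

Section Main.
Variables (N B : nat) (R : octagon N).
Hypothesis N0 : (0 < N)%N.
Let q := N.*2.
Let D := (q + q + q)%N.
Let es := oct_edges R.
Let inp (k : nat) : int := nth 0 (input_code R) k.
(** In the second case [M] is the matrix before the last squaring; it is exact because it is itself
    the result of a squaring. *)
Definition verdict (st : state) : Prop :=
  0 < reg st rFail /\ (exists2 n, (0 < n)%N & infeasible N es n) \/
  reg st rFail <= 0 /\ exists n M, [/\ (0 < n)%N, (3 ^ q <= n)%N,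
     power_matrix N es (mu R) n M, exact_matrix N es n M &
     squared_spec N es (mu R) n M (entries st false) (reg st rDiff)].

Lemma verdict_wf st : verdict st ->
  0 < reg st rFail \/ 0 < reg st rDiff -> well_founded_rel (oct_rel R).
Proof.
move=> v h [nu run]; have [z [cz sz]] := run_potential N0 run.
case: v => [[_ [n n0 inf]]|[f [n [M [n0 qn pM xM [pM' xM' d]]]]]].
  exact: inf cz (sz _).
case: d => [[d0 _]|[_ [x [y [d [xq yq h1 h2]]]]]]; first by case: h; lia.
move/negP: h2; apply; apply: (run_stable (@oct_edges_lt N R) qn cz sz xM pM' xq yq h1).
Qed.

Lemma verdict_not_wf st : verdict st ->
  reg st rFail <= 0 -> reg st rDiff <= 0 -> ~ well_founded_rel (oct_rel R).
Proof.
move=> v f d wf; apply: wf.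
case: v => [[f' _]|[_ [n [M [n0 qn pM xM [pM' xM' h]]]]]]; first by lia.
case: h => [[_ stab]|[d1 _]]; last by lia.
have [s hs] := stable_run n0 pM xM' stab.
exact: potential_run hs.
Qed.

Hypothesis B_small : (64 < B)%N.
Hypothesis D_small : (D < B)%N.
Hypothesis mu_small : (mu R <= B)%N.
Hypothesis size_small : (4 * size R + 2 <= B)%N.
Hypothesis B_large : (2 ^ D * (q * (2 ^ (q + q)).+1 * mu R) <= B)%N.
Local Notation wps := (wps B D (dims N) inp).
Local Notation evals := (evals B D (dims N) inp).

Lemma lt2D i : (i < q + q)%N -> (i < D)%N.
Proof. by move=> h; apply: leq_trans h (leq_addr _ _). Qed.

Lemma inp_atom a0 k j : (k < size R)%N -> (j < 4)%N ->
  inp (4 * k + 2 + j) = nth 0 (atom_code (nth a0 R k)) j.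
Proof.
move=> kR j4; rewrite /inp /input_code.
have -> : (4 * k + 2 + j = (4 * k + j).+2)%N by lia.
rewrite -[nth 0 _ _]/(nth 0 (flatten [seq atom_code a | a <- R]) (4 * k + j)).
rewrite (@nth_flatten_const _ 0 4) ?size_map // ?(nth_map a0) //.
apply/allP => s /mapP[[[sh [u v]] c] _ ->]; by [].
Qed.

Lemma wps_init_diag st : reg st rFail = 0 ->
  (forall x y, (x < D)%N -> (y < D)%N -> entries st false x y = None) ->
  wps init_diag (10 * D) (fun st' => reg st' rFail = 0 /\
    forall x y d, (x < q + q)%N -> (y < q + q)%N ->
      ole (entries st' false x y) d = (x == y) && (0 <= d)) st.
Proof.
move=> f0 e0; pose Inv (k : nat) st' := reg st' rFail = 0 /\
  forall x y d, (x < q + q)%N -> (y < q + q)%N ->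
      ole (entries st' false x y) d = [&& (x < k)%N, x == y & 0 <= d].
apply: wps_le; first apply: wps_post.
- apply: (wps_for (n := (q + q)%N) (s := 3) B_small (I := Inv)) => //.
  + by have := D_small; rewrite /D; lia.
  + exact: evals_2q.
  + by split=> // x y d xq yq; rewrite /= e0 // lt2D.
  + move=> k st1 kq hk [f1 h1]; have kD := lt2D kq.
    have evk : evals st1 (V rI) k%:Z by apply: evals_reg.
    apply: (wps_min B_small evk evk kD kD (v := 0)) => //.
    split=> //; split=> // x y d xq yq.
    rewrite [LHS](_ : _ = ole (entries (set_entry st1 false k k
      (omin (entries st1 false k k) (Some 0))) false x y) d) // ole_set_min h1 // ltnS.
    case: (ltngtP x k) => [xk|xk|->] //=; first by rewrite orbF.
    by rewrite eq_sym.
- by move=> st1 [f1 h1]; split=> // x y d xq yq; rewrite h1 // xq.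
- by rewrite /D; lia.
Qed.

Lemma wps_read_atom st (k : nat) (Q : state -> Prop) : (k < size R)%N ->
  reg st rP = (4 * k + 2)%N%:Z ->
  (forall st', reg st' rP = (4 * k.+1 + 2)%N%:Z ->
     (forall r, r \notin [:: rX; rY; rP] -> reg st' r = reg st r) ->
     (forall x y d, (x < q + q)%N -> (y < q + q)%N ->
        ole (entries st' false x y) d = ole (entries st false x y) d ||
          has (fun e => (e.1 == (x, y)) && (e.2 <= d)) (atom_edges (nth (Atom (Diff, (inl (Ordinal N0), inl (Ordinal N0))) 0) R k))) ->
     Q st') ->
  wps read_atom 20 Q st.
Proof.
(* [N0] supplies a variable for the default atom of [nth]. *)
set a0 := Atom _ _; move=> kR hp hQ.
have aR := mem_nth a0 kR; have ha := inp_atom a0 kR.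
move: (nth a0 R k) aR ha hQ => a aR ha hQ; case: a aR ha hQ => [[s [u v]] c] aR ha hQ.
have h0 := ha 0%N isT; have h1 := ha 1%N isT; have h2 := ha 2%N isT; have h3 := ha 3%N isT.
have evf st' j : reg st' rP = (4 * k + 2)%N%:Z -> evals st' (field j%:Z) (inp (4 * k + 2 + j)).
  by move=> hp'; apply: evals_input; apply: evals_eq; [apply: evals_add;
    [apply: evals_reg; [exact: hp'|by []]|apply: evals_cst]|].
have {ha} vu w : var_code w = (var_nat w)%:Z by case: w.
rewrite /= !vu in h0 h1 h2 h3.
have cB : (`|c| <= B)%N.
  apply: leq_trans mu_small; exact: (@leq_bigmax_seq _ R xpredT (fun a => `|rhs a|%N) _ aR isT).
apply: wps_le; first apply: wps_seq.
  apply: (wps_post (Q := fun st' =>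
    [/\ forall b x y, entries st' b x y = entries st b x y,
        forall r, r \notin [:: rX; rY] -> reg st' r = reg st r,
        reg st' rX = ((atom_shift s).1 : nat)%:Z &
        reg st' rY = ((atom_shift s).2 : nat)%:Z])).
    have ok (x y : int) (xb yb : nat) : x = xb%:Z -> y = yb%:Z -> (xb < 2)%N -> (yb < 2)%N ->
        xb = (atom_shift s).1 -> yb = (atom_shift s).2 ->
        wps (Seq (Set_ rX (Cst x)) (Set_ rY (Cst y))) 2 (fun st' =>
    [/\ forall b x y, entries st' b x y = entries st b x y,
        forall r, r \notin [:: rX; rY] -> reg st' r = reg st r,
        reg st' rX = ((atom_shift s).1 : nat)%:Z &
        reg st' rY = ((atom_shift s).2 : nat)%:Z]) st.
      move=> -> -> x2 y2 xE yE; apply: (@wps_seq _ _ _ _ _ _ 1 1).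
      apply: (wps_set B_small (z := xb%:Z)) => //; first by have := B_small; lia.
      apply: (wps_set B_small (z := yb%:Z)) => //; first by have := B_small; lia.
      rewrite -xE -yE; split=> //= r; rewrite !inE !negb_or => /andP[/negbTE -> /negbTE ->].
      by [].
    apply: wps_if2; first exact: (evf st 0%N hp).
      rewrite h0 => s0; apply: wps_if2.
        apply: evals_sub; [exact: (evf st 0%N hp)|exact: evals_cst].
        rewrite h0 => s1; apply: (ok 1 0 1%N 0%N) => //; by case: s s0 s1 {h0 hQ ok aR}.
      rewrite h0 => s1; apply: (ok 0 1 0%N 1%N) => //; by case: s s0 s1 {h0 hQ ok aR}.
    rewrite h0 => s0; apply: (ok 0 0 0%N 0%N) => //; by case: s s0 {h0 hQ ok aR}.
  move=> st1 [e1 r1 x1 y1].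
  have hp1 : reg st1 rP = (4 * k + 2)%N%:Z by rewrite r1.
  case sE: (atom_shift s) x1 y1 => [bu bv] /= x1 y1.
  have lt (w : var N) (b : bool) : ((var_nat w).*2 + b < D)%N.
    by apply: lt2D; apply: signed_lt.
  have ev1 st' j z : reg st' rP = (4 * k + 2)%N%:Z -> inp (4 * k + 2 + j) = z ->
    evals st' (field j%:Z) z by move=> hp' <-; apply: evf.
  apply: wps_seq; apply: (wps_min B_small (i := (var_nat u).*2 + bu) (j := (var_nat v).*2 + bv) _ _ _ _ (v := c)) => //.
  - apply: evals_eq; first apply: evals_add; [apply: evals_add; exact: (ev1 _ 1%N _ hp1 h1)|apply: evals_reg x1 _ => //|].
    by lia.
  - apply: evals_eq; first apply: evals_add; [apply: evals_add; exact: (ev1 _ 2%N _ hp1 h2)|apply: evals_reg y1 _ => //|].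
    by lia.
  - exact: (ev1 _ 3%N _ hp1 h3).
  set st2 := set_entry _ _ _ _ _.
  apply: wps_seq; apply: (wps_min B_small (i := (var_nat v).*2 + ~~ bv) (j := (var_nat u).*2 + ~~ bu) _ _ _ _ (v := c)) => //.
  - apply: evals_eq; first apply: evals_sub; [apply: evals_add; [apply: evals_add; exact: (ev1 st2 2%N _ hp1 h2)|exact: evals_cst]|apply: (@evals_reg _ _ _ _ st2 _ _ y1) => //|].
    by case: (bv); lia.
  - apply: evals_eq; first apply: evals_sub; [apply: evals_add; [apply: evals_add; exact: (ev1 st2 1%N _ hp1 h1)|exact: evals_cst]|apply: (@evals_reg _ _ _ _ st2 _ _ x1) => //|].
    by case: (bu); lia.
  - exact: (ev1 st2 3%N _ hp1 h3).
  set st3 := set_entry _ _ _ _ _.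
  apply: (wps_set B_small (z := (4 * k.+1 + 2)%N%:Z)) => //.
  - apply: evals_eq; first apply: evals_add; [apply: (@evals_reg _ _ _ _ st3 _ _ hp1) => //|exact: evals_cst|].
    by lia.
  - by have := size_small; lia.
  apply: hQ => //.
    by move=> r; rewrite !inE !negb_or => /and3P[n1 n2 n3]; rewrite /= (negbTE n3) r1 // !inE negb_or n1.
  move=> x y d xq yq; rewrite [LHS](_ : _ = ole (entries st3 false x y) d) //.
  rewrite ole_set_min ole_set_min e1 /atom_edges /= sE /= !xpair_eqE orbF -!orbA -!andbA.
  by rewrite !(eq_sym x) !(eq_sym y).
by [].
Qed.

Lemma wps_read_input st : reg st rFail = 0 ->
  (forall x y d, (x < q + q)%N -> (y < q + q)%N ->
      ole (entries st false x y) d = (x == y) && (0 <= d)) ->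
  wps read_input (25 * (size R).+1) (fun st' => reg st' rFail = 0 /\
     base_matrix N es (entries st' false)) st.
Proof.
move=> f0 e0; pose Inv (k : nat) st' := [/\ reg st' rFail = 0,
  reg st' rP = (4 * k + 2)%N%:Z &
  forall x y d, (x < q + q)%N -> (y < q + q)%N ->
      ole (entries st' false x y) d = (x == y) && (0 <= d) ||
        has (fun e => (e.1 == (x, y)) && (e.2 <= d)) (oct_edges (take k R))].
apply: wps_le; first apply: (@wps_seq _ _ _ _ _ _ 1); first apply: (wps_set B_small (z := 2)) => //.
  by have := B_small; lia.
  apply: wps_post; first apply: (wps_for (n := size R) (s := 20) B_small (I := Inv)) => //.
  - by have := size_small; lia.
  - by move=> st'; apply: (@evals_input _ _ _ _ st' (Cst 1) 1%N); apply: evals_cst.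
  - split=> // x y d xq yq; rewrite take0 orbF; exact: e0.
  - move=> k st1 kR hk [f1 p1 h1]; apply: (wps_read_atom kR p1) => st2 p2 r2 h2.
    split; rewrite ?r2 //; split=> //; first by rewrite /= r2.
    move=> x y d xq yq; rewrite /= h2 // h1 //.
    set a0 := Atom _ _; rewrite (take_nth a0 kR) /oct_edges map_rcons flatten_rcons has_cat.
    by rewrite orbA.
  - move=> st1 [f1 _ h1]; split=> // x y d xq yq; rewrite h1 //.
    by rewrite take_size.
by lia.
Qed.

Lemma wps_squarings st : reg st rFail = 0 -> base_matrix N es (entries st false) ->
  wps squarings (2000 * ((q + q).+1 * (D * (D * D).+1).+1)) verdict st.
Proof.
move=> f0 bM; pose Inv (k : nat) st' :=
  reg st' rFail = 1 /\ (exists2 n, (0 < n)%N & infeasible N es n) \/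
  reg st' rFail = 0 /\
  if k is k'.+1 then exists2 M, power_matrix N es (mu R) (2 ^ k') M /\
       ((0 < k')%N -> exact_matrix N es (2 ^ k') M) &
       squared_spec N es (mu R) (2 ^ k') M (entries st' false) (reg st' rDiff)
  else power_matrix N es (mu R) 1 (entries st' false).
have e2 k : (2 ^ k + 2 ^ k = 2 ^ k.+1)%N by rewrite expnS mul2n addnn.
apply: wps_le; first apply: wps_post.
- apply: (wps_for (n := (q + q).+1) (s := (1 + 1000 * (D * (D * D).+1).+1).+1) B_small (I := Inv)) => //.
  + by have := D_small; rewrite /D /q; lia.
  + move=> st'; apply: evals_eq; first apply: evals_add; [exact: evals_2q|exact: evals_cst|].
    by rewrite /q; lia.
  + right; split=> //; apply: base_power bM => //; [exact: oct_edges_lt|exact: oct_edges_mu].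
  + move=> k st1 kq hk h1; apply: wps_if2; first by evs.
      move=> f; apply: wps_skip; split=> //; case: h1 => [h1|[f1 _]]; first by left.
      by move: f; rewrite f1.
    move=> f; case: h1 => [[f1 _]|[f1 h1]]; first by move: f; rewrite f1.
    have pM : power_matrix N es (mu R) (2 ^ k) (entries st1 false).
      by case: k h1 {kq hk} => [|k] //= [M _ [p _ _]]; rewrite -e2.
    have xM : (0 < k)%N -> exact_matrix N es (2 ^ k) (entries st1 false).
      by case: k h1 {kq hk pM} => [|k] //= [M _ [_ x _]]; rewrite -e2.
    apply: wps_post; first apply: (wps_square _ _ _ _ _ _ _ _ f1 pM) => //.
    * exact: oct_edges_lt.
    * exact: oct_edges_bar.
    * exact: oct_edges_mu.
    * by rewrite expn_gt0.
    * apply: leq_trans B_large; rewrite leq_mul2l leq_mul2r leq_mul2l ltnS leq_pexp2l ?orbT //.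
    move=> st2 [c2 h2]; split; first by rewrite c2.
    case: h2 => [[f2 inf]|[f2 sq]]; [left|right]; split=> //.
      by exists (2 ^ k)%N => //; rewrite expn_gt0.
    by exists (entries st1 false).
- move=> st1 [[f1 inf]|[f1 [M [pM xM] sq]]]; [left|right]; rewrite f1; split=> //.
  have q0 : (0 < q)%N by rewrite double_gt0.
  exists (2 ^ (q + q))%N, M; split=> //; first by rewrite expn_gt0.
    by rewrite addnn -mul2n expnM leq_exp2r.
  by apply: xM; rewrite addn_gt0 q0.
- by rewrite /D /q; nia.
Qed.

Lemma wps_decide st :
  (forall x y, (x < D)%N -> (y < D)%N -> entries st false x y = None) ->
  wps decide (1 + (10 * D + (25 * (size R).+1 + 2000 * ((q + q).+1 * (D * (D * D).+1).+1))))
    verdict st.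
Proof.
move=> e0; apply: wps_seq; apply: (wps_set B_small (z := 0)) => //.
apply: wps_seq; apply: wps_post; first exact: wps_init_diag.
move=> st1 [f1 h1]; apply: wps_seq; apply: wps_post; first exact: wps_read_input.
by move=> st2 [f2 h2]; apply: wps_squarings.
Qed.

End Main.

(** * Initialization and time bound *)

Definition set_dims : com :=
  Seq (Put (Cst (const_addr 0)) (twice (Get (Cst 0))))
  (Seq (Put (Cst (const_addr 2)) (twice (K 0)))
  (Seq (Put (Cst (const_addr 1)) (Add (K 0) (K 2)))
       (Put (Cst (const_addr 3)) (Add (K 0) (Get (Cst 0)))))).
(** Consecutive row addresses differ by [8 * D], so a running subtraction fills the table. *)
Definition set_rows : com :=
  Seq (Set_ rI (Cst 0)) (Seq (Set_ rJ (Cst (- 64%:Z)))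
    (WhilePos (Sub (K 1) (V rI))
      (Seq (Put (Row (V rI)) (V rJ))
      (Seq (Set_ rJ (Sub (V rJ) (times8 (K 1))))
           (Set_ rI (Add (V rI) (Cst 1))))))).
Definition answer : com :=
  IfPos (V rFail) (Put (Cst 0) (Cst 1))
    (IfPos (V rDiff) (Put (Cst 0) (Cst 1)) (Put (Cst 0) (Cst 0))).
Definition termination_program : com := Seq set_dims (Seq set_rows (Seq decide answer)).

Section Correct.
Variables (N B : nat) (R : octagon N).
Hypothesis N0 : (0 < N)%N.
Let q := N.*2.
Let D := (q + q + q)%N.
Let inp (k : nat) : int := nth 0 (input_code R) k.
Hypothesis B_large : (2 ^ D * (q * (2 ^ (q + q)).+1 * (mu R).+1) + 8 * (D * D)
  + 4 * size R + 200 <= B)%N.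

Let B_small : (64 < B)%N.
Proof. by apply: leq_trans B_large; rewrite addnC. Qed.
Let cells_small : (8 * (D * D) + 64 < B)%N.
Proof.
apply: leq_trans B_large; move: (2 ^ D * _)%N (8 * (D * D))%N => a b; lia.
Qed.
Let D_small : (D < B)%N.
Proof.
have D0 : (0 < D)%N by rewrite /D /q; lia.
apply: leq_ltn_trans cells_small; apply: leq_trans (leq_addr _ _).
by rewrite mulnA leq_pmull // muln_gt0.
Qed.
Let pow_small : (2 ^ D * (q * (2 ^ (q + q)).+1 * mu R) <= B)%N.
Proof.
apply: leq_trans B_large; rewrite -!addnA; apply: leq_trans (leq_addr _ _).
by rewrite !leq_mul2l leqnSn !orbT.
Qed.
Let mu_small : (mu R <= B)%N.
Proof.
apply: leq_trans pow_small; rewrite mulnA leq_pmull // muln_gt0 expn_gt0 /=.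
by rewrite muln_gt0 double_gt0 N0.
Qed.
Let size_small : (4 * size R + 2 <= B)%N.
Proof.
apply: leq_trans B_large; move: (2 ^ D * _)%N (8 * (D * D))%N => a b; lia.
Qed.

Lemma var_code_bound (u : var N) : (`|var_code u| < 2 * N)%N.
Proof. by case: u => k /=; have := ltn_ord k; lia. Qed.

Lemma input_bounded : bounded B (input_mem R).
Proof.
have NB : (2 * N <= B)%N by apply: leq_trans (ltnW D_small); rewrite /D /q; lia.
have in_le x : x \in input_code R -> (`|x| <= B)%N.
  rewrite /input_code inE => /predU1P[->|]; first by apply: leq_trans NB; lia.
  rewrite inE => /predU1P[->|]; first by have := size_small; lia.
  case/flatten_mapP => a aR; case: a aR => [[s [u v]] c] aR.
  rewrite /atom_code /= !inE => /or4P[]/eqP ->.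
  - by case: s {aR}; have := B_small; rewrite /=; lia.
  - exact: ltnW (leq_trans (var_code_bound u) NB).
  - exact: ltnW (leq_trans (var_code_bound v) NB).
  - apply: leq_trans mu_small.
    exact: (@leq_bigmax_seq _ R xpredT (fun a => `|rhs a|%N) _ aR isT).
case=> [k|k] //=; case: (ltnP k (size (input_code R))) => h.
  exact/in_le/mem_nth.
by rewrite nth_default.
Qed.

(** Only component 4 of the cells is written, so all flags stay null and both matrices start without
    bounds. *)
Record rows_filled (i : nat) (m : memory) : Prop := RowsFilled {
  rf_bounded : bounded B m;
  rf_input : forall k : nat, m k%:Z = inp k;
  rf_const : forall c, (c < 4)%N -> m (const_addr c) = (dims N c)%:Z;
  rf_index : m (reg_addr rI) = i%:Z;
  rf_next : m (reg_addr rJ) = cell_addr D 0 i 0;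
  rf_row : forall j, (j < i)%N -> m (- (68 + 8 * j)%N%:Z) = cell_addr D 0 j 0;
  rf_zero : forall a x : nat, (a < 4)%N -> m (- (64 + 8 * x + a)%N%:Z) = 0
}.

Lemma wp_set_dims (Q : memory -> Prop) :
  (forall m, bounded B m -> (forall k : nat, m k%:Z = inp k) ->
     (forall c, (c < 4)%N -> m (const_addr c) = (dims N c)%:Z) ->
     (forall x, x < - 8%:Z -> m x = 0) -> Q m) ->
  wp B set_dims 4 Q (input_mem R).
Proof.
move=> hQ; have b0 := input_bounded.
have DB := D_small; rewrite /D in DB.
apply: (@wp_seq _ _ _ 1 3); apply: wp_put => //.
have -> : eval (input_mem R) (twice (Get (Cst 0))) = q%:Z by rewrite /= /q; lia.
set m1 := upd _ _ _.
have b1 : bounded B m1 by apply: upd_bounded => //; lia.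
have e1 : m1 (const_addr 0) = q%:Z by [].
apply: (@wp_seq _ _ _ 1 2); apply: wp_put => //.
have -> : eval m1 (twice (K 0)) = (q + q)%N%:Z by rewrite [LHS]/= e1; lia.
set m2 := upd _ _ _.
have b2 : bounded B m2 by apply: upd_bounded => //; lia.
have e2 : m2 (const_addr 2) = (q + q)%N%:Z by [].
have e2' : m2 (const_addr 0) = q%:Z by [].
apply: (@wp_seq _ _ _ 1 1); apply: wp_put => //.
have -> : eval m2 (Add (K 0) (K 2)) = D%:Z by rewrite [LHS]/= e2 e2' /D; lia.
set m3 := upd _ _ _.
have b3 : bounded B m3 by apply: upd_bounded => //; lia.
have e3 : m3 (const_addr 1) = D%:Z by [].
have e3' : m3 (const_addr 0) = q%:Z by [].
have e3'' : m3 0 = N%:Z by [].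
apply: wp_put => //.
have -> : eval m3 (Add (K 0) (Get (Cst 0))) = q%:Z + N%:Z by rewrite [LHS]/= e3' e3''.
rewrite [eval _ _]/=.
have far x : x != const_addr 0 -> x != const_addr 1 -> x != const_addr 2 ->
    x != const_addr 3 -> upd m3 (const_addr 3) (q%:Z + N%:Z) x = input_mem R x.
  by move=> h0 h1 h2 h3; rewrite upd_neqb // /m3 upd_neqb // /m2 upd_neqb // /m1 upd_neqb.
apply: hQ.
- by apply: upd_bounded => //; rewrite /q in DB *; lia.
- by move=> k; rewrite far.
- case=> [|[|[|[|//]]]] _.
  + exact: e3'.
  + exact: e3.
  + exact: e2.
  + by rewrite upd_eq /dims /= /q; lia.
- move=> x hx; rewrite far; try by apply/eqP; rewrite /const_addr; lia.
  by case: x hx => // k; lia.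
Qed.

Lemma wp_set_rows m : bounded B m -> (forall k : nat, m k%:Z = inp k) ->
  (forall c, (c < 4)%N -> m (const_addr c) = (dims N c)%:Z) ->
  (forall x, x < - 8%:Z -> m x = 0) ->
  wp B set_rows (D * 4 + 3) (rows_filled D) m.
Proof.
move=> bm hi hc hz; have CB := cells_small.
have -> : (D * 4 + 3 = 1 + (1 + (D * 4 + 1)))%N by lia.
apply: wp_seq; apply: wp_put => //; apply: wp_seq; apply: wp_put => /=.
  by apply: upd_bounded.
set m1 := upd _ _ _.
have DB := D_small.
apply: (wp_while (I := rows_filled)).
- move=> i m' iD [r1 r2 r3 r4 r5 r6 r7]; split=> //.
  by rewrite /= r3 // r4 /dims /= -/q -/D; lia.
- move=> i m' iD [r1 r2 r3 r4 r5 r6 r7].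
  have iDD : (i * D + D <= D * D)%N by rewrite -mulSnr leq_mul2r iD orbT.
  have cD (k : nat) : (k <= D)%N -> (`|cell_addr D 0 k 0| <= B)%N.
    move=> kD; rewrite /cell_addr !addn0.
    have : (k * D <= D * D)%N by rewrite leq_mul2r kD orbT.
    by move: (k * D)%N => t; move: CB; move: (D * D)%N => t'; lia.
  have rowE : eval m' (Row (V rI)) = - (68 + 8 * i)%N%:Z by rewrite /= r4; lia.
  apply: (@wp_seq _ _ _ 1 2); apply: wp_put => //; rewrite rowE.
  have -> : eval m' (V rJ) = cell_addr D 0 i 0 by exact: r5.
  set m2 := upd _ _ _.
  have b2 : bounded B m2 by apply: upd_bounded => //; apply: cD; apply: ltnW.
  have e2 x : - 64%:Z < x -> m2 x = m' x by move=> hx; rewrite /m2 upd_neqb //; apply/eqP; lia.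
  apply: (@wp_seq _ _ _ 1 1); apply: wp_put => //.
  have -> : eval m2 (Sub (V rJ) (times8 (K 1))) = cell_addr D 0 i.+1 0.
    rewrite /= !e2 // r5 r3 // /dims /= -/q -/D /cell_addr !addn0 (mulSn i D).
    by move: (i * D)%N => t; lia.
  set m3 := upd _ _ _.
  have b3 : bounded B m3 by apply: upd_bounded => //; apply: cD.
  have e3 x : - 64%:Z < x -> x != reg_addr rJ -> m3 x = m' x.
    by move=> hx nx; rewrite /m3 upd_neqb // e2.
  apply: wp_put => //.
  have -> : eval m3 (Add (V rI) (Cst 1)) = i.+1%:Z by rewrite /= e3 // r4; lia.
  rewrite [eval _ _]/=.
  have fr x : x < - 60%:Z -> x != - (68 + 8 * i)%N%:Z ->
      upd m3 (reg_addr rI) i.+1%:Z x = m' x.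
    move=> hx nx; rewrite upd_neqb; last by apply/eqP; rewrite /= /reg_addr; lia.
    rewrite /m3 upd_neqb; last by apply/eqP; rewrite /= /reg_addr; lia.
    by rewrite /m2 upd_neqb.
  split.
  + by apply: upd_bounded => //; lia.
  + by move=> k; rewrite upd_neqb // e3.
  + by move=> c c4; rewrite upd_neqb ?e3 ?r3 //; rewrite /const_addr /reg_addr; try apply/eqP; lia.
  + by rewrite upd_eq.
  + by rewrite upd_neqb // /m3 upd_eq.
  + move=> j; rewrite ltnS leq_eqVlt => /predU1P[->|ji].
      rewrite upd_neqb; last by apply/eqP; rewrite /= /reg_addr; lia.
      rewrite /m3 upd_neqb; last by apply/eqP; rewrite /= /reg_addr; lia.
      by rewrite /m2 upd_eq.
    by rewrite fr ?r6 //; try apply/eqP; lia.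
  + by move=> a x a4; rewrite fr ?r7 //; try apply/eqP; lia.
- have fr x : x < - 60%:Z -> m1 x = 0.
    move=> hx; rewrite /m1 upd_neqb; last by apply/eqP; rewrite /= /reg_addr; lia.
    by rewrite upd_neqb ?hz //; try (apply/eqP; rewrite /= /reg_addr); lia.
  split=> //.
  + by apply: upd_bounded; [apply: upd_bounded|exact: ltnW B_small].
  + by move=> c c4; rewrite /m1 !upd_neqb ?hc //; rewrite /const_addr /reg_addr; apply/eqP; lia.
  + by move=> a x a4; rewrite fr //; lia.
Qed.

Lemma rows_filled_represents m : rows_filled D m ->
  represents B D (dims N) inp (State (fun _ _ _ => None) (fun r => m (reg_addr r))) m.
Proof.
move=> [r1 r2 r3 r4 r5 r6 r7]; split=> // b i j iD jD /=.
by rewrite /cell_addr r7 //; case: b.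
Qed.

(** Summands in program order: dimensions, row table, decision, answer. *)
Definition step_bound : nat :=
  4 + (D * 4 + 3 + (1 + (10 * D + (25 * (size R).+1 +
    2000 * ((q + q).+1 * (D * (D * D).+1).+1))) + 3)).

Lemma termination_program_correct :
  wp B termination_program step_bound (fun m =>
    (m 0 = 1 /\ well_founded_rel (oct_rel R))
      \/ (m 0 = 0 /\ ~ well_founded_rel (oct_rel R))) (input_mem R).
Proof.
apply: wp_seq; apply: wp_set_dims => m b0 i0 c0 z0.
apply: wp_seq; apply: wp_mono (wp_set_rows b0 i0 c0 z0) => // m1 /rows_filled_represents rep1.
apply: wp_seq.
apply: wp_mono (wps_decide N0 B_small D_small mu_small size_small pow_small _ rep1) => //.
move=> m2 [st rep2 v].
have bm := rep_bounded rep2.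
have ef : eval m2 (V rFail) = reg st rFail by apply: (rep_reg rep2).
have ed : eval m2 (V rDiff) = reg st rDiff by apply: (rep_reg rep2).
apply: wp_if => //; rewrite ef => hf.
  apply: (wp_mono (s := 1) (Q := fun m => m 0 = 1 /\ well_founded_rel (oct_rel R))) => //.
    by move=> m' h; left.
  by apply: wp_put => //; rewrite /= upd_eq; split=> //; apply: (verdict_wf N0 v); left.
apply: wp_if => //; rewrite ed => hd; apply: wp_put => //=; rewrite upd_eq.
  by left; split=> //; apply: (verdict_wf N0 v); right.
by right; split=> //; apply: (verdict_not_wf N0 v).
Qed.

End Correct.

(** * Bounds on the number of steps and on the word length *)

Lemma one_bound_size N (R : octagon N) : one_bound_per_lhs R -> (size R <= 12 * N ^ 2)%N.
Proof.
move=> un; rewrite -(size_map (@lhs N)).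
pose V2 := enum {: ('I_N + 'I_N) * ('I_N + 'I_N)}.
pose all_lhs : seq (shape * (var N * var N)) :=
  [seq (s, p) | s <- [:: Diff; Plus; OppPlus], p <- V2].
(* Three shapes and [2N * 2N] ordered pairs of variables. *)
have -> : (12 * N ^ 2 = size all_lhs)%N.
  rewrite size_allpairs /V2 -cardE card_prod card_sum card_ord /=; nia.
apply: uniq_leq_size => // -[s p] _; apply/allpairsP; exists (s, p); split=> //=.
  by case: s.
by rewrite mem_enum.
Qed.

(** The summands cover the matrix entries during a closure, the cell addresses, the input pointer
    and small constants. In the first one, [2 ^ (6N)] is the growth over the stages, and the other
    factor bounds the weights of simple walks. *)
Definition memory_bound N (R : octagon N) : nat :=
  2 ^ (N.*2 + N.*2 + N.*2) * (N.*2 * (2 ^ (N.*2 + N.*2)).+1 * (mu R).+1)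
  + 8 * ((N.*2 + N.*2 + N.*2) * (N.*2 + N.*2 + N.*2)) + 4 * size R + 200.

Lemma bitlen_memory_bound N (R : octagon N) : (0 < N)%N -> one_bound_per_lhs R ->
  (bitlen (memory_bound R)%:Z <= 16 * (N + trunc_log 2 (mu R)))%N.
Proof.
move=> N0 /one_bound_size sz; set l := trunc_log 2 (mu R).
have mul : ((mu R).+1 <= 2 ^ l.+1)%N by apply: trunc_log_ltn.
have N2 : (N.*2 <= 2 ^ (2 * N))%N by rewrite -mul2n ltnW // ltn_expl.
have h1 : ((2 ^ (N.*2 + N.*2)).+1 <= 2 ^ (5 * N))%N.
  apply: (@leq_trans (2 ^ (4 * N).+1)%N); last by rewrite leq_pexp2l //; lia.
  rewrite (_ : N.*2 + N.*2 = 4 * N)%N; last lia.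
  by rewrite expnS mul2n -addnn -addn1 leq_add2l expn_gt0.
(* Exponents: [6N] for the stages, [2N] for the factor [N.*2], [5N] for the number of layers,
   [l + 1] for [mu R]. *)
have h2 : (2 ^ (N.*2 + N.*2 + N.*2) * (N.*2 * (2 ^ (N.*2 + N.*2)).+1 * (mu R).+1)
    <= 2 ^ (13 * N + l.+1))%N.
  have -> : (2 ^ (13 * N + l.+1) =
      2 ^ (N.*2 + N.*2 + N.*2) * (2 ^ (2 * N) * 2 ^ (5 * N) * 2 ^ l.+1))%N.
    by rewrite -!expnD; congr (2 ^ _)%N; lia.
  by apply: leq_mul => //; apply: leq_mul => //; apply: leq_mul.
have h3 : (8 * ((N.*2 + N.*2 + N.*2) * (N.*2 + N.*2 + N.*2)) + 4 * size R + 200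
    <= 2 ^ (13 * N))%N.
  apply: (@leq_trans (2 ^ 9 * (N.*2 * N.*2))); first by rewrite -!mul2n; move: sz; nia.
  apply: (@leq_trans (2 ^ (9 * N) * (2 ^ (2 * N) * 2 ^ (2 * N)))%N).
    by apply: leq_mul; [rewrite leq_pexp2l // leq_pmulr|apply: leq_mul].
  by rewrite -!expnD leq_pexp2l //; lia.
have h : (memory_bound R < 2 ^ (13 * N + l.+1 + 2))%N.
  have h4 : (2 ^ (13 * N) <= 2 ^ (13 * N + l.+1))%N by rewrite leq_pexp2l // leq_addr.
  have p : (0 < 2 ^ (13 * N + l.+1))%N by rewrite expn_gt0.
  have aux (a b c d e : nat) : (c <= a -> d + e + 200 <= b -> b <= a -> 0 < a ->
    c + d + e + 200 < a * 4)%N by lia.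
  by rewrite expnD; apply: aux h2 h3 h4 p.
rewrite /bitlen absz_nat; apply: (@leq_trans (13 * N + l.+1 + 2)%N); last by lia.
rewrite -(ltn_exp2l _ _ (ltnSn 1)); apply: leq_ltn_trans h.
by apply: trunc_logP => //; rewrite /memory_bound addn_gt0 orbT.
Qed.

Lemma step_bound_le N (R : octagon N) : (0 < N)%N -> one_bound_per_lhs R ->
  (step_bound R <= 3000 * 1000 * N ^ 4)%N.
Proof.
move=> N0 /one_bound_size sz; rewrite /step_bound.
have -> : (N.*2 = 2 * N)%N by rewrite mul2n.
move: sz; move: (size R) => k; rewrite (expnS N 3) (expnS N 2) (expnS N 1) expn1 => sz.
have [n1 n2] : (N <= N * N)%N /\ (N * N <= N * (N * N))%N by nia.
have n3 : (N * (N * N) <= N * (N * (N * N)))%N by nia.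
have n4 : (1 <= N * (N * (N * N)))%N by nia.
(* [4N + 1] squarings with a cubic closure in dimension [6N]; the leading coefficient is
   [4 * 6 ^ 3 = 864]. *)
have -> : ((2 * N + 2 * N).+1 * ((2 * N + 2 * N + 2 * N) *
  ((2 * N + 2 * N + 2 * N) * (2 * N + 2 * N + 2 * N)).+1).+1
  = 864 * (N * (N * (N * N))) + 216 * (N * (N * N)) + 24 * (N * N) + 10 * N + 1)%N by nia.
move: sz n1 n2 n3 n4; move: (N * (N * (N * N)))%N => a4; move: (N * (N * N))%N => a3.
move: (N * N)%N => a2; lia.
Qed.

(* trunc_log 2 is the floor of log2, with value 0 at 0; the rounding is absorbed
   by C since N >= 1. *)
Theorem theorem4p39 :
  exists (P : com) (C : nat),
    forall (N : nat) (hN : (1 <= N)%N) (R : octagon N),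
      exists (t : nat) (m : memory),
        [/\ exec P (input_mem R) t m,
            (m 0 = 1 /\ well_founded_rel (oct_rel R))
              \/ (m 0 = 0 /\ ~ well_founded_rel (oct_rel R))
          & one_bound_per_lhs R ->
              (t <= C * (N ^ 4 * (N + trunc_log 2 (mu R))))%N].
Proof.
exists termination_program, (3000 * 1000 * (ccost termination_program * 16))%N => N hN R.
have [s [m [ss r v]]] := @termination_program_correct N (memory_bound R) R hN (leqnn _).
have B0 : (0 < memory_bound R)%N by rewrite /memory_bound addn_gt0 orbT.
have [t ex tb] := run_exec B0 r.
exists t, m; split=> // ob; apply: leq_trans tb _.
apply: leq_trans (leq_mul (leq_trans ss (step_bound_le hN ob))
  (leq_mul (leqnn _) (bitlen_memory_bound hN ob))) _.
move: (ccost _) (trunc_log _ _) (3000 * 1000)%N => c l k.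
by move: (N ^ 4)%N (N + l)%N => a b; apply: eq_leq; lia.
Qed.
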